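(* Let $A=C(B_+)$ and $H=U(\mathfrak b_+)$ be as in the context. For a non-empty finite set $I\subset\mathbb N$ let $\Gamma_I$ be the differential calculus on $C(B_+)$ and $L_I$ the quantum tangent space on $U(\mathfrak b_+)$ defined in the context. (a) $I\mapsto\Gamma_I$ and $I\mapsto L_I$ are bijections from the non-empty finite subsets of $\mathbb N$ to the finite dimensional differential calculi on $C(B_+)$, respectively to the finite dimensional quantum tangent spaces on $U(\mathfrak b_+)$; $L_I$ is the quantum tangent space corresponding to $\Gamma_I$. Moreover $\dim\Gamma_I=\dim L_I=\left(\sum_{n\in I}n\right)-1$. The $\Gamma_I$ (and $L_I$) with $1\in I$ are in one-to-one correspondence with the finite dimensional differential calculi on $C_q(B_+)$ (and the finite dimensional quantum tangent spaces on $U_q(\mathfrak b_+)$), where $\Gamma_I$, $L_I$ with $1\in I$ correspond to the calculus $\Gamma^q_{I\setminus\{1\}}$ and the quantum tangent space $L^q_{I\setminus\{1\}}$ of the context. (b) Let $n\ge2$. The differential calculus $\Gamma_{\{1,n\}}$ of dimension $n$ (the one corresponding to the coirreducible $n$-dimensional calculus $\Gamma^q_{\{n\}}$ on $C_q(B_+)$) has a right invariant basis $\eta_0,\dots,\eta_{n-1}$ such that $$\mathrm dX=\eta_1+\eta_0X,\qquad \mathrm dg=\eta_0g,$$ $$[g,\eta_i]=0\ \ \forall i,\qquad [X,\eta_i]=\begin{cases}0&\text{if } i=0\text{ or } i=n-1,\\ \eta_{i+1}&\text{if } 0<i<n-1.\end{cases}$$ The braided derivations $\partial_i=\partial_{\phi_i}$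 obtained from the dual basis $\phi_0,\dots,\phi_{n-1}$ of the corresponding $L_{\{1,n\}}$ are $$\partial_if=\frac1{i!}\left(\frac{\partial}{\partial X}\right)^if\quad (1\le i\le n-1),\qquad \partial_0f=\left(X\frac{\partial}{\partial X}+g\frac{\partial}{\partial g}\right)f$$ for $f\in C(B_+)$. (c) For $n\ge 2$ the differential calculus $\Gamma_{\{n\}}$ of dimension $n-1$, obtained by removing $1$ from the characterising set in (b), is the same as the one in (b) except that one sets $\eta_0=0$ and $\partial_0=0$ (so that it has right invariant basis $\eta_1,\dots,\eta_{n-1}$ with the relations $\mathrm dX=\eta_1$, $\mathrm dg=0$, $[g,\eta_i]=0$ for $1\le i\le n-1$, $[X,\eta_i]=\eta_{i+1}$ for $1\le i<n-1$, and $[X,\eta_{n-1}]=0$).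
   Context: $\Bbbk$ is a field of characteristic $0$; $\mathbb N$ = positive integers. $C(B_+)=\Bbbk[X,g,g^{-1}]$ is the commutative Hopf algebra with $\Delta X=X\otimes1+g\otimes X$, $\Delta g=g\otimes g$, $\epsilon(X)=0$, $\epsilon(g)=1$, $S X=-g^{-1}X$, $S g=g^{-1}$. $U(\mathfrak b_+)$ is the enveloping algebra (with primitive generators) of the Lie algebra with generators $X,H$, $[H,X]=X$. They are paired by $\langle X^nH^m,X^rg^s\rangle=\delta_{n,r}\,n!\,s^m$ ($n,m,r\ge0$, $s\in\mathbb Z$). Differential calculi on a Hopf algebra $A$. ''Differential calculus'' means bicovariant first order differential calculus. By Woronowicz these are in bijection with left crossed submodules $M\subseteq\ker\epsilon\subset A$, i.e. subspaces with $AM\subseteq M$ and $\mathrm{Ad_L}(M)\subseteq A\otimes M$, $\mathrm{Ad_L}(v)=v_{(1)}S v_{(3)}\otimes v_{(2)}$. The calculus of $M$ is $\Gamma=(\ker\epsilon/M)\otimes A$ with right action $(v\otimes b)c=v\otimes bc$, left action $a(v\otimes b)=a_{(1)}v\otimes a_{(2)}b$, and $\mathrm da=\pi(\Delta a-1\otimes a)$, $\pi$ the canonical projection on the first factor. $\dim\Gamma:=\dim(\ker\epsilon/M)$; a right invariant basis is a basis of $\ker\epsilon/M$, with $v$ identified with $v\otimes1\in\Gamma$. $[a,\eta]=a\eta-\eta a$. A calculus is coirreducible if it is nonzero and has no proper nonzero quotient calculus. A quantum tangent space on a Hopf algebra $H$ paired with $A$ is a subspace $L\subseteq\ker\epsilon\subset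 H$ invariant under the left adjoint action $h\triangleright x=h_{(1)}xS h_{(2)}$ and with $x_{(1)}\otimes(x_{(2)}-\epsilon(x_{(2)})1)\in H\otimes L$ for $x\in L$. The one corresponding to the calculus of $M$ is $\{x\in\ker\epsilon\subset H:\langle x,m\rangle=0\ \forall m\in M\}$; it pairs with $\ker\epsilon/M$, and dual bases refer to this pairing. For $x\in L$, $\partial_x(a)=\langle x,a_{(1)}\rangle a_{(2)}$, $a\in A$. Classical correspondence: for non-empty finite $I\subset\mathbb N$, put $c_I(k)=\#\{n\in I:n>k\}$. $\Gamma_I$ is the calculus given by $M_I=\bigoplus_{k\ge0}X^k(1-g)^{c_I(k)}\,\Bbbk[g,g^{-1}]$ and $L_I=\mathrm{span}\{X^kH^j:k,j\ge0,\ (k,j)\ne(0,0),\ j<c_I(k)\}$. $q$-deformed setting: $C_q(B_+)=U_q(\mathfrak b_+)$ is the Hopf algebra over $\Bbbk(q)$ generated by $X,g,g^{-1}$ with $Xg=qgX$ and $\Delta X=X\otimes1+g\otimes X$, $\Delta g=g\otimes g$, $\epsilon(X)=0$, $\epsilon(g)=1$, $S X=-g^{-1}X$, $S g=g^{-1}$, self-paired by $\langle X^ng^m,X^rg^s\rangle=\delta_{n,r}[n]_q!\,q^{-n(n-1)/2}q^{-ms}$, where $[n]_q=\sum_{i=0}^{n-1}q^i$ and $[n]_q!=[1]_q\cdots[n]_q$. For a finite set $J\subset\mathbb N\setminus\{1\}$, $\Gamma^q_J$ is the calculus given by $\bigoplus_{k\ge0}X^k\prod_{n\in J\cup\{1\},n>k}(1-q^{1-n}g)\,\Bbbk(q)[g,g^{-1}]$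 and $L^q_J=\mathrm{span}\{g^{1-n}-1,\ X^kg^{1-n}:n\in J,1\le k\le n-1\}$; these are all finite dimensional calculi on $C_q(B_+)$ and all finite dimensional quantum tangent spaces on $U_q(\mathfrak b_+)$, and $\Gamma^q_{\{n\}}$, $n\ge2$, are the finite dimensional coirreducible calculi. *)

(* Defs.v *)
From HB Require Import structures.
From mathcomp Require Import all_boot all_order all_algebra ring_quotient.
From mathcomp Require Import finmap boolp classical_sets.
From mathcomp Require Import monalg zify.

Set Implicit Arguments.
Unset Strict Implicit.
Unset Printing Implicit Defensive.

Import GRing.Theory.

Local Open Scope classical_set_scope.
Local Open Scope ring_scope.
Local Open Scope quotient_scope.

Section LinearAlgebra.
Variable K : fieldType.
Implicit Types U V W : lmodType K.

Definition is_linear V W (f : V -> W) : Prop := linear f.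

Definition is_bilinear U V W (f : U -> V -> W) : Prop :=
  (forall v, is_linear (f^~ v)) /\ (forall u, is_linear (f u)).

Definition lspan V (W : set V) : set V :=
  [set v | exists n (c : 'I_n -> K) (w : 'I_n -> V),
     (forall i, W (w i)) /\ v = \sum_(i < n) c i *: w i].

Definition is_subspace V (W : set V) : Prop :=
  W 0 /\ forall (c : K) u v, W u -> W v -> W (c *: u + v).

Definition is_basis V (W : set V) n (b : 'I_n -> V) : Prop :=
  (forall i, W (b i)) /\
  (forall v, W v -> exists! c : {ffun 'I_n -> K}, v = \sum_(i < n) c i *: b i).

Definition has_dim V (W : set V) n : Prop :=
  exists b : 'I_n -> V, is_basis W b.

(* [lext f] is the linear extension of [f] to the free module on [B]. *)
Definition lext (B : choiceType) V (f : B -> V) (x : {malg K[B]}) : V :=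
  \sum_(b <- msupp x) x@_b *: f b.

End LinearAlgebra.

Section LinearAlgebraTheory.
Variable K : fieldType.
Implicit Types U V W : lmodType K.

Lemma is_linear0 V W (f : V -> W) : is_linear f -> f 0 = 0.
Proof. by move=> fl; have := fl (-1) 0 0; rewrite scaler0 addr0 scaleN1r addNr. Qed.

Lemma lextEw (B : choiceType) V (f : B -> V) (x : {malg K[B]}) (d : {fset B}) :
  (msupp x `<=` d)%fset -> lext f x = \sum_(b <- d) x@_b *: f b.
Proof.
move=> sxd; rewrite /lext (big_fset_incl _ sxd) //= => b _.
by move=> /mcoeff_outdom ->; rewrite scale0r.
Qed.

Lemma lext_is_linear (B : choiceType) V (f : B -> V) :
  is_linear (lext f : {malg K[B]} -> V).
Proof.
move=> c x y; pose d := (msupp x `|` msupp y `|` msupp (c *: x + y))%fset.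
rewrite !(@lextEw _ _ _ _ d) ?scaler_sumr -?big_split /=.
- apply: eq_bigr => b _; rewrite mcoeffD mcoeffZ scalerDl scalerA //.
- by apply/fsubsetP => b; rewrite !inE => ->; rewrite orbT.
- by apply/fsubsetP => b; rewrite !inE => ->.
- by apply/fsubsetP => b; rewrite !inE => ->; rewrite orbT.
Qed.

HB.instance Definition _ (B : choiceType) V (f : B -> V) :=
  GRing.isLinear.Build K {malg K[B]} V *:%R (lext f) (lext_is_linear f).

Lemma lextU (B : choiceType) V (f : B -> V) (b : B) :
  lext f (<< b >> : {malg K[B]}) = f b.
Proof.
rewrite (@lextEw _ _ _ _ [fset b]%fset); last by rewrite msuppU oner_eq0.
by rewrite big_seq_fset1 mcoeffUU scale1r.
Qed.

Lemma lextZU (B : choiceType) V (f : B -> V) c (b : B) :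
  lext f (c *: << b >> : {malg K[B]}) = c *: f b.
Proof. by rewrite linearZ /= lextU. Qed.

Lemma malg_lext (B : choiceType) (x : {malg K[B]}) :
  x = lext (fun b => << b >>) x.
Proof.
rewrite {1}[x]monalgE; apply: eq_bigr => b _.
by apply/eqP/eqP/malgP => k; rewrite mcoeffZ !mcoeffU mulrnAr mulr1.
Qed.

Lemma lext_uniq (B : choiceType) V (h : {malg K[B]} -> V) :
  is_linear h -> h =1 lext (fun b => h << b >>).
Proof.
move=> hl x; pose hL : {linear {malg K[B]} -> V} :=
  HB.pack h (GRing.isLinear.Build K _ V *:%R h hl).
rewrite -[h x]/(hL x) {1}[x]malg_lext linear_sum.
by apply: eq_bigr => b _; rewrite linearZ.
Qed.

Lemma eq_malg_lin (B : choiceType) V (h h' : {malg K[B]} -> V) :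
  is_linear h -> is_linear h' -> (forall b, h << b >> = h' << b >>) -> h =1 h'.
Proof.
move=> hl hl' e x; rewrite (lext_uniq hl) (lext_uniq hl').
by apply: eq_bigr => b _; rewrite e.
Qed.

Lemma lspan_subspace V (W : set V) : is_subspace (lspan W).
Proof.
split.
  by exists 0, (fun=> 0), (fun=> 0); split=> [[]|]; rewrite ?big_ord0.
move=> a u v [n [c [w [Ww ->]]]] [m [d [x [Wx ->]]]].
exists (n + m)%N,
  (fun i => match split i with inl j => a * c j | inr j => d j end),
  (fun i => match split i with inl j => w j | inr j => x j end).
split; first by move=> i; case: (split i).
rewrite big_split_ord /= scaler_sumr; congr (_ + _); apply: eq_bigr => i _.
  by case: split_ordP => j; [move/lshift_inj <-; rewrite scalerA
    | move/eqP; rewrite eq_lrshift].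
by case: split_ordP => j; [move/eqP; rewrite eq_rlshift
    | move/rshift_inj <-].
Qed.

Lemma sub_lspan V (W : set V) : W `<=` lspan W.
Proof.
move=> v Wv; exists 1%N, (fun=> 1), (fun=> v); split=> //.
by rewrite big_ord1 scale1r.
Qed.

End LinearAlgebraTheory.

Section QuotientConstruction.
Variables (K : fieldType) (V : lmodType K) (W : set V).

Definition qpred : {pred V} := [pred v | `[< lspan W v >]].

Lemma qpredP v : reflect (lspan W v) (v \in qpred).
Proof. by rewrite inE; apply: asboolP. Qed.

Lemma qpred_zmod : zmod_closed qpred.
Proof.
have [h0 hD] := lspan_subspace W; split; first exact/qpredP.
move=> x y /qpredP hx /qpredP hy; apply/qpredP.
by rewrite addrC -scaleN1r; apply: hD.
Qed.

HB.instance Definition _ := GRing.isZmodClosed.Build V qpred qpred_zmod.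

Definition preq := Quotient.quot qpred.
HB.instance Definition _ := GRing.Zmodule.on preq.

Let p (v : V) : preq := \pi_(Quotient.quot qpred) v.
Let r (x : preq) : V := repr (x : Quotient.quot qpred).

Let rK : cancel r p. Proof. exact: reprK. Qed.

Let p_eq u v : p u = p v <-> lspan W (u - v).
Proof.
split; first by move/eqP; rewrite -Quotient.idealrBE => /qpredP.
by move=> h; apply/eqP; rewrite -Quotient.idealrBE; apply/qpredP.
Qed.

Definition preq_scale (c : K) (x : preq) : preq := p (c *: r x).

Let scale_p c v : preq_scale c (p v) = p (c *: v).
Proof.
apply/p_eq; rewrite -scalerBr; have [h0 hD] := lspan_subspace W.
rewrite -[_ *: _]addr0; apply: hD => //.
by apply/p_eq; rewrite rK.
Qed.

Let pD : {morph p : x y / x + y}.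
Proof. by move=> x y; rewrite /p raddfD. Qed.

Fact preq_scaleA a b x : preq_scale a (preq_scale b x) = preq_scale (a * b) x.
Proof. by rewrite -[x]rK !scale_p scalerA. Qed.
Fact preq_scale1 : left_id 1 preq_scale.
Proof. by move=> x; rewrite -[x]rK !scale_p scale1r. Qed.
Fact preq_scaleDr : right_distributive preq_scale +%R.
Proof.
by move=> a x y; rewrite -[x]rK -[y]rK -pD !scale_p -pD scalerDr.
Qed.
Fact preq_scaleDl x : {morph preq_scale^~ x : a b / a + b}.
Proof. by move=> a b; rewrite -[x]rK !scale_p -pD scalerDl. Qed.

HB.instance Definition _ := GRing.Zmodule_isLmodule.Build K preq
  preq_scaleA preq_scale1 preq_scaleDr preq_scaleDl.

Lemma quotient_exists : {Q : lmodType K & {p : V -> Q & {r : Q -> V |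
  [/\ is_linear p, cancel r p & forall v, p v = 0 <-> lspan W v]}}}.
Proof.
exists preq, p, r; split; first by move=> c u v; rewrite pD -scale_p.
  exact: rK.
move=> v; have p0 : p 0 = 0 by rewrite /p raddf0.
by rewrite -[v in lspan W v]subr0 -p_eq p0.
Qed.

End QuotientConstruction.

(* [qmod W] is the quotient of [V] by the subspace spanned by [W]; it is only
   accessed through the properties in [quotient_exists]. *)
Section QuotientModule.
Variables (K : fieldType) (V : lmodType K) (W : set V).

Definition qmod : Type := projT1 (quotient_exists W).
HB.instance Definition _ := GRing.Lmodule.copy qmod (projT1 (quotient_exists W)).

Definition qproj : V -> qmod := projT1 (projT2 (quotient_exists W)).
Definition qrepr : qmod -> V := sval (projT2 (projT2 (quotient_exists W))).

Lemma qreprK : cancel qrepr qproj.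
Proof. by case: (svalP (projT2 (projT2 (quotient_exists W)))). Qed.

Lemma qproj_eq0 v : qproj v = 0 <-> lspan W v.
Proof. by case: (svalP (projT2 (projT2 (quotient_exists W)))). Qed.

Lemma qproj_is_linear : is_linear qproj.
Proof. by case: (svalP (projT2 (projT2 (quotient_exists W)))). Qed.

HB.instance Definition _ :=
  GRing.isLinear.Build K V qmod *:%R qproj qproj_is_linear.

Lemma qproj_eq u v : qproj u = qproj v <-> lspan W (u - v).
Proof.
split=> [e|/qproj_eq0/eqP].
  by apply/qproj_eq0; rewrite linearB /= e subrr.
by rewrite linearB subr_eq0 => /eqP.
Qed.

End QuotientModule.

Definition tensor_rel (K : fieldType) (U V : lmodType K) :
    set {malg K[(U * V)%type]} :=
  [set t | (exists (c : K) u u' v,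
              t = << (c *: u + u', v) >> - (c *: << (u, v) >> + << (u', v) >>)) \/
           (exists (c : K) u v v',
              t = << (u, c *: v + v') >> - (c *: << (u, v) >> + << (u, v') >>))].

Definition tensor (K : fieldType) (U V : lmodType K) := qmod (@tensor_rel K U V).
HB.instance Definition _ (K : fieldType) (U V : lmodType K) :=
  GRing.Lmodule.on (tensor U V).

HB.lock Definition tens (K : fieldType) (U V : lmodType K) (u : U) (v : V) :
  tensor U V := qproj (@tensor_rel K U V) << (u, v) >>.

(* Sweedler-style evaluation: if [t] is the sum of the [u_i (x) v_i] then
   [tlift f t] is the sum of the [f u_i v_i].  A representative of [t] is
   chosen; for bilinear [f] the value does not depend on it
   ([tlift_tens], [tlift_is_linear]). *)
HB.lock Definition tlift (K : fieldType) (U V W : lmodType K) (f : U -> V -> W)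
  (t : tensor U V) : W := lext (fun p => f p.1 p.2) (qrepr t).

Arguments tens {K U V} u v.
Arguments tlift {K U V W} f t.
Notation "u (x) v" := (tens u v) (at level 40, format "u  (x)  v").

Section Tensor.
Variables (K : fieldType) (U V : lmodType K).

Local Notation free := {malg K[(U * V)%type]}.
Local Notation tens := (@tens K U V).
Local Notation tensor := (tensor U V).
Local Notation tensor_rel := (@tensor_rel K U V).

Lemma tens_is_bilinear : is_bilinear tens.
Proof.
split=> [v c u u' | u c v v']; rewrite !tens.unlock -linearP; apply/qproj_eq.
  by apply: sub_lspan; left; exists c, u, u', v.
by apply: sub_lspan; right; exists c, u, v, v'.
Qed.

Lemma tliftE (W : lmodType K) (f : U -> V -> W) (x : free) : is_bilinear f ->
  tlift f (qproj tensor_rel x) = lext (fun p => f p.1 p.2) x.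
Proof.
rewrite tlift.unlock => -[fl fr]; apply/eqP; rewrite -subr_eq0 -linearB /=; apply/eqP.
have [n [c [w [Ww ->]]]] : lspan tensor_rel (qrepr (qproj tensor_rel x) - x).
  by apply/qproj_eq; rewrite qreprK.
rewrite linear_sum big1 // => i _; rewrite linearZ /=.
suff -> : lext (fun p => f p.1 p.2) (w i) = 0 by rewrite scaler0.
case: (Ww i) => [[a [u [u' [v ->]]]] | [a [u [v [v' ->]]]]];
  by rewrite linearB linearP /= !lextU /= ?fl ?fr subrr.
Qed.

Lemma tlift_is_linear (W : lmodType K) (f : U -> V -> W) :
  is_bilinear f -> is_linear (tlift f).
Proof.
move=> fb c x y; rewrite -[x]qreprK -[y]qreprK -linearP /=.
by rewrite !tliftE // linearP.
Qed.

Lemma tlift_tens (W : lmodType K) (f : U -> V -> W) u v :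
  is_bilinear f -> tlift f (tens u v) = f u v.
Proof. by move=> fb; rewrite tens.unlock tliftE // lextU. Qed.

Lemma eq_tensor_lin (W : lmodType K) (h h' : tensor -> W) :
  is_linear h -> is_linear h' -> (forall u v, h (tens u v) = h' (tens u v)) ->
  h =1 h'.
Proof.
move=> hl hl' e t; rewrite -[t]qreprK.
apply: (@eq_malg_lin _ _ _ (h \o qproj tensor_rel) (h' \o qproj tensor_rel)).
- by move=> c x y /=; rewrite linearP hl.
- by move=> c x y /=; rewrite linearP hl'.
- by move=> [u v]; have := e u v; rewrite tens.unlock.
Qed.

Lemma eq_tlift (W : lmodType K) (f g : U -> V -> W) :
  (forall u v, f u v = g u v) -> tlift f =1 tlift g.
Proof. by move=> e t; rewrite tlift.unlock; apply: eq_bigr => p _; rewrite e. Qed.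

End Tensor.

(* An algebraic Hahn-Banach argument, used to see that a tensor product of
   nonzero algebras is nonzero. *)
Lemma separating_functional (K : fieldType) (V : lmodType K) (e : V) :
  e <> 0 -> exists f : V -> K^o, is_linear f /\ f e = 1.
Proof.
move=> e0; pose P : set (set V) :=
  [set W | (forall (c : K) u v, W u -> W v -> W (c *: u + v)) /\ ~ W e].
have [F FP Ftot|W [[WD We] Wmax]] := @Zorn_bigcup _ P.
  split; last by move=> [X /FP[_ ?]].
  move=> c u v [X FX Xu] [Y FY Yv].
  have [XY|YX] := Ftot _ _ FX FY.
    by exists Y => //; apply: (FP _ FY).1 => //; apply: XY.
  by exists X => //; apply: (FP _ FX).1 => //; apply: YX.
have W0 : W 0.
  have [//|nW0] := pselect (W 0).
  case: (Wmax (W `|` [set 0])).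
    by split=> [x ?|/(_ 0)]; [left | move=> h; apply: nW0; apply: h; right].
  have nW u : ~ W u.
    by move=> Wu; apply: nW0; rewrite -[0](addNr u) -scaleN1r; apply: WD.
  split; first by move=> c u v [/nW//|->] [/nW//|->]; right; rewrite scaler0 addr0.
  by case.
have WZ c u : W u -> W (c *: u) by move=> Wu; rewrite -[_ *: _]addr0; apply: WD.
have WA u v : W u -> W v -> W (u + v).
  by move=> Wu Wv; rewrite -[u]scale1r; apply: WD.
have WB u v : W u -> W v -> W (u - v).
  by move=> Wu Wv; apply: WA => //; rewrite -scaleN1r; apply: WZ.
have ex x : exists c : K^o, W (x - c *: e).
  have [Wx|nWx] := pselect (W x); first by exists 0; rewrite scale0r subr0.
  apply: contrapT => nex.
  case: (Wmax [set y | exists (c : K) w, W w /\ y = w + c *: x]).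
    split; first by move=> w Ww; exists 0, w; rewrite scale0r addr0.
    move=> h; apply: nWx; apply: h; exists 1, 0.
    by rewrite add0r scale1r.
  split.
    move=> c u v [a [w [Ww ->]]] [b [w' [Ww' ->]]].
    exists (c * a + b), (c *: w + w'); split; first exact: WD.
    by rewrite scalerDl scalerDr scalerA addrACA.
  move=> [c [w [Ww ee]]]; have c0 : c != 0.
    by apply/eqP => c0; apply: We; rewrite ee c0 scale0r addr0.
  apply: nex; exists c^-1; rewrite ee scalerDr scalerA mulVf // scale1r.
  by rewrite opprD addrCA subrr addr0 -scaleNr; apply: WZ.
have uniq x (c d : K) : W (x - c *: e) -> W (x - d *: e) -> c = d.
  move=> hc hd; apply/eqP; rewrite -subr_eq0; apply/negP => cd0; apply: We.
  have := WB _ _ hd hc; rewrite opprB addrC addrA subrK -scalerBl => h.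
  have := WZ (c - d)^-1 _ h; rewrite scalerA mulVf ?scale1r //.
  exact/negP.
pose f x := xget 0 [set c : K^o | W (x - c *: e)].
have fP x : W (x - f x *: e) by rewrite /f; case: xgetP => [c _ //|h]; case: (ex x) => c /h.
exists f; split=> [c u v|].
  apply: (uniq _ _ _ (fP _)).
  rewrite scalerDl opprD addrACA -scalerA -scalerBr; exact: WD.
by apply: (uniq _ _ _ (fP _)); rewrite scale1r subrr.
Qed.

Section TensorAlgebra.
Variable K : fieldType.

Lemma tensDl (U V : lmodType K) c (u u' : U) (v : V) :
  (c *: u + u') (x) v = c *: (u (x) v) + u' (x) v.
Proof. exact: (tens_is_bilinear U V).1. Qed.

Lemma tensDr (U V : lmodType K) c (u : U) (v v' : V) :
  u (x) (c *: v + v') = c *: (u (x) v) + u (x) v'.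
Proof. exact: (tens_is_bilinear U V).2. Qed.

Lemma tlift_linear_fun (U V W : lmodType K) c (f g : U -> V -> W) t :
  tlift (fun u v => c *: f u v + g u v) t = c *: tlift f t + tlift g t.
Proof.
rewrite tlift.unlock /lext scaler_sumr -big_split /=; apply: eq_bigr => p _.
by rewrite scalerDr !scalerA mulrC.
Qed.

Lemma mulr_linl (A : algType K) c (x y z : A) :
  (c *: x + y) * z = c *: (x * z) + y * z.
Proof. by rewrite mulrDl scalerAl. Qed.

Lemma mulr_linr (A : algType K) c (x y z : A) :
  z * (c *: x + y) = c *: (z * x) + z * y.
Proof. by rewrite mulrDr scalerAr. Qed.

Variables A B : algType K.
Implicit Types s t u : tensor A B.

Definition tmul s t : tensor A B :=
  tlift (fun a b => tlift (fun c d => (a * c) (x) (b * d)) t) s.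

Let tm0 a b : is_bilinear (fun c d => (a * c) (x) (b * d) : tensor A B).
Proof. by split=> [d k c c' | c k d d']; rewrite mulr_linr ?tensDl ?tensDr. Qed.

Let tm1 t :
  is_bilinear (fun a b => tlift (fun c d => (a * c) (x) (b * d)) t : tensor A B).
Proof.
by split=> [b k a a' | a k b b']; rewrite -tlift_linear_fun; apply: eq_tlift => *;
  rewrite mulr_linl ?tensDl ?tensDr.
Qed.

Lemma tmul_linl t : is_linear (tmul^~ t).
Proof. exact/tlift_is_linear. Qed.

Lemma tmul_linr s : is_linear (tmul s).
Proof.
move=> c t t'; rewrite /tmul -tlift_linear_fun; apply: eq_tlift => a b.
exact/tlift_is_linear.
Qed.

Lemma tmul_tens a b c d : tmul (a (x) b) (c (x) d) = (a * c) (x) (b * d).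
Proof. by rewrite /tmul tlift_tens ?tlift_tens. Qed.

Fact tmulA : associative tmul.
Proof.
move=> s t u; move: s; apply: eq_tensor_lin.
- exact: tmul_linl.
- by move=> c x y; rewrite !tmul_linl.
move=> a b; move: t; apply: eq_tensor_lin.
- by move=> c x y; rewrite tmul_linl tmul_linr.
- by move=> c x y; rewrite tmul_linr tmul_linl.
move=> c d; move: u; apply: eq_tensor_lin.
- by move=> k x y; rewrite !tmul_linr.
- exact: tmul_linr.
by move=> e f; rewrite !tmul_tens !mulrA.
Qed.

Fact tmul1l : left_id (1 (x) 1) tmul.
Proof.
by apply: eq_tensor_lin; [exact: tmul_linr | by [] | move=> a b; rewrite tmul_tens !mul1r].
Qed.

Fact tmul1r : right_id (1 (x) 1) tmul.
Proof.
by apply: eq_tensor_lin; [exact: tmul_linl | by [] | move=> a b; rewrite tmul_tens !mulr1].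
Qed.

Fact tmulDl : left_distributive tmul +%R.
Proof. by move=> s t u; have := tmul_linl u 1 s t; rewrite !scale1r. Qed.

Fact tmulDr : right_distributive tmul +%R.
Proof. by move=> s t u; have := tmul_linr s 1 t u; rewrite !scale1r. Qed.

Fact tens1_neq0 : (1 : A) (x) (1 : B) != 0.
Proof.
have [f [fl f1]] := separating_functional (elimN eqP (oner_neq0 A)).
have [g [gl g1]] := separating_functional (elimN eqP (oner_neq0 B)).
pose h a b : K^o := f a * g b.
have hb : is_bilinear h.
  split=> [b c a a' | a c b b']; rewrite /h ?fl ?gl.
    by rewrite mulrDl -scalerAl.
  by rewrite mulrDr -scalerAr.
have h0 : tlift h 0 = 0.
  exact/is_linear0/tlift_is_linear.
apply/eqP => e; have /eqP := tlift_tens 1 1 hb.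
by rewrite e h0 /h f1 g1 mulr1 eq_sym; apply/negP; apply: (@oner_neq0 K).
Qed.

HB.instance Definition _ := GRing.Zmodule_isNzRing.Build (tensor A B)
  tmulA tmul1l tmul1r tmulDl tmulDr tens1_neq0.

Fact tscaleAl k s t : k *: (s * t) = k *: s * t.
Proof.
have z u : tmul 0 u = 0 by apply: is_linear0 (tmul_linl u).
by have := tmul_linl t k s 0; rewrite z !addr0.
Qed.

HB.instance Definition _ :=
  GRing.Lmodule_isLalgebra.Build K (tensor A B) tscaleAl.

Fact tscaleAr k s t : k *: (s * t) = s * (k *: t).
Proof.
have z u : tmul u 0 = 0 by apply: is_linear0 (tmul_linr u).
by have := tmul_linr s k t 0; rewrite z !addr0.
Qed.

HB.instance Definition _ := GRing.Lalgebra_isAlgebra.Build K (tensor A B) tscaleAr.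

Lemma tens_mul (a c : A) (b d : B) :
  (a (x) b) * (c (x) d) = (a * c) (x) (b * d).
Proof. exact: tmul_tens. Qed.

End TensorAlgebra.

Record hopfAlg (K : fieldType) := HopfAlg {
  hcar :> algType K;
  cop : {linear hcar -> tensor hcar hcar};
  cou : {linear hcar -> K^o};
  ant : {linear hcar -> hcar};
  cop1 : cop 1 = 1;
  copM : {morph cop : a b / a * b};
  cou1 : cou 1 = 1;
  couM : {morph cou : a b / a * b};
  coassoc : forall a,
    tlift (fun b c => tlift (fun b1 b2 => b1 (x) (b2 (x) c)) (cop b)) (cop a) =
    tlift (fun b c => b (x) cop c) (cop a);
  counitl : forall a, tlift (fun b c => cou b *: c) (cop a) = a;
  counitr : forall a, tlift (fun b c => cou c *: b) (cop a) = a;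
  antipodel : forall a, tlift (fun b c => ant b * c) (cop a) = (cou a)%:A;
  antipoder : forall a, tlift (fun b c => b * ant c) (cop a) = (cou a)%:A }.

Arguments cop {K h}.
Arguments cou {K h}.
Arguments ant {K h}.

(* The Hopf axioms follow from their validity on algebra generators. *)
Section HopfFromGenerators.
Variables (K : fieldType) (A : algType K).
Variables (Delta : {linear A -> tensor A A}) (eps : {linear A -> K^o})
  (S : {linear A -> A}).
Hypotheses (Delta1 : Delta 1 = 1) (DeltaM : {morph Delta : a b / a * b}).
Hypotheses (eps1 : eps 1 = 1) (epsM : {morph eps : a b / a * b}).
Hypotheses (S1 : S 1 = 1) (SM : forall a b, S (a * b) = S b * S a).
Variable G : set A.
Hypothesis Ggen : forall P : A -> Prop, P 1 ->
  (forall (c : K) a b, P a -> P b -> P (c *: a + b)) ->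
  (forall a b, P a -> P b -> P (a * b)) -> (forall a, G a -> P a) -> forall a, P a.

Lemma tmul_ext (B C D E : algType K) (h h' h'' : tensor B C -> tensor D E) :
  is_linear h -> is_linear h' -> is_linear h'' ->
  (forall b c b' c', h ((b (x) c) * (b' (x) c')) = h' (b (x) c) * h'' (b' (x) c')) ->
  forall s t, h (s * t) = h' s * h'' t.
Proof.
move=> hl hl' hl'' e s t; move: s; apply: eq_tensor_lin.
- by move=> k x y; rewrite mulr_linl hl.
- by move=> k x y; rewrite hl' mulr_linl.
move=> b c; move: t; apply: eq_tensor_lin; last exact: e.
- by move=> k x y; rewrite mulr_linr hl.
- by move=> k x y; rewrite hl'' mulr_linr.
Qed.

Let assocr (c : A) := tlift (fun b1 b2 => b1 (x) (b2 (x) c)) : tensor A A -> _.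

Let assocr_bil c :
  is_bilinear (fun b1 b2 => b1 (x) (b2 (x) c) : tensor A (tensor A A)).
Proof. by split=> [v k x y | u k x y]; rewrite !(tensDl, tensDr). Qed.

Let assocr_lin c : is_linear (assocr c).
Proof. exact: tlift_is_linear. Qed.

Let lhs_bil : is_bilinear (fun b c => assocr c (Delta b)).
Proof.
split=> [c k x y | b k x y]; first by rewrite linearP assocr_lin.
rewrite -tlift_linear_fun; apply: eq_tlift => u v.
by rewrite !tensDr.
Qed.

Let rhs_bil : is_bilinear (fun b c => b (x) Delta c : tensor A (tensor A A)).
Proof.
by split=> [c k x y | b k x y]; rewrite ?linearP !(tensDl, tensDr).
Qed.

Let assocrM c d s t : assocr (c * d) (s * t) = assocr c s * assocr d t.
Proof.
apply: tmul_ext => // b b' a a'.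
rewrite tens_mul.
rewrite /assocr.
rewrite (tlift_tens _ _ (assocr_bil (c*d))).
rewrite (tlift_tens _ _ (assocr_bil c)).
rewrite (tlift_tens _ _ (assocr_bil d)).
rewrite tens_mul.
rewrite tens_mul.
by [].
Qed.

Fact gen_coassoc :
  (forall a, G a -> tlift (fun b c => assocr c (Delta b)) (Delta a) =
                    tlift (fun b c => b (x) Delta c) (Delta a)) ->
  forall a, tlift (fun b c => assocr c (Delta b)) (Delta a) =
            tlift (fun b c => b (x) Delta c) (Delta a).
Proof.
move=> hG; apply: Ggen => //.
- rewrite Delta1 !tlift_tens // !Delta1 /assocr tlift_tens //.
- move=> k a b ea eb; rewrite linearP (tlift_is_linear lhs_bil) ea eb.
  by rewrite (tlift_is_linear rhs_bil).
move=> a b ea eb; rewrite DeltaM.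
rewrite (@tmul_ext _ _ _ _ _ (tlift (fun b c => assocr c (Delta b)))
  (tlift (fun b c => assocr c (Delta b)))); try exact/tlift_is_linear; last first.
  by move=> x y x' y'; rewrite tens_mul !tlift_tens // DeltaM assocrM.
rewrite ea eb; symmetry.
apply: tmul_ext; try exact/tlift_is_linear.
by move=> x y x' y'; rewrite tens_mul !tlift_tens // DeltaM tens_mul.
Qed.

Let counitl_bil : is_bilinear (fun b c : A => eps b *: c).
Proof.
split=> [c k x y | b k x y]; first by rewrite linearP scalerDl -scalerA.
by rewrite scalerDr !scalerA mulrC.
Qed.

Let counitr_bil : is_bilinear (fun b c : A => eps c *: b).
Proof.
split=> [c k x y | b k x y]; last by rewrite linearP scalerDl -scalerA.
by rewrite scalerDr !scalerA mulrC.
Qed.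

Lemma tlift_mul (f : A -> A -> A) : is_bilinear f ->
  (forall a b a' b', f (a * a') (b * b') = f a b * f a' b') ->
  forall s t, tlift f (s * t) = tlift f s * tlift f t.
Proof.
move=> fb fM s t; have fl := tlift_is_linear fb.
move: s; apply: eq_tensor_lin.
- by move=> k x y; rewrite mulr_linl fl.
- by move=> k x y; rewrite fl mulr_linl.
move=> b c; move: t; apply: eq_tensor_lin.
- by move=> k x y; rewrite mulr_linr fl.
- by move=> k x y; rewrite fl mulr_linr.
by move=> b' c'; rewrite tens_mul !tlift_tens.
Qed.

Fact gen_counitl :
  (forall a, G a -> tlift (fun b c => eps b *: c) (Delta a) = a) ->
  forall a, tlift (fun b c => eps b *: c) (Delta a) = a.
Proof.
move=> hG; apply: Ggen => //.
- by rewrite Delta1 tlift_tens // eps1 scale1r.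
- by move=> k a b ea eb; rewrite linearP (tlift_is_linear counitl_bil) ea eb.
move=> a b ea eb; rewrite DeltaM tlift_mul ?ea ?eb // => x y x' y'.
by rewrite epsM -scalerAl -scalerAr scalerA.
Qed.

Fact gen_counitr :
  (forall a, G a -> tlift (fun b c => eps c *: b) (Delta a) = a) ->
  forall a, tlift (fun b c => eps c *: b) (Delta a) = a.
Proof.
move=> hG; apply: Ggen => //.
- by rewrite Delta1 tlift_tens // eps1 scale1r.
- by move=> k a b ea eb; rewrite linearP (tlift_is_linear counitr_bil) ea eb.
move=> a b ea eb; rewrite DeltaM tlift_mul ?ea ?eb // => x y x' y'.
by rewrite epsM -scalerAl -scalerAr scalerA.
Qed.

Let antl_bil (u v : A) : is_bilinear (fun b c : A => u * (S b * c) * v).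
Proof.
by split=> [c k x y | b k x y]; rewrite ?linearP !(mulr_linl, mulr_linr).
Qed.

Let antr_bil (u v : A) : is_bilinear (fun b c : A => u * (b * S c) * v).
Proof.
by split=> [c k x y | b k x y]; rewrite ?linearP !(mulr_linl, mulr_linr).
Qed.

Let antl_bil1 : is_bilinear (fun b c : A => S b * c).
Proof.
by split=> [c k x y | b k x y]; rewrite ?linearP !(mulr_linl, mulr_linr).
Qed.

Let antr_bil1 : is_bilinear (fun b c : A => b * S c).
Proof.
by split=> [c k x y | b k x y]; rewrite ?linearP !(mulr_linl, mulr_linr).
Qed.

Let antl_mid (u v : A) t :
  tlift (fun b c => u * (S b * c) * v) t = u * tlift (fun b c => S b * c) t * v.
Proof.
have l := tlift_is_linear antl_bil1.
move: t; apply: eq_tensor_lin; first exact: tlift_is_linear.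
  by move=> k x y; rewrite l !(mulr_linl, mulr_linr).
by move=> b c; rewrite !tlift_tens.
Qed.

Let antr_mid (u v : A) t :
  tlift (fun b c => u * (b * S c) * v) t = u * tlift (fun b c => b * S c) t * v.
Proof.
have l := tlift_is_linear antr_bil1.
move: t; apply: eq_tensor_lin; first exact: tlift_is_linear.
  by move=> k x y; rewrite l !(mulr_linl, mulr_linr).
by move=> b c; rewrite !tlift_tens.
Qed.

Fact gen_antl :
  (forall a, G a -> tlift (fun b c => S b * c) (Delta a) = (eps a)%:A) ->
  forall a, tlift (fun b c => S b * c) (Delta a) = (eps a)%:A.
Proof.
have l := tlift_is_linear antl_bil1.
move=> hG; apply: Ggen => //.
- by rewrite Delta1 tlift_tens // eps1 scale1r S1 mulr1.
- by move=> k a b ea eb; rewrite !linearP l ea eb scalerDl scalerA.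
move=> a b ea eb; rewrite DeltaM epsM.
pose e := eps a.
have key t : tlift (fun b c => S b * c) (Delta a * t) =
             (eps a)%:A * tlift (fun b c => S b * c) t.
  move: t; apply: eq_tensor_lin.
  - by move=> k x y; rewrite mulr_linr l.
  - by move=> k x y; rewrite l mulr_linr.
  move=> x y; rewrite tlift_tens // -scalerAl mul1r.
  have -> : eps a *: (S x * y) = S x * (eps a)%:A * y.
    by rewrite -scalerAr mulr1 scalerAl.
  rewrite -ea -antl_mid.
  move: (Delta a); apply: eq_tensor_lin.
  - by move=> k s t; rewrite mulr_linl l.
  - exact: tlift_is_linear.
  by move=> c d; rewrite tens_mul !tlift_tens // SM !mulrA.
by rewrite key eb -scalerAl mul1r scalerA.
Qed.

Fact gen_antr :
  (forall a, G a -> tlift (fun b c => b * S c) (Delta a) = (eps a)%:A) ->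
  forall a, tlift (fun b c => b * S c) (Delta a) = (eps a)%:A.
Proof.
have l := tlift_is_linear antr_bil1.
move=> hG; apply: Ggen => //.
- by rewrite Delta1 tlift_tens // eps1 scale1r S1 mulr1.
- by move=> k a b ea eb; rewrite !linearP l ea eb scalerDl scalerA.
move=> a b ea eb; rewrite DeltaM epsM.
have key t : tlift (fun b c => b * S c) (t * Delta b) =
             (eps b)%:A * tlift (fun b c => b * S c) t.
  move: t; apply: eq_tensor_lin.
  - by move=> k x y; rewrite mulr_linl l.
  - by move=> k x y; rewrite l mulr_linr.
  move=> x y; rewrite tlift_tens // -scalerAl mul1r.
  have -> : eps b *: (x * S y) = x * (eps b)%:A * S y.
    by rewrite -scalerAr mulr1 scalerAl.
  rewrite -eb -antr_mid.
  move: (Delta b); apply: eq_tensor_lin.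
  - by move=> k s t; rewrite mulr_linr l.
  - exact: tlift_is_linear.
  by move=> c d; rewrite tens_mul !tlift_tens // SM !mulrA.
by rewrite key ea -scalerAl mul1r scalerA mulrC.
Qed.

End HopfFromGenerators.

(* Algebras given by structure constants on a basis. *)
Record sctable (K : fieldType) := SCTable {
  scbase : choiceType;
  scone : scbase;
  scmul : scbase -> scbase -> {malg K[scbase]};
  scmulA : forall a b c,
    lext (fun d => scmul d c) (scmul a b) = lext (scmul a) (scmul b c);
  scmul1l : forall a, scmul scone a = << a >>;
  scmul1r : forall a, scmul a scone = << a >> }.

Definition scalg (K : fieldType) (T : sctable K) : Type := {malg K[scbase T]}.
HB.instance Definition _ (K : fieldType) (T : sctable K) :=
  GRing.Lmodule.on (scalg T).

HB.lock Definition scb (K : fieldType) (T : sctable K) (a : scbase T) : scalg T :=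
  << a >>.

HB.lock Definition sc_mul (K : fieldType) (T : sctable K) (x y : scalg T) :
  scalg T := lext (fun a => lext (scmul a) y) x.

(* linear extension from the basis *)
HB.lock Definition sclin (K : fieldType) (T : sctable K) (V : lmodType K)
  (f : scbase T -> V) (x : scalg T) : V := lext f x.

Section StructureConstants.
Variables (K : fieldType) (T : sctable K).
Local Notation scalg := (scalg T).
Local Notation scb := (@scb K T).
Local Notation sc_mul := (@sc_mul K T).

Lemma sc_mull y : is_linear (sc_mul^~ y).
Proof. by move=> c x x'; rewrite sc_mul.unlock linearP. Qed.

Lemma sc_mulr x : is_linear (sc_mul x).
Proof.
move=> c y y'; rewrite sc_mul.unlock /lext scaler_sumr -big_split /=.
apply: eq_bigr => a _; rewrite -/(lext (scmul a) _) linearP /= scalerDr.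
by rewrite !scalerA mulrC.
Qed.

Lemma sc_mulU a b : sc_mul (scb a) (scb b) = scmul a b.
Proof. by rewrite sc_mul.unlock scb.unlock !lextU. Qed.

Lemma eq_sc_lin (V : lmodType K) (h h' : scalg -> V) :
  is_linear h -> is_linear h' -> (forall a, h (scb a) = h' (scb a)) -> h =1 h'.
Proof. by rewrite scb.unlock; apply: eq_malg_lin. Qed.

Fact sc_mulA : associative sc_mul.
Proof.
move=> x y z; move: x; apply: eq_sc_lin.
- exact: sc_mull.
- by move=> c x x'; rewrite !sc_mull.
move=> a; move: y; apply: eq_sc_lin.
- by move=> c y y'; rewrite sc_mull sc_mulr.
- by move=> c y y'; rewrite sc_mulr sc_mull.
move=> b; move: z; apply: eq_sc_lin.
- by move=> c z z'; rewrite !sc_mulr.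
- exact: sc_mulr.
move=> c; rewrite !sc_mulU.
have -> : sc_mul (scb a) (scmul b c) = lext (scmul a) (scmul b c).
  by rewrite sc_mul.unlock scb.unlock lextU.
rewrite -scmulA sc_mul.unlock scb.unlock; apply: eq_bigr => d _.
by rewrite lextU.
Qed.

Fact sc_mul1l : left_id (scb (scone T)) sc_mul.
Proof.
apply: eq_sc_lin; first exact: sc_mulr; first by [].
by move=> a; rewrite sc_mulU scmul1l scb.unlock.
Qed.

Fact sc_mul1r : right_id (scb (scone T)) sc_mul.
Proof.
apply: eq_sc_lin; first exact: sc_mull; first by [].
by move=> a; rewrite sc_mulU scmul1r scb.unlock.
Qed.

Fact sc_mulDl : left_distributive sc_mul +%R.
Proof. by move=> x y z; have := sc_mull z 1 x y; rewrite !scale1r. Qed.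
Fact sc_mulDr : right_distributive sc_mul +%R.
Proof. by move=> x y z; have := sc_mulr x 1 y z; rewrite !scale1r. Qed.
Fact sc_one_neq0 : scb (scone T) != 0.
Proof. by rewrite scb.unlock monalgU_eq0 oner_eq0. Qed.

HB.instance Definition _ := GRing.Zmodule_isNzRing.Build scalg
  sc_mulA sc_mul1l sc_mul1r sc_mulDl sc_mulDr sc_one_neq0.

Fact sc_scaleAl k (x y : scalg) : k *: (x * y) = k *: x * y.
Proof.
have z : sc_mul 0 y = 0 by apply: is_linear0 (sc_mull y).
by have := sc_mull y k x 0; rewrite z !addr0.
Qed.
HB.instance Definition _ := GRing.Lmodule_isLalgebra.Build K scalg sc_scaleAl.

Fact sc_scaleAr k (x y : scalg) : k *: (x * y) = x * (k *: y).
Proof.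
have z : sc_mul x 0 = 0 by apply: is_linear0 (sc_mulr x).
by have := sc_mulr x k y 0; rewrite z !addr0.
Qed.
HB.instance Definition _ := GRing.Lalgebra_isAlgebra.Build K scalg sc_scaleAr.

Lemma scbM a b : scb a * scb b = scmul a b.
Proof. exact: sc_mulU. Qed.

Lemma scb1 : scb (scone T) = 1.
Proof. by []. Qed.

Lemma sclin_is_linear (V : lmodType K) (f : scbase T -> V) :
  is_linear (sclin f).
Proof. by rewrite sclin.unlock; apply: lext_is_linear. Qed.

HB.instance Definition _ (V : lmodType K) (f : scbase T -> V) :=
  GRing.isLinear.Build K scalg V *:%R (sclin f) (sclin_is_linear f).

Lemma sclinE (V : lmodType K) (f : scbase T -> V) a : sclin f (scb a) = f a.
Proof. by rewrite sclin.unlock scb.unlock lextU. Qed.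

Lemma sclinM (V : lmodType K) (mu : V -> V -> V) (f : scbase T -> V) :
  is_bilinear mu -> (forall a b, sclin f (scmul a b) = mu (f a) (f b)) ->
  forall x y, sclin f (x * y) = mu (sclin f x) (sclin f y).
Proof.
move=> [mul mur] fM x y; move: x; apply: eq_sc_lin.
- by move=> c x x'; rewrite mulr_linl linearP.
- by move=> c x x'; rewrite linearP mul.
move=> a; move: y; apply: eq_sc_lin.
- by move=> c y y'; rewrite mulr_linr linearP.
- by move=> c y y'; rewrite linearP mur.
by move=> b; rewrite scbM !sclinE.
Qed.

Lemma sc_ind (P : scalg -> Prop) : P 1 ->
  (forall (c : K) a b, P a -> P b -> P (c *: a + b)) ->
  (forall a, P (scb a)) -> forall x, P x.
Proof.
move=> P1 PD; rewrite scb.unlock => Pb x; rewrite [x]malg_lext /lext.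
have P0 : P 0 by have := PD (-1) _ _ P1 P1; rewrite scaleN1r addNr.
elim/big_rec: _ => [|a y _ Py]; first exact: P0.
exact: PD (Pb a) Py.
Qed.

End StructureConstants.

Lemma mul_bil (K : fieldType) (A : algType K) : is_bilinear (fun x y : A => x * y).
Proof. by split=> [z c x y|z c x y]; rewrite ?mulr_linl ?mulr_linr. Qed.

Lemma mulop_bil (K : fieldType) (A : algType K) : is_bilinear (fun x y : A => y * x).
Proof. by split=> [z c x y|z c x y]; rewrite ?mulr_linl ?mulr_linr. Qed.

Lemma qcommX (K : fieldType) (A : algType K) (a b : A) c m :
  b * a = c *: (a * b) -> b * a ^+ m = c ^+ m *: (a ^+ m * b).
Proof.
move=> e; elim: m => [|m IH]; first by rewrite !expr0 mulr1 mul1r scale1r.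
by rewrite [a ^+ _]exprSr mulrA IH -scalerAl -(mulrA _ b) e -scalerAr scalerA mulrA -exprSr.
Qed.

Lemma tliftD (K : fieldType) (U V W : lmodType K) (f : U -> V -> W) s t :
  is_bilinear f -> tlift f (s + t) = tlift f s + tlift f t.
Proof. by move=> /tlift_is_linear fl; have := fl 1 s t; rewrite !scale1r. Qed.

Lemma tens0l (K : fieldType) (U V : lmodType K) (v : V) : (0 : U) (x) v = 0.
Proof. exact: is_linear0 ((tens_is_bilinear U V).1 v). Qed.

Lemma tens0r (K : fieldType) (U V : lmodType K) (u : U) : u (x) (0 : V) = 0.
Proof. exact: is_linear0 ((tens_is_bilinear U V).2 u). Qed.

Lemma tensAl (K : fieldType) (U V : lmodType K) (u u' : U) (v : V) :
  (u + u') (x) v = u (x) v + u' (x) v.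
Proof. by have := tensDl 1 u u' v; rewrite !scale1r. Qed.

Lemma tensAr (K : fieldType) (U V : lmodType K) (u : U) (v v' : V) :
  u (x) (v + v') = u (x) v + u (x) v'.
Proof. by have := tensDr 1 u v v'; rewrite !scale1r. Qed.

Lemma tensZl (K : fieldType) (U V : lmodType K) c (u : U) (v : V) :
  (c *: u) (x) v = c *: (u (x) v).
Proof. by rewrite -[c *: u]addr0 tensDl tens0l addr0. Qed.

Lemma tensZr (K : fieldType) (U V : lmodType K) c (u : U) (v : V) :
  u (x) (c *: v) = c *: (u (x) v).
Proof. by rewrite -[c *: v]addr0 tensDr tens0r addr0. Qed.

(* The algebra generated by X, g, g^-1 with X g = q g X.  The basis element
   (n, s) stands for X^n g^s. *)
Section Bq.
Variables (K : fieldType) (q : K) (q0 : q != 0).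

Local Notation B := (nat * int)%type.

Definition Bq_mul (a b : B) : {malg K[B]} :=
  (q ^ (- (a.2 * b.1%:Z)) : K) *: << ((a.1 + b.1)%N, a.2 + b.2) : B >>.

Fact Bq_mulA a b c :
  lext (fun d => Bq_mul d c) (Bq_mul a b) = lext (Bq_mul a) (Bq_mul b c).
Proof.
rewrite /Bq_mul.
rewrite [LHS]lextZU.
rewrite [RHS]lextZU.
rewrite ![(_,_).1]/= ![(_,_).2]/=.
rewrite !scalerA.
rewrite -!(expfzDr _ _ q0) addnA addrA; congr (q ^ _ *: _).
lia.
Qed.

Fact Bq_mul1l a : Bq_mul (0%N, 0) a = << a >>.
Proof. by case: a => n s; rewrite /Bq_mul /= mul0r oppr0 scale1r !add0r. Qed.

Fact Bq_mul1r a : Bq_mul a (0%N, 0) = << a >>.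
Proof. by case: a => n s; rewrite /Bq_mul /= mulr0 oppr0 scale1r addn0 addr0. Qed.

Definition Bq_table := SCTable Bq_mulA Bq_mul1l Bq_mul1r.
Local Notation A := (scalg Bq_table).

Definition Bq_mon (n : nat) (s : int) : A := scb (T := Bq_table) (n, s).
Local Notation mon := Bq_mon.
Local Notation X := (mon 1 0).
Local Notation g := (mon 0 1).

Lemma Bq_monM n s m t :
  mon n s * mon m t = q ^ (- (s * m%:Z)) *: mon (n + m) (s + t).
Proof. by rewrite /mon scbM scb.unlock. Qed.

Lemma Bq_gM s t : mon 0 s * mon 0 t = mon 0 (s + t).
Proof. by rewrite Bq_monM mulr0 oppr0 scale1r. Qed.

Lemma Bq_gX s n : mon n 0 * mon 0 s = mon n s.
Proof. by rewrite Bq_monM mulr0 oppr0 scale1r addn0 add0r. Qed.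

Lemma Bq_mon1 : mon 0 0 = 1.
Proof. exact: scb1. Qed.

Lemma Bq_XE n : X ^+ n = mon n 0.
Proof.
elim: n => [//|n IH]; rewrite exprS IH Bq_monM mul0r oppr0 scale1r.
by rewrite add1n addr0.
Qed.

Definition Bq_D : tensor A A := X (x) 1 + g (x) X.
Definition Bq_E (s : int) : tensor A A := mon 0 s (x) mon 0 s.
Definition Bq_copb (a : B) : tensor A A := Bq_D ^+ a.1 * Bq_E a.2.
Definition Bq_cop : A -> tensor A A := sclin (T := Bq_table) Bq_copb.
HB.instance Definition _ := GRing.Linear.on Bq_cop.

Definition Bq_coub (a : B) : K^o := (a.1 == 0%N)%:R.
Definition Bq_cou : A -> K^o := sclin (T := Bq_table) Bq_coub.
HB.instance Definition _ := GRing.Linear.on Bq_cou.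

Definition Bq_Y : A := - (mon 0 (-1) * X).
Definition Bq_antb (a : B) : A := mon 0 (- a.2) * Bq_Y ^+ a.1.
Definition Bq_ant : A -> A := sclin (T := Bq_table) Bq_antb.
HB.instance Definition _ := GRing.Linear.on Bq_ant.

Lemma Bq_gXcomm s : mon 0 s * X = q ^ (- s) *: (X * mon 0 s).
Proof. by rewrite Bq_gX Bq_monM mulr1 addr0. Qed.

Lemma Bq_ED s : Bq_E s * Bq_D = q ^ (- s) *: (Bq_D * Bq_E s).
Proof.
rewrite /Bq_D /Bq_E mulrDl mulrDr scalerDr !tens_mul !mulr1 !mul1r !Bq_gXcomm.
by rewrite tensZl tensZr !Bq_gM addrC [1 + s]addrC addrC.
Qed.

Lemma Bq_EM s t : Bq_E s * Bq_E t = Bq_E (s + t).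
Proof. by rewrite /Bq_E tens_mul Bq_gM. Qed.

Lemma Bq_copM : {morph Bq_cop : x y / x * y}.
Proof.
apply: sclinM; first exact: mul_bil.
move=> [n s] [m t]; rewrite -scbM -!/(mon _ _) Bq_monM linearZ /=.
rewrite sclinE /Bq_copb /= -mulrA [Bq_E s * _]mulrA (qcommX m (Bq_ED s)).
rewrite -scalerAl -scalerAr -!mulrA Bq_EM mulrA -exprD; congr (_ *: _).
by rewrite exprnP exprz_exp mulNr.
Qed.

Lemma Bq_couM : {morph Bq_cou : x y / x * y}.
Proof.
apply: sclinM; first exact: (mul_bil (K^o : algType K)).
move=> [n s] [m t]; rewrite -scbM -!/(mon _ _) Bq_monM linearZ /=.
rewrite sclinE /Bq_coub /= addn_eq0.
by case: n m => [|n] [|m] /=; rewrite ?(scaler0, mul0r, mulr0).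
Qed.

Lemma Bq_Ycomm s : Bq_Y * mon 0 s = q ^ s *: (mon 0 s * Bq_Y).
Proof.
rewrite /Bq_Y mulNr mulrN scalerN; congr (- _).
rewrite -mulrA Bq_gX mulrA Bq_gM !Bq_monM scalerA -expfzDr //.
by rewrite add0n addrC addr0; congr (q ^ _ *: mon _ _); lia.
Qed.

Lemma Bq_antM x y : Bq_ant (x * y) = Bq_ant y * Bq_ant x.
Proof.
move: x y; apply: (sclinM (mulop_bil A)) => -[n s] [m t].
rewrite -scbM -!/(mon _ _) Bq_monM linearZ /= sclinE /Bq_antb /=.
have e : Bq_Y ^+ m * mon 0 (- s) = q ^ (- (s * m%:Z)) *: (mon 0 (- s) * Bq_Y ^+ m).
  elim: m => [|k IH]; first by rewrite !expr0 mulr1 mul1r mulr0 oppr0 scale1r.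
  rewrite exprS -mulrA IH -scalerAr [Bq_Y * (_ * _)]mulrA Bq_Ycomm -scalerAl.
  by rewrite scalerA -mulrA -(expfzDr _ _ q0); congr (q ^ _ *: _); lia.
rewrite -mulrA [Bq_Y ^+ m * _]mulrA e -scalerAl -scalerAr -!mulrA -exprD.
by rewrite mulrA Bq_gM addnC opprD addrC.
Qed.

Definition Bq_gens : set A := [set x | [\/ x = X, x = g | x = mon 0 (-1)]].

Lemma Bq_gen_ind (P : A -> Prop) : P 1 ->
  (forall (c : K) a b, P a -> P b -> P (c *: a + b)) ->
  (forall a b, P a -> P b -> P (a * b)) -> (forall a, Bq_gens a -> P a) ->
  forall a, P a.
Proof.
move=> P1 PD PM PG; apply: sc_ind => // -[n s].
rewrite -/(mon n s) -Bq_gX; apply: (PM).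
  elim: n => [//|n IH]; rewrite -Bq_XE exprS Bq_XE.
  by apply: (PM) => //; apply: (PG); apply: Or31.
elim/int_ind: s => [//|s IH|s IH]; rewrite intS ?opprD -Bq_gM; apply: (PM) => //.
  by apply: (PG); apply: Or32.
by apply: (PG); apply: Or33.
Qed.

Lemma Bq_cop_mon n s : Bq_cop (mon n s) = Bq_D ^+ n * Bq_E s.
Proof. exact: sclinE. Qed.

Lemma Bq_copX : Bq_cop X = X (x) 1 + g (x) X.
Proof. by rewrite Bq_cop_mon expr1 /Bq_E Bq_mon1 mulr1. Qed.

Lemma Bq_copg s : Bq_cop (mon 0 s) = mon 0 s (x) mon 0 s.
Proof. by rewrite Bq_cop_mon expr0 mul1r. Qed.

Lemma Bq_cop1 : Bq_cop 1 = 1.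
Proof. by rewrite -Bq_mon1 Bq_copg Bq_mon1. Qed.

Lemma Bq_cou_mon n s : Bq_cou (mon n s) = (n == 0%N)%:R.
Proof. exact: sclinE. Qed.

Lemma Bq_cou1 : Bq_cou 1 = 1.
Proof. by rewrite -Bq_mon1 Bq_cou_mon. Qed.

Lemma Bq_ant_mon n s : Bq_ant (mon n s) = mon 0 (- s) * Bq_Y ^+ n.
Proof. exact: sclinE. Qed.

Lemma Bq_antg s : Bq_ant (mon 0 s) = mon 0 (- s).
Proof. by rewrite Bq_ant_mon expr0 mulr1. Qed.

Lemma Bq_antX : Bq_ant X = - (mon 0 (-1) * X).
Proof. by rewrite Bq_ant_mon oppr0 Bq_mon1 mul1r expr1. Qed.

Lemma Bq_ant1 : Bq_ant 1 = 1.
Proof. by rewrite -Bq_mon1 Bq_antg oppr0. Qed.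

Fact Bq_coassoc a :
  tlift (fun b c => tlift (fun b1 b2 => b1 (x) (b2 (x) c)) (Bq_cop b)) (Bq_cop a) =
  tlift (fun b c => b (x) Bq_cop c) (Bq_cop a).
Proof.
have b3 (c : A) : is_bilinear (fun b1 b2 => b1 (x) (b2 (x) c) : tensor A (tensor A A)).
  by split=> [v k x y | u k x y]; rewrite !(tensDl, tensDr).
have bl : is_bilinear
    (fun b c => tlift (fun b1 b2 => b1 (x) (b2 (x) c)) (Bq_cop b) : tensor A (tensor A A)).
  split=> [c k x y | b k x y]; first by rewrite linearP (tlift_is_linear (b3 c)).
  by rewrite -tlift_linear_fun; apply: eq_tlift => u v; rewrite !tensDr.
have br : is_bilinear (fun b c => b (x) Bq_cop c : tensor A (tensor A A)).
  by split=> [c k x y | b k x y]; rewrite ?linearP !(tensDl, tensDr).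
move: a; apply: (gen_coassoc Bq_cop1 Bq_copM Bq_gen_ind) => a; case=> ->.
- rewrite /= Bq_copX (tliftD _ _ bl) (tliftD _ _ br) !(tlift_tens _ _ bl).
  rewrite !(tlift_tens _ _ br) Bq_copX Bq_copg Bq_cop1 (tliftD _ _ (b3 _)).
  by rewrite !(tlift_tens _ _ (b3 _)) tensAr addrA.
- by rewrite /= Bq_copg (tlift_tens _ _ bl) (tlift_tens _ _ br) Bq_copg (tlift_tens _ _ (b3 _)).
- by rewrite /= Bq_copg (tlift_tens _ _ bl) (tlift_tens _ _ br) Bq_copg (tlift_tens _ _ (b3 _)).
Qed.

Fact Bq_counitl a : tlift (fun b c => Bq_cou b *: c) (Bq_cop a) = a.
Proof.
have bl : is_bilinear (fun b c : A => Bq_cou b *: c).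
  split=> [c k x y | b k x y]; first by rewrite linearP scalerDl -scalerA.
  by rewrite scalerDr !scalerA mulrC.
move: a; apply: (gen_counitl Bq_cop1 Bq_copM Bq_cou1 Bq_couM Bq_gen_ind) => a; case=> ->.
- rewrite /= Bq_copX (tliftD _ _ bl) !(tlift_tens _ _ bl) !Bq_cou_mon.
  by rewrite scale0r scale1r add0r.
- by rewrite /= Bq_copg (tlift_tens _ _ bl) Bq_cou_mon scale1r.
- by rewrite /= Bq_copg (tlift_tens _ _ bl) Bq_cou_mon scale1r.
Qed.

Fact Bq_counitr a : tlift (fun b c => Bq_cou c *: b) (Bq_cop a) = a.
Proof.
have bl : is_bilinear (fun b c : A => Bq_cou c *: b).
  split=> [c k x y | b k x y]; last by rewrite linearP scalerDl -scalerA.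
  by rewrite scalerDr !scalerA mulrC.
move: a; apply: (gen_counitr Bq_cop1 Bq_copM Bq_cou1 Bq_couM Bq_gen_ind) => a; case=> ->.
- rewrite /= Bq_copX (tliftD _ _ bl) !(tlift_tens _ _ bl) Bq_cou1 !Bq_cou_mon.
  by rewrite scale0r scale1r addr0.
- by rewrite /= Bq_copg (tlift_tens _ _ bl) Bq_cou_mon scale1r.
- by rewrite /= Bq_copg (tlift_tens _ _ bl) Bq_cou_mon scale1r.
Qed.

Fact Bq_antipodel a : tlift (fun b c => Bq_ant b * c) (Bq_cop a) = Bq_cou a *: (1 : A).
Proof.
have bl : is_bilinear (fun b c : A => Bq_ant b * c).
  by split=> [c k x y | b k x y]; rewrite ?linearP !(mulr_linl, mulr_linr).
move: a; apply: (gen_antl Bq_cop1 Bq_copM Bq_cou1 Bq_couM Bq_ant1 Bq_antM Bq_gen_ind) => a; case=> ->.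
- rewrite /= Bq_copX (tliftD _ _ bl) !(tlift_tens _ _ bl) Bq_antX Bq_antg mulr1 addNr.
  by rewrite Bq_cou_mon scale0r.
- by rewrite /= Bq_copg (tlift_tens _ _ bl) Bq_antg Bq_gM addNr Bq_cou_mon scale1r.
- by rewrite /= Bq_copg (tlift_tens _ _ bl) Bq_antg Bq_gM addNr Bq_cou_mon scale1r.
Qed.

Fact Bq_antipoder a : tlift (fun b c => b * Bq_ant c) (Bq_cop a) = Bq_cou a *: (1 : A).
Proof.
have bl : is_bilinear (fun b c : A => b * Bq_ant c).
  by split=> [c k x y | b k x y]; rewrite ?linearP !(mulr_linl, mulr_linr).
move: a; apply: (gen_antr Bq_cop1 Bq_copM Bq_cou1 Bq_couM Bq_ant1 Bq_antM Bq_gen_ind) => a; case=> ->.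
- rewrite /= Bq_copX (tliftD _ _ bl) !(tlift_tens _ _ bl) Bq_antX Bq_ant1 mulr1.
  by rewrite mulrN mulrA Bq_gM subrr Bq_mon1 mul1r subrr Bq_cou_mon scale0r.
- by rewrite /= Bq_copg (tlift_tens _ _ bl) Bq_antg Bq_gM subrr Bq_cou_mon scale1r.
- by rewrite /= Bq_copg (tlift_tens _ _ bl) Bq_antg Bq_gM subrr Bq_cou_mon scale1r.
Qed.

Definition Bq : hopfAlg K := HopfAlg Bq_cop1 Bq_copM Bq_cou1 Bq_couM
  Bq_coassoc Bq_counitl Bq_counitr Bq_antipodel Bq_antipoder.

End Bq.

(* The enveloping algebra of the Lie algebra with basis X, H and [H, X] = X.
   The basis element (n, m) stands for the PBW monomial X^n H^m, and products
   are computed with p(H) X^r = X^r p(H + r). *)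
Section Ubp.
Variable K : fieldType.

Local Notation B := (nat * nat)%type.

(* X^n p(H) *)
Definition Ub_row (n : nat) (p : {poly K}) : {malg K[B]} :=
  \sum_(j < size p) p`_j *: << (n, j : nat) : B >>.

Definition Ub_mul (a b : B) : {malg K[B]} :=
  Ub_row (a.1 + b.1)%N (('X + (b.1)%:R) ^+ a.2 * 'X^(b.2)).

Lemma Ub_rowEw n (p : {poly K}) m : (size p <= m)%N ->
  Ub_row n p = \sum_(j < m) p`_j *: << (n, j : nat) : B >>.
Proof.
move=> spm; rewrite /Ub_row (big_ord_widen _ (fun j => p`_j *: << (n, j) : B >>) spm).
rewrite big_mkcond /=; apply: eq_bigr => j _; case: ltnP => // h.
by rewrite nth_default // scale0r.
Qed.

Lemma Ub_row_is_linear n : is_linear (Ub_row n).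
Proof.
move=> c p r; pose m := maxn (size (c *: p + r)) (maxn (size p) (size r)).
rewrite !(@Ub_rowEw _ _ m) ?leq_max ?leqnn ?orbT // scaler_sumr -big_split /=.
by apply: eq_bigr => j _; rewrite coefD coefZ scalerDl scalerA.
Qed.

HB.instance Definition _ n :=
  GRing.isLinear.Build K {poly K} {malg K[B]} *:%R (Ub_row n) (Ub_row_is_linear n).

Lemma Ub_rowX n m : Ub_row n 'X^m = << (n, m) : B >>.
Proof.
rewrite /Ub_row size_polyXn big_ord_recr /= coefXn eqxx scale1r big1 ?add0r //.
by move=> j _; rewrite coefXn (ltn_eqF (ltn_ord j)) scale0r.
Qed.

Lemma lin_poly_ext (V : lmodType K) (h h' : {poly K} -> V) :
  is_linear h -> is_linear h' -> (forall m, h 'X^m = h' 'X^m) -> h =1 h'.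
Proof.
move=> hl hl' e p; pose hL : {linear {poly K} -> V} :=
  HB.pack h (GRing.isLinear.Build K _ V *:%R h hl).
pose hL' : {linear {poly K} -> V} :=
  HB.pack h' (GRing.isLinear.Build K _ V *:%R h' hl').
rewrite -[h p]/(hL p) -[h' p]/(hL' p) -[p]coefK poly_def !linear_sum.
by apply: eq_bigr => i _; rewrite !linearZ; congr (_ *: _); apply: e.
Qed.

Fact Ub_mulA a b c :
  lext (fun d => Ub_mul d c) (Ub_mul a b) = lext (Ub_mul a) (Ub_mul b c).
Proof.
case: a b c => [n m] [r s] [u v]; rewrite {2}/Ub_mul {3}/Ub_mul /=.
have -> : forall N (p : {poly K}), lext (fun d => Ub_mul d (u, v)) (Ub_row N p) =
    Ub_row (N + u) ((p \Po ('X + u%:R)) * 'X^v).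
  move=> N; apply: lin_poly_ext => [c p p'|c p p'|j]; first by rewrite !linearP.
    by rewrite comp_polyD comp_polyZ mulrDl -scalerAl linearP.
  by rewrite Ub_rowX lextU comp_Xn_poly.
have -> : forall N (p : {poly K}), lext (Ub_mul (n, m)) (Ub_row N p) =
    Ub_row (n + N) (('X + N%:R) ^+ m * p).
  move=> N; apply: lin_poly_ext => [c p p'|c p p'|j]; first by rewrite !linearP.
    by rewrite mulrDr -scalerAr linearP.
  by rewrite Ub_rowX lextU.
rewrite addnA comp_polyM comp_Xn_poly rmorphXn /= comp_polyD comp_polyX.
by rewrite -[r%:R in LHS]polyC_natr comp_polyC polyC_natr natrD mulrA -addrA [u%:R + _]addrC.
Qed.

Fact Ub_mul1l a : Ub_mul (0%N, 0%N) a = << a >>.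
Proof. by case: a => n m; rewrite /Ub_mul /= expr0 mul1r Ub_rowX. Qed.

Fact Ub_mul1r a : Ub_mul a (0%N, 0%N) = << a >>.
Proof. by case: a => n m; rewrite /Ub_mul /= addr0 mulr1 addn0 Ub_rowX. Qed.

Definition Ub_table := SCTable Ub_mulA Ub_mul1l Ub_mul1r.
Local Notation A := (scalg Ub_table).

Definition Ub_mon (n m : nat) : A := scb (T := Ub_table) (n, m).
Local Notation mon := Ub_mon.
Local Notation X := (mon 1 0).
Local Notation H := (mon 0 1).

Lemma Ub_monM n m r s : mon n m * mon r s =
  Ub_row (n + r) (('X + r%:R) ^+ m * 'X^s) :> {malg K[B]}.
Proof. by rewrite /mon scbM. Qed.

Lemma Ub_HX : H * X = X * H + X.
Proof.
rewrite !Ub_monM !expr1 !expr0 mulr1 mul1r raddfD /= -['X]expr1 Ub_rowX.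
by rewrite -[1%:R](expr0 'X) Ub_rowX /mon scb.unlock.
Qed.

Lemma Ub_XHE n m : mon n m = X ^+ n * H ^+ m.
Proof.
have XE k : X ^+ k = mon k 0.
  elim: k => [|k IH]; first by rewrite expr0 -scb1.
  by rewrite exprS IH [LHS]Ub_monM expr0 mul1r Ub_rowX /mon scb.unlock.
have HE k : H ^+ k = mon 0 k.
  elim: k => [|k IH]; first by rewrite expr0 -scb1.
  by rewrite exprS IH [LHS]Ub_monM expr1 addr0 -exprS Ub_rowX /mon scb.unlock.
by rewrite XE HE [RHS]Ub_monM expr0 mul1r Ub_rowX addn0 /mon scb.unlock.
Qed.

(* An algebra map out of U is determined by elements x, h with h x = x h + x. *)
Lemma Ub_map_mul (T : algType K) (x h : T) : h * x = x * h + x ->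
  {morph (sclin (T := Ub_table) (fun a => x ^+ a.1 * h ^+ a.2) : A -> T) :
     y z / y * z}.
Proof.
move=> hx; apply: sclinM; first exact: mul_bil.
move=> [n m] [r s]; rewrite /= /Ub_mul /=.
pose ev (p : {poly K}) : T := horner_alg h p.
have rowE N p : sclin (T := Ub_table) (fun a => x ^+ a.1 * h ^+ a.2) (Ub_row N p) =
    x ^+ N * ev p.
  move: p; apply: lin_poly_ext => [c p p'|c p p'|j]; first by rewrite !linearP.
    by rewrite /ev linearP /= mulr_algl mulr_linr.
  rewrite Ub_rowX -/(mon N j); have -> : << (N, j) : B >> = mon N j.
    by rewrite /mon scb.unlock.
  by rewrite sclinE /ev rmorphXn /= horner_algX.
rewrite rowE /ev rmorphM !rmorphXn /= rmorphD /= rmorph_nat !horner_algX exprD.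
rewrite -!mulrA; congr (_ * _); rewrite !mulrA; congr (_ * _).
have hxr : h * x ^+ r = x ^+ r * (h + r%:R).
  elim: r {s} => [|r IH]; first by rewrite expr0 mul1r mulr1 addr0.
  rewrite exprS mulrA hx mulrDl -mulrA IH -mulrA -{2}[x ^+ r]mulr1.
  by rewrite -mulrDr -mulrDr -natr1 addrA.
elim: m => [|m IH]; first by rewrite !expr0 mul1r mulr1.
by rewrite [(h + _) ^+ _]exprS mulrA -hxr -mulrA IH mulrA -exprS.
Qed.

Definition Ub_cop : A -> tensor A A := sclin (T := Ub_table)
  (fun a : B => (X (x) 1 + 1 (x) X) ^+ a.1 * (H (x) 1 + 1 (x) H) ^+ a.2).
HB.instance Definition _ := GRing.Linear.on Ub_cop.

Definition Ub_cou : A -> K^o := sclin (T := Ub_table)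
  (fun a : B => (0 : K^o) ^+ a.1 * 0 ^+ a.2).
HB.instance Definition _ := GRing.Linear.on Ub_cou.

Definition Ub_ant : A -> A := sclin (T := Ub_table)
  (fun a : B => (- H) ^+ a.2 * (- X) ^+ a.1).
HB.instance Definition _ := GRing.Linear.on Ub_ant.

Lemma Ub_copM : {morph Ub_cop : x y / x * y}.
Proof.
apply: Ub_map_mul; rewrite !(mulrDl, mulrDr) !tens_mul !mulr1 !mul1r Ub_HX.
rewrite tensAl tensAr -!addrA; congr (_ + _).
rewrite [1 (x) (X * H) + (X (x) 1 + _)]addrCA [H (x) X + (X (x) 1 + _)]addrCA.
by rewrite [RHS]addrCA [X (x) H + (H (x) X + _)]addrCA.
Qed.

Lemma Ub_couM : {morph Ub_cou : x y / x * y}.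
Proof.
by apply: (Ub_map_mul (T := (K^o : algType K))); rewrite !mulr0 addr0.
Qed.

Lemma Ub_antM x y : Ub_ant (x * y) = Ub_ant y * Ub_ant x.
Proof.
move: x y; apply: (sclinM (mulop_bil A)) => -[n m] [r s].
rewrite /= /Ub_mul /=; pose ev (p : {poly K}) : A := horner_alg (- H) p.
have rowE N p : sclin (T := Ub_table)
    (fun a : B => (- H) ^+ a.2 * (- X) ^+ a.1) (Ub_row N p) = ev p * (- X) ^+ N.
  move: p; apply: lin_poly_ext => [c p p'|c p p'|j]; first by rewrite !linearP.
    by rewrite /ev linearP /= mulr_algl mulr_linl.
  rewrite Ub_rowX -/(mon N j); have -> : << (N, j) : B >> = mon N j.
    by rewrite /mon scb.unlock.
  by rewrite sclinE /ev rmorphXn /= horner_algX.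
rewrite rowE /ev rmorphM !rmorphXn /= rmorphD /= rmorph_nat !horner_algX.
rewrite addnC exprD !mulrA; congr (_ * _).
have hY : (- X) * (- H) = (- H + 1) * (- X).
  by rewrite mulrDl !mulrNN mul1r Ub_HX addrK.
have hYr : (- X) ^+ r * (- H) = (- H + r%:R) * (- X) ^+ r.
  elim: r {s rowE} => [|r IH]; first by rewrite expr0 mul1r mulr1 addr0.
  rewrite exprSr -mulrA hY mulrDl mul1r mulrDr mulrA IH -mulrA -exprSr.
  by rewrite -natr1 addrA [RHS]mulrDl mul1r.
have hYrm k : (- X) ^+ r * (- H) ^+ k = (- H + r%:R) ^+ k * (- X) ^+ r.
  elim: k => [|k IH]; first by rewrite !expr0 mul1r mulr1.
  by rewrite exprSr mulrA IH -mulrA hYr mulrA -exprSr.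
rewrite -[RHS]mulrA hYrm mulrA; congr (_ * _).
have cm : GRing.comm (- H) (- H + r%:R).
  by apply: commrD; [apply: commr_refl | apply: commr_nat].
by rewrite (commrX _ (commr_sym (commrX _ (commr_sym cm)))).
Qed.

Definition Ub_gens : set A := [set x | x = X \/ x = H].

Lemma Ub_gen_ind (P : A -> Prop) : P 1 ->
  (forall (c : K) a b, P a -> P b -> P (c *: a + b)) ->
  (forall a b, P a -> P b -> P (a * b)) -> (forall a, Ub_gens a -> P a) ->
  forall a, P a.
Proof.
move=> P1 PD PM PG; apply: sc_ind => // -[n m].
rewrite -/(mon n m) Ub_XHE; apply: (PM).
  elim: n => [|n IH]; first by rewrite expr0.
  by rewrite exprS; apply: (PM) => //; apply: (PG); left.
elim: m => [|m IH]; first by rewrite expr0.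
by rewrite exprS; apply: (PM) => //; apply: (PG); right.
Qed.

Lemma Ub_cop_mon n m : Ub_cop (mon n m) =
  (X (x) 1 + 1 (x) X) ^+ n * (H (x) 1 + 1 (x) H) ^+ m.
Proof. exact: sclinE. Qed.

Lemma Ub_copX : Ub_cop X = X (x) 1 + 1 (x) X.
Proof. by rewrite Ub_cop_mon expr1 expr0 mulr1. Qed.

Lemma Ub_copH : Ub_cop H = H (x) 1 + 1 (x) H.
Proof. by rewrite Ub_cop_mon expr1 expr0 mul1r. Qed.

Lemma Ub_cop1 : Ub_cop 1 = 1.
Proof. by rewrite -scb1 -/(mon 0 0) Ub_cop_mon !expr0 mulr1. Qed.

Lemma Ub_cou_mon n m : Ub_cou (mon n m) = 0 ^+ n * 0 ^+ m.
Proof. exact: sclinE. Qed.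

Lemma Ub_couX : Ub_cou X = 0.
Proof. by rewrite Ub_cou_mon expr1 mul0r. Qed.

Lemma Ub_couH : Ub_cou H = 0.
Proof. by rewrite Ub_cou_mon expr1 mulr0. Qed.

Lemma Ub_cou1 : Ub_cou 1 = 1.
Proof. by rewrite -scb1 -/(mon 0 0) Ub_cou_mon !expr0 mulr1. Qed.

Lemma Ub_ant_mon n m : Ub_ant (mon n m) = (- H) ^+ m * (- X) ^+ n.
Proof. exact: sclinE. Qed.

Lemma Ub_antX : Ub_ant X = - X.
Proof. by rewrite Ub_ant_mon expr0 expr1 mul1r. Qed.

Lemma Ub_antH : Ub_ant H = - H.
Proof. by rewrite Ub_ant_mon expr0 expr1 mulr1. Qed.

Lemma Ub_ant1 : Ub_ant 1 = 1.
Proof.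
have e1 : mon 0 0 = 1 by exact: scb1.
by rewrite -[in LHS]e1 Ub_ant_mon !expr0 mulr1.
Qed.

Definition Ub_prim (x : A) : Prop :=
  [/\ Ub_cop x = x (x) 1 + 1 (x) x, Ub_cou x = 0 & Ub_ant x = - x].

Lemma Ub_gens_prim x : Ub_gens x -> Ub_prim x.
Proof.
by case=> ->; split; rewrite (Ub_copX, Ub_copH) || rewrite (Ub_couX, Ub_couH) ||
  rewrite (Ub_antX, Ub_antH).
Qed.

Fact Ub_coassoc a :
  tlift (fun b c => tlift (fun b1 b2 => b1 (x) (b2 (x) c)) (Ub_cop b)) (Ub_cop a) =
  tlift (fun b c => b (x) Ub_cop c) (Ub_cop a).
Proof.
have b3 (c : A) : is_bilinear (fun b1 b2 => b1 (x) (b2 (x) c) : tensor A (tensor A A)).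
  by split=> [v k x y | u k x y]; rewrite !(tensDl, tensDr).
have bl : is_bilinear
    (fun b c => tlift (fun b1 b2 => b1 (x) (b2 (x) c)) (Ub_cop b) : tensor A (tensor A A)).
  split=> [c k x y | b k x y]; first by rewrite linearP (tlift_is_linear (b3 c)).
  by rewrite -tlift_linear_fun; apply: eq_tlift => u v; rewrite !tensDr.
have br : is_bilinear (fun b c => b (x) Ub_cop c : tensor A (tensor A A)).
  by split=> [c k x y | b k x y]; rewrite ?linearP !(tensDl, tensDr).
move: a; apply: (gen_coassoc Ub_cop1 Ub_copM Ub_gen_ind) => a /Ub_gens_prim [ca _ _].
rewrite /= ca (tliftD _ _ bl) (tliftD _ _ br) !(tlift_tens _ _ bl).
rewrite !(tlift_tens _ _ br) ca !Ub_cop1 (tliftD _ _ (b3 _)).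
by rewrite !(tlift_tens _ _ (b3 _)) tensAr addrA.
Qed.

Fact Ub_counitl a : tlift (fun b c => Ub_cou b *: c) (Ub_cop a) = a.
Proof.
have bl : is_bilinear (fun b c : A => Ub_cou b *: c).
  split=> [c k x y | b k x y]; first by rewrite linearP scalerDl -scalerA.
  by rewrite scalerDr !scalerA mulrC.
move: a; apply: (gen_counitl Ub_cop1 Ub_copM Ub_cou1 Ub_couM Ub_gen_ind) => a
  /Ub_gens_prim [ca ea _].
rewrite /= ca (tliftD _ _ bl) !(tlift_tens _ _ bl) ea Ub_cou1.
by rewrite scale0r scale1r add0r.
Qed.

Fact Ub_counitr a : tlift (fun b c => Ub_cou c *: b) (Ub_cop a) = a.
Proof.
have bl : is_bilinear (fun b c : A => Ub_cou c *: b).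
  split=> [c k x y | b k x y]; last by rewrite linearP scalerDl -scalerA.
  by rewrite scalerDr !scalerA mulrC.
move: a; apply: (gen_counitr Ub_cop1 Ub_copM Ub_cou1 Ub_couM Ub_gen_ind) => a
  /Ub_gens_prim [ca ea _].
rewrite /= ca (tliftD _ _ bl) !(tlift_tens _ _ bl) ea Ub_cou1.
by rewrite scale0r scale1r addr0.
Qed.

Fact Ub_antipodel a : tlift (fun b c => Ub_ant b * c) (Ub_cop a) = Ub_cou a *: (1 : A).
Proof.
have bl : is_bilinear (fun b c : A => Ub_ant b * c).
  by split=> [c k x y | b k x y]; rewrite ?linearP !(mulr_linl, mulr_linr).
move: a; apply: (gen_antl Ub_cop1 Ub_copM Ub_cou1 Ub_couM Ub_ant1 Ub_antM Ub_gen_ind)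
  => a /Ub_gens_prim [ca ea sa].
rewrite /= ca (tliftD _ _ bl) !(tlift_tens _ _ bl) sa ea Ub_ant1.
by rewrite mulr1 mul1r addNr scale0r.
Qed.

Fact Ub_antipoder a : tlift (fun b c => b * Ub_ant c) (Ub_cop a) = Ub_cou a *: (1 : A).
Proof.
have bl : is_bilinear (fun b c : A => b * Ub_ant c).
  by split=> [c k x y | b k x y]; rewrite ?linearP !(mulr_linl, mulr_linr).
move: a; apply: (gen_antr Ub_cop1 Ub_copM Ub_cou1 Ub_couM Ub_ant1 Ub_antM Ub_gen_ind)
  => a /Ub_gens_prim [ca ea sa].
rewrite /= ca (tliftD _ _ bl) !(tlift_tens _ _ bl) sa ea Ub_ant1.
by rewrite mulr1 mul1r subrr scale0r.
Qed.

Definition Ub : hopfAlg K := HopfAlg Ub_cop1 Ub_copM Ub_cou1 Ub_couM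
  Ub_coassoc Ub_counitl Ub_counitr Ub_antipodel Ub_antipoder.

End Ubp.

Section Calculi.
Variables (K : fieldType) (A : hopfAlg K).

(* the augmentation ideal ker eps *)
Definition in_aug : {pred A} := [pred a | cou a == 0].

Fact in_aug_submod_closed : submod_closed in_aug.
Proof.
split; first by rewrite inE linear0.
move=> c a b; rewrite !inE linearP => /eqP -> /eqP ->.
by rewrite scaler0 addr0.
Qed.

HB.instance Definition _ := GRing.isSubmodClosed.Build K A in_aug
  in_aug_submod_closed.

Record aug : Type := Aug { aug_val : A; aug_valP : in_aug aug_val }.
HB.instance Definition _ := [isSub for aug_val].
HB.instance Definition _ := [Choice of aug by <:].
HB.instance Definition _ := [SubChoice_isSubLmodule of aug by <:].

Fact aug_proj_subproof (a : A) : in_aug (a - (cou a)%:A).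
Proof. by rewrite /in_aug /= linearB linearZ /= cou1 -[_ *: _]/(_ * _) mulr1 subrr. Qed.

(* the projection a |-> a - eps(a) 1; it is the identity on ker eps *)
Definition aug_proj (a : A) : aug := Aug (aug_proj_subproof a).

(* Ad_L(v) = v_(1) S v_(3) (x) v_(2) *)
Definition AdL (v : A) : tensor A A :=
  tlift (fun v1 w => tlift (fun v2 v3 => (v1 * ant v3) (x) v2) (cop w)) (cop v).

(* the subspace A (x) M of A (x) A *)
Definition tens_sub (M : set A) : set (tensor A A) :=
  lspan [set t | exists a m, M m /\ t = a (x) m].

Definition is_crossed (M : set A) : Prop :=
  [/\ is_subspace M, forall m, M m -> cou m = 0,
      forall a m, M m -> M (a * m) & forall m, M m -> tens_sub M (AdL m)].

Record calculus := Calculus {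
  forms : lmodType K;
  lact : A -> forms -> forms;
  ract : forms -> A -> forms;
  dd : A -> forms }.

Implicit Types (G : calculus) (M : set A).

Definition rcomm G (a : A) (w : forms G) : forms G := lact a w - ract w a.

(* Bicovariant first order differential calculi.  Left and right covariance
   say that  a db |-> Delta(a) (id (x) d)(Delta b)  and
   a db |-> Delta(a) (d (x) id)(Delta b)  extend to well-defined maps. *)
Record bicovariant G : Prop := Bicovariant {
  lact_bilinear : is_bilinear (@lact G);
  ract_bilinear : is_bilinear (@ract G);
  lact1 : forall w : forms G, lact 1 w = w;
  lactM : forall a b (w : forms G), lact (a * b) w = lact a (lact b w);
  ract1 : forall w : forms G, ract w 1 = w;
  ractM : forall a b (w : forms G), ract w (a * b) = ract (ract w a) b;
  lract : forall a b (w : forms G), ract (lact a w) b = lact a (ract w b);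
  dd_linear : is_linear (@dd G);
  dd_leibniz : forall a b, dd G (a * b) = ract (dd G a) b + lact a (dd G b);
  dd_span : forall w : forms G, lspan [set lact a (dd G b) | a in setT & b in setT] w;
  left_covariant : exists2 D : forms G -> tensor A (forms G), is_linear D &
    forall a b, D (lact a (dd G b)) =
      tlift (fun a1 a2 => tlift (fun b1 b2 =>
        (a1 * b1) (x) lact a2 (dd G b2)) (cop b)) (cop a);
  right_covariant : exists2 D : forms G -> tensor (forms G) A, is_linear D &
    forall a b, D (lact a (dd G b)) =
      tlift (fun a1 a2 => tlift (fun b1 b2 =>
        lact a1 (dd G b1) (x) (a2 * b2)) (cop b)) (cop a) }.

Definition calc_map G G' (f : forms G -> forms G') : Prop :=
  [/\ is_linear f, forall a w, f (lact a w) = lact a (f w),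
      forall a w, f (ract w a) = ract (f w) a & forall a, f (dd G a) = dd G' a].

Definition calc_iso G G' : Prop :=
  exists f : forms G -> forms G', calc_map f /\ bijective f.

Definition calc_quotient_map G G' (f : forms G -> forms G') : Prop :=
  calc_map f /\ (forall w', exists w, f w = w').

Definition coirreducible G : Prop :=
  [/\ bicovariant G, exists w : forms G, w <> 0 &
      forall G' (f : forms G -> forms G'), bicovariant G' ->
        calc_quotient_map f -> (forall w' : forms G', w' = 0) \/ injective f].

(* ker eps / M *)
Definition aug_quot M := qmod [set v : aug | M (aug_val v)].

(* The calculus (ker eps / M) (x) A of a crossed submodule M.  In [lact] a
   representative of the class v is chosen, which is harmless as A M is
   contained in M, and a1 v lies in ker eps, where [aug_proj] is the identity. *)
Definition calc_of M : calculus := @Calculus (tensor (aug_quot M) A)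
  (fun a => tlift (fun (v : aug_quot M) b => tlift (fun a1 a2 =>
     (qproj _ (aug_proj (a1 * aug_val (qrepr v))) : aug_quot M) (x) (a2 * b)) (cop a)))
  (fun w c => tlift (fun (v : aug_quot M) b => v (x) (b * c)) w)
  (fun a => tlift (fun a1 a2 => (qproj _ (aug_proj a1) : aug_quot M) (x) a2)
     (cop a - 1 (x) a)).

(* right invariant forms: v is identified with v (x) 1 *)
Definition rinv M (v : aug_quot M) : forms (calc_of M) := v (x) 1.

Definition calc_dim G n : Prop :=
  exists M, [/\ is_crossed M, calc_iso G (calc_of M) &
                has_dim [set: aug_quot M] n].

Definition findim_calculus G : Prop := bicovariant G /\ exists n, calc_dim G n.

(* h |> x = h_(1) x S h_(2) *)
Definition adl (h x : A) : A := tlift (fun h1 h2 => h1 * x * ant h2) (cop h).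

Definition is_tangent (L : set A) : Prop :=
  [/\ is_subspace L, forall x, L x -> cou x = 0,
      forall h x, L x -> L (adl h x) &
      forall x, L x ->
        tens_sub L (tlift (fun x1 x2 : A => x1 (x) (x2 - cou x2 *: 1 : A)) (cop x))].

Definition findim_tangent (L : set A) : Prop :=
  is_tangent L /\ exists n, has_dim L n.

End Calculi.

Arguments calc_iso {K} A G G'.
Arguments findim_calculus {K} A G.
Arguments findim_tangent {K} A L.

Section Duality.
Variables (K : fieldType) (H A : hopfAlg K) (pair : H -> A -> K).

Definition tangent_of (M : set A) : set H :=
  [set x | cou x = 0 /\ forall m, M m -> pair x m = 0].

(* the pairing of the tangent space of M with ker eps / M; it does not depend
   on the representative when x lies in that tangent space *)
Definition qpair (M : set A) (x : H) (v : aug_quot M) : K :=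
  pair x (aug_val (qrepr v)).

Definition partial (x : H) (a : A) : A :=
  tlift (fun a1 a2 => pair x a1 *: a2) (cop a).

End Duality.

(* F is a bijection from P onto C, elements of C being identified along E. *)
Definition bij_onto (I T : Type) (P : I -> Prop) (F : I -> T)
    (E : T -> T -> Prop) (C : T -> Prop) : Prop :=
  [/\ forall i, P i -> C (F i),
      forall i j, P i -> P j -> E (F i) (F j) -> i = j &
      forall t, C t -> exists2 i, P i & E t (F i)].

(* F i |-> F' i (i in P) is a well-defined bijection onto C, up to E and E'. *)
Definition corresponds (I T T' : Type) (P : I -> Prop) (F : I -> T)
    (E : T -> T -> Prop) (F' : I -> T') (E' : T' -> T' -> Prop)
    (C : T' -> Prop) : Prop :=
  [/\ forall i, P i -> C (F' i),
      forall i j, P i -> P j -> (E (F i) (F j) <-> E' (F' i) (F' j)) &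
      forall t, C t -> exists2 i, P i & E' t (F' i)].

(* non-empty finite sets of positive integers *)
Definition posfin (I : {fset nat}) : Prop := (0%N \notin I) /\ I <> fset0.

Definition cI (I : {fset nat}) (k : nat) : nat := #|` [fset n in I | (k < n)%N]%fset |.

Section Classical.
Variable k : fieldType.

Definition CB : hopfAlg k := Bq (oner_neq0 k).
Definition UB : hopfAlg k := Ub k.

Definition CX : CB := Bq_mon (oner_neq0 k) 1 0.
Definition Cg (s : int) : CB := Bq_mon (oner_neq0 k) 0 s.
Definition UX : UB := Ub_mon k 1 0.
Definition UH : UB := Ub_mon k 0 1.

Definition CU_pair_basis (a : nat * nat) (b : nat * int) : k :=
  (a.1 == b.1)%:R * (a.1)`!%:R * (b.2)%:~R ^+ a.2.

Definition CU_pair (x : UB) (y : CB) : k :=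
  sclin (T := Ub_table k) (fun a =>
    sclin (T := Bq_table (oner_neq0 k)) (fun b => CU_pair_basis a b : k^o) y) x.

Definition ddX (f : CB) : CB := sclin (T := Bq_table (oner_neq0 k))
  (fun b => (b.1)%:R *: Bq_mon (oner_neq0 k) b.1.-1 b.2 : CB) f.
Definition ddg (f : CB) : CB := sclin (T := Bq_table (oner_neq0 k))
  (fun b => (b.2)%:~R *: Bq_mon (oner_neq0 k) b.1 (b.2 - 1) : CB) f.

Definition MI (I : {fset nat}) : set CB :=
  lspan [set m : CB | exists i s, m = CX ^+ i * (1 - Cg 1) ^+ cI I i * Cg s].

Definition GammaI (I : {fset nat}) : calculus CB := calc_of (MI I).

Definition LI (I : {fset nat}) : set UB :=
  lspan [set x : UB | exists i j,
    [/\ (i, j) <> (0%N, 0%N), (j < cI I i)%N & x = UX ^+ i * UH ^+ j]].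

End Classical.

Section Deformed.
Variable k : fieldType.
Local Notation kq := {fraction {poly k}}.

Definition qpar : kq := tofrac 'X.

Fact qpar_neq0 : qpar != 0.
Proof. by rewrite tofrac_eq0 polyX_eq0. Qed.

(* C_q(B_+) = U_q(b_+) over k(q) *)
Definition CqB : hopfAlg kq := Bq qpar_neq0.

Definition qX : CqB := Bq_mon qpar_neq0 1 0.
Definition qg (s : int) : CqB := Bq_mon qpar_neq0 0 s.

Definition MqJ (J : {fset nat}) : set CqB :=
  lspan [set m : CqB | exists i s,
    m = qX ^+ i * (\prod_(n <- (1%N |` J)%fset | (i < n)%N)
                     (1 - qpar ^ (1 - n%:Z) *: qg 1)) * qg s].

Definition GammaqJ (J : {fset nat}) : calculus CqB := calc_of (MqJ J).

Definition LqJ (J : {fset nat}) : set CqB :=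
  lspan [set x : CqB | exists2 n, n \in J &
    x = qg (1 - n%:Z) - 1 \/
    exists2 i, (1 <= i <= n.-1)%N & x = qX ^+ i * qg (1 - n%:Z)].

End Deformed.

Arguments CX {k}.
Arguments Cg {k}.
Arguments CU_pair {k}.
Arguments MI : clear implicits.
Arguments GammaI : clear implicits.
Arguments LI : clear implicits.
Arguments MqJ : clear implicits.
Arguments GammaqJ : clear implicits.
Arguments LqJ : clear implicits.

(* Main.v *)
From HB Require Import structures.
Require Import Defs.
From mathcomp Require Import all_boot all_order all_algebra.
From mathcomp Require Import finmap boolp classical_sets.
From mathcomp Require Import monalg zify ring.

Set Implicit Arguments.
Unset Strict Implicit.
Unset Printing Implicit Defensive.

Import GRing.Theory.
Local Open Scope classical_set_scope.
Local Open Scope ring_scope.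

(** The classical algebra k[X, g, g^-1] and its deformation are the members
    q = 1 and q generic of one family, with X g = q g X.  Both classifications
    of calculi come from one analysis of the crossed submodules M of a member of
    this family, and they are indexed by the same finite sets; this is what the
    correspondence between them means.

    Calculi.  The left adjoint coaction of X^k r(g) is the sum over j <= k of
      [k, j] X^(k-j) g^j (x) X^j (1 - p^j g) ... (1 - p^(k-1) g) r(g),  p = q^-1,
    with Gaussian binomials [k, j] ([bq_AdL]).  Since M is stable under it, the
    coefficient of g^k shows that M is graded by the degree in X, and the
    coefficient of X g^k shows that X^(k+1) r in M implies X^k (1 - p^k g) r in M,
    up to the factor 1 + p + ... + p^k.  This factor is nonzero when q = 1 in
    characteristic 0 and when q is not a root of unity.  Hence M is the sum of
    the X^k d_k(g) k[g, g^-1] for polynomials with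
    d_(k+1) | d_k | (1 - p^k g) d_(k+1) ([crossed_Mgr]).  If M has finite
    codimension, then d_k = 1 for large k, and going down from there each step
    either changes nothing or contributes the factor 1 - p^k g.  So d_k is the
    product of the 1 - q^(1-n) g over the n > k in the finite set I of those k+1
    at which a factor appears ([crossed_classification]).  The remaining
    condition that M lies in ker eps is d_0(1) = 0: for q = 1 it says that I is
    non-empty, for generic q that 1 is in I.  The dimension is the sum of the
    degrees c_I(k) of the d_k, less 1 for the unit, and the c_I(k) add up to the
    sum of I ([Mset_dim]).  Finally a calculus determines M, because v (x) 1 is
    (d v_(1)) S v_(2) ([calc_iso_crossed]).

    Tangent spaces.  For a tangent space L, the sum W of L and the line of 1 is
    stable under the adjoint action and under applying a functional to the first
    factor of the coproduct.  Eigenvectors of the adjoint action of H, or of g,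
    reduce W to its components, and W turns out to be spanned by monomials.  In
    the enveloping algebra W is stable under lowering either exponent and, by
    ad_X, under passing from X^n H^(m+1) to X^(n+1) H^m.  The exponents thus
    form a staircase whose steps have height at most one, and such a staircase
    is given by a set I ([ub_tangent_stairs]).  In the deformed algebra the
    monomials X^k g^s in W with s fixed start at k = 0, and ad_X prolongs them
    until k = -s; finite dimension makes them stop there
    ([bq_tangent_classification]).  Duality of L_I and M_I holds because
    multiplication by 1 - g is dual to the difference operator on polynomials in
    H: annihilating X^k (1 - g)^c k[g, g^-1] means having degree less than c
    ([LI_tangent_of]).

    Examples.  The form eta_i is the class of X^i for i > 0, and eta_0 is the
    class of g - 1.  The stated relations follow from the coproducts of X and g
    and from (1 - g)^2, X^i (1 - g), X^n being in M.  The functionals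
    X^i / i! and H are dual to these classes, which by the known dimensions makes
    both families bases.  A quotient of the deformed calculus of {1, n} comes
    from a crossed submodule containing that of {1, n}, so from a set between
    {1} and {1, n} ([Mset_coirreducible]). *)

(** * Subspaces and linear maps *)

Section Subspaces.
Variable K : fieldType.
Implicit Types U V W Z : lmodType K.

Lemma subspaceZ V (W : set V) c u : is_subspace W -> W u -> W (c *: u).
Proof. by move=> [h0 hD] Wu; rewrite -[_ *: _]addr0; apply: hD. Qed.

Lemma subspaceD V (W : set V) u v : is_subspace W -> W u -> W v -> W (u + v).
Proof. by move=> [h0 hD] Wu Wv; rewrite -[u]scale1r; apply: hD. Qed.

Lemma subspaceB V (W : set V) u v : is_subspace W -> W u -> W v -> W (u - v).
Proof.
by move=> h Wu Wv; apply: subspaceD => //; rewrite -scaleN1r; apply: subspaceZ.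
Qed.

Lemma subspace_sum V (W : set V) (I : eqType) (r : seq I) (P : pred I) (F : I -> V) :
  is_subspace W -> (forall i, i \in r -> P i -> W (F i)) ->
  W (\sum_(i <- r | P i) F i).
Proof.
move=> sW h; rewrite big_seq_cond; elim/big_rec: _ => [|i x /andP[ir Pi] Wx].
  exact: sW.1.
by apply: subspaceD => //; apply: h.
Qed.

Lemma subspaceZK V (W : set V) c u : is_subspace W -> c != 0 -> W (c *: u) -> W u.
Proof.
by move=> h c0 Wu; rewrite -[u]scale1r -(mulVf c0) -scalerA; apply: subspaceZ.
Qed.

Lemma lspan_min V (S W : set V) : is_subspace W -> S `<=` W -> lspan S `<=` W.
Proof.
move=> sW SW v [n [c [w [Sw ->]]]]; apply: subspace_sum => // i _ _.
by apply: subspaceZ => //; apply: SW.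
Qed.

Lemma lspan_id V (W : set V) v : is_subspace W -> lspan W v <-> W v.
Proof. by move=> sW; split; [apply: lspan_min | apply: sub_lspan]. Qed.

Lemma lin_id V : is_linear (fun x : V => x).
Proof. by []. Qed.

Lemma lin_const0 V W : is_linear (fun _ : V => 0 : W).
Proof. by move=> c x y; rewrite scaler0 addr0. Qed.

Lemma lin_comp U V W (h : V -> W) (g : U -> V) :
  is_linear h -> is_linear g -> is_linear (fun x => h (g x)).
Proof. by move=> hl gl c x y; rewrite gl hl. Qed.

Lemma lin_add V W (f g : V -> W) :
  is_linear f -> is_linear g -> is_linear (fun x => f x + g x).
Proof. by move=> fl gl c x y; rewrite fl gl scalerDr addrACA. Qed.

Lemma lin_opp V W (f : V -> W) : is_linear f -> is_linear (fun x => - f x).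
Proof. by move=> fl c x y; rewrite fl opprD scalerN. Qed.

Lemma lin_scale V W a (f : V -> W) : is_linear f -> is_linear (fun x => a *: f x).
Proof. by move=> fl c x y; rewrite fl scalerDr !scalerA mulrC. Qed.

Lemma lin_scalel V W (f : V -> K^o) (w : W) :
  is_linear f -> is_linear (fun x => (f x : K) *: w).
Proof. by move=> fl c x y; rewrite fl scalerDl -scalerA. Qed.

Lemma lin_tensl U V Z (f : Z -> U) (v : V) :
  is_linear f -> is_linear (fun x => f x (x) v).
Proof. by move=> fl c x y; rewrite fl tensDl. Qed.

Lemma lin_tensr U V Z (u : U) (f : Z -> V) :
  is_linear f -> is_linear (fun x => u (x) f x).
Proof. by move=> fl c x y; rewrite fl tensDr. Qed.

Lemma lin_mull Z (A : algType K) (f : Z -> A) (b : A) :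
  is_linear f -> is_linear (fun x => f x * b).
Proof. by move=> fl c x y; rewrite fl mulr_linl. Qed.

Lemma lin_mulr Z (A : algType K) (a : A) (f : Z -> A) :
  is_linear f -> is_linear (fun x => a * f x).
Proof. by move=> fl c x y; rewrite fl mulr_linr. Qed.

Lemma lin_sum Z W (I : Type) (r : seq I) (P : pred I) (F : I -> Z -> W) :
  (forall i, is_linear (F i)) -> is_linear (fun x => \sum_(i <- r | P i) F i x).
Proof.
move=> Fl c x y; rewrite scaler_sumr -big_split /=.
by apply: eq_bigr => i _; rewrite Fl.
Qed.

(** [tlift f t] is a finite sum of values of [f], for a representative of [t]
    that does not depend on [f]. *)
Lemma lin_tlift_par U V W Z (f : Z -> U -> V -> W) t :
  (forall u v, is_linear (fun x => f x u v)) -> is_linear (fun x => tlift (f x) t).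
Proof.
move=> fl c x y; rewrite -tlift_linear_fun; apply: eq_tlift => u v; exact: fl.
Qed.

Lemma lin_tlift_arg U V W Z (f : U -> V -> W) (g : Z -> tensor U V) :
  is_bilinear f -> is_linear g -> is_linear (fun x => tlift f (g x)).
Proof. by move=> fb; apply: lin_comp; apply: tlift_is_linear. Qed.

Lemma lin_linear V W (h : {linear V -> W}) : is_linear h.
Proof. by move=> c x y; rewrite linearP. Qed.

Lemma lin_linear_comp U V W (h : {linear V -> W}) (g : U -> V) :
  is_linear g -> is_linear (fun x => h (g x)).
Proof. by apply: lin_comp; apply: lin_linear. Qed.

Lemma lin_sumE V W (f : V -> W) (I : Type) (r : seq I) (P : pred I) (F : I -> V) :
  is_linear f -> f (\sum_(i <- r | P i) F i) = \sum_(i <- r | P i) f (F i).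
Proof.
move=> fl; pose fL : {linear V -> W} :=
  HB.pack f (GRing.isLinear.Build K V W *:%R f fl).
by rewrite -[LHS]/(fL _) linear_sum.
Qed.

Lemma linZE V W (f : V -> W) c u : is_linear f -> f (c *: u) = c *: f u.
Proof. by move=> fl; have := fl c u 0; rewrite (is_linear0 fl) !addr0. Qed.

Lemma linDE V W (f : V -> W) u v : is_linear f -> f (u + v) = f u + f v.
Proof. by move=> fl; have := fl 1 u v; rewrite !scale1r. Qed.

Lemma linBE V W (f : V -> W) u v : is_linear f -> f (u - v) = f u - f v.
Proof. by move=> fl; rewrite linDE // -scaleN1r linZE // scaleN1r. Qed.

Lemma tlift_comp U V W Z (h : W -> Z) (f : U -> V -> W) t :
  is_linear h -> h (tlift f t) = tlift (fun u v => h (f u v)) t.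
Proof.
by move=> hl; rewrite tlift.unlock /lext lin_sumE //; apply: eq_bigr => p _; rewrite linZE.
Qed.

Lemma preim_subspace V W (f : V -> W) (S : set W) :
  is_linear f -> is_subspace S -> is_subspace [set x | S (f x)].
Proof.
move=> fl sS; split=> [|c u v Su Sv] /=; first by rewrite (is_linear0 fl); exact: sS.1.
by rewrite fl; apply: sS.2.
Qed.

Lemma subspace0 V : is_subspace [set 0 : V].
Proof. by split=> // c u v -> ->; rewrite /= scaler0 addr0. Qed.

Lemma tlift0 U V W (f : U -> V -> W) t : (forall u v, f u v = 0) -> tlift f t = 0.
Proof. by move=> f0; rewrite tlift.unlock /lext big1 // => p _; rewrite f0 scaler0. Qed.

Lemma tensBr U V (u : U) (v v' : V) : u (x) (v - v') = u (x) v - u (x) v'.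
Proof. exact: linBE (lin_tensr u (@lin_id V)). Qed.

Lemma tensBl U V (u u' : U) (v : V) : (u - u') (x) v = u (x) v - u' (x) v.
Proof. exact: linBE (lin_tensl v (@lin_id U)). Qed.

Lemma tlift_add U V W (f g : U -> V -> W) t :
  tlift (fun u v => f u v + g u v) t = tlift f t + tlift g t.
Proof.
rewrite -[in RHS](scale1r (tlift f t)) -tlift_linear_fun.
by apply: eq_tlift => u v; rewrite scale1r.
Qed.

Lemma tensNl U V (u : U) (v : V) : (- u) (x) v = - (u (x) v).
Proof. by rewrite -scaleN1r tensZl scaleN1r. Qed.

Lemma tlift_sub U V W (f g : U -> V -> W) t :
  tlift (fun u v => f u v - g u v) t = tlift f t - tlift g t.
Proof.
rewrite [RHS]addrC -scaleN1r -tlift_linear_fun; apply: eq_tlift => u v.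
by rewrite scaleN1r addrC.
Qed.

(** Every tensor is an image of [tens] under linear combinations, so a subspace
    containing the pure tensors is everything. *)
Lemma tensor_ind U V (P : tensor U V -> Prop) :
  is_subspace P -> (forall u v, P (u (x) v)) -> forall t, P t.
Proof.
move=> sP Pt t; have -> : t = tlift (fun u v => u (x) v) t.
  move: t; apply: eq_tensor_lin => //; first by apply/tlift_is_linear/tens_is_bilinear.
  by move=> u v; rewrite tlift_tens //; apply: tens_is_bilinear.
rewrite tlift.unlock /lext; apply: subspace_sum => // p _ _; exact: subspaceZ.
Qed.

End Subspaces.

(** Proves linearity of a function by its outermost operation; the linear maps
    applied to the argument have to be of bundled type or known in the context. *)
Ltac lin_hyp :=
  solve [ assumption
        | multimatch goal with
          | H : is_linear _ |- _ => exact H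
          | H : is_bilinear _ |- _ => first [exact (H.1 _) | exact (H.2 _)]
          | H : forall _, is_linear _ |- _ => exact (H _)
          | H : forall _ _, is_linear _ |- _ => exact (H _ _)
          end ].

Ltac lin :=
  intros; cbv beta;
  try lin_hyp;
  lazymatch goal with
  | |- is_bilinear _ => split; lin
  | |- is_linear (fun x => x) => exact: lin_id
  | |- is_linear (fun x => @?f x + @?g x) => apply (@lin_add _ _ _ f g); lin
  | |- is_linear (fun x => - (@?f x)) => apply (@lin_opp _ _ _ f); lin
  | |- is_linear (fun x => tens (@?f x) (@?g x)) =>
        first [apply (@lin_tensl _ _ _ _ f) | apply (@lin_tensr _ _ _ _ _ g)]; lin
  | |- is_linear (fun x => tlift (@?f x) (@?g x)) =>
        first [apply (@lin_tlift_arg _ _ _ _ _ _ g) | apply (@lin_tlift_par _ _ _ _ _ f)]; lin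
  | |- is_linear (fun x => (@?f x) *: (@?g x)) =>
        first [refine (@lin_scale _ _ _ _ g _) | refine (@lin_scalel _ _ _ f _ _)]; lin
  | |- is_linear (fun x => (@?f x) * (@?g x)) =>
        first [apply (@lin_mull _ _ _ f) | apply (@lin_mulr _ _ _ _ g)]; lin
  | |- is_linear (fun x => \sum_(i <- ?r | @?P i) (@?F x i)) => apply: lin_sum; lin
  | |- is_linear (tlift ?f) => apply: tlift_is_linear; lin
  | |- is_linear _ => first [ exact: lin_linear | apply: lin_linear_comp; lin | lin_app ]
  end
(* the argument may sit in any of the last three places of an application *)
with lin_app :=
  first
    [ match goal with |- is_linear (fun x => ?h (@?f x)) =>
        apply (@lin_comp _ _ _ _ h f); [lin_hyp | lin] end
    | match goal with |- is_linear (fun x => ?h (@?f x) (@?b x)) =>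
        first [ apply (@lin_comp _ _ _ _ (fun y => h y _) f); [lin_hyp | lin]
              | apply (@lin_comp _ _ _ _ (fun y => h _ y) b); [lin_hyp | lin]] end
    | match goal with |- is_linear (fun x => ?h (@?f x) (@?b x) (@?c x)) =>
        first [ apply (@lin_comp _ _ _ _ (fun y => h y _ _) f); [lin_hyp | lin]
              | apply (@lin_comp _ _ _ _ (fun y => h _ y _) b); [lin_hyp | lin]
              | apply (@lin_comp _ _ _ _ (fun y => h _ _ y) c); [lin_hyp | lin]] end ].

Section BasisCoefficients.
Variables (K : fieldType) (T : sctable K).

Definition sc_coef (b : scbase T) : scalg T -> K^o := sclin (fun c => (c == b)%:R : K^o).

Lemma sc_coefE b c : sc_coef b (scb c) = (c == b)%:R.
Proof. exact: sclinE. Qed.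

Lemma sc_expand (x : scalg T) : exists2 S : seq (scbase T), uniq S &
  x = \sum_(b <- S) sc_coef b x *: scb b.
Proof.
exists (msupp (x : {malg K[scbase T]})); first exact: fset_uniq.
have e (b : scbase T) : sc_coef b x = (x : {malg K[scbase T]})@_b.
  rewrite /sc_coef sclin.unlock /lext.
  have [xb|xb] := boolP (b \in msupp (x : {malg K[scbase T]})).
    rewrite (big_fsetD1 _ xb) /= eqxx [_ *: _]mulr1 big_seq big1 ?addr0 // => c.
    by rewrite !inE => /andP[/negbTE -> _]; rewrite scaler0.
  rewrite (mcoeff_outdom xb) big_seq big1 // => c cx.
  by case: eqP cx xb => [-> ->//|_ _ _]; rewrite scaler0.
have {1}-> : x = lext (fun b => scb b : {malg K[scbase T]}) x.
  by rewrite {1}[x]malg_lext; apply: eq_bigr => b _; rewrite scb.unlock.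
by apply: eq_bigr => b _; rewrite e.
Qed.

End BasisCoefficients.

(** * Sweedler calculus *)
Section Sweedler.
Variables (K : fieldType) (A : hopfAlg K).
Implicit Types (W : lmodType K) (a : A).

(** Coassociativity and the other axioms are used as rules for rewriting under
    an arbitrary multilinear expression in the Sweedler components. *)
Lemma cop_assoc W (f : A -> A -> A -> W) a :
  (forall y z, is_linear (fun x => f x y z)) ->
  (forall x z, is_linear (fun y => f x y z)) ->
  (forall x y, is_linear (fun z => f x y z)) ->
  tlift (fun b c => tlift (fun b1 b2 => f b1 b2 c) (cop b)) (cop a) =
  tlift (fun b c => tlift (fun c1 c2 => f b c1 c2) (cop c)) (cop a).
Proof.
move=> f1 f2 f3.
pose F := tlift (fun x t => tlift (fun y z => f x y z) t) : tensor A (tensor A A) -> W.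
have Fb : is_bilinear (fun x (t : tensor A A) => tlift (fun y z => f x y z) t).
  split; first by move=> t; apply: lin_tlift_par.
  by move=> x; apply: tlift_is_linear; split.
have Fl : is_linear F by exact: tlift_is_linear.
have /(congr1 F) := coassoc a; rewrite !(tlift_comp _ _ Fl).
move=> e; etransitivity; last etransitivity; [|exact: e|].
  apply: eq_tlift => b c; rewrite (tlift_comp _ _ Fl); apply: eq_tlift => b1 b2.
  rewrite /F (tlift_tens _ _ Fb) tlift_tens //; by split.
by apply: eq_tlift => b c; rewrite /F (tlift_tens _ _ Fb).
Qed.

Lemma cop_counitl W (f : A -> W) a : is_linear f ->
  tlift (fun b c => (cou b : K) *: f c) (cop a) = f a.
Proof.
move=> fl; rewrite -{2}[a]counitl tlift_comp //.
by apply: eq_tlift => b c; rewrite linZE.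
Qed.

Lemma cop_counitr W (f : A -> W) a : is_linear f ->
  tlift (fun b c => (cou c : K) *: f b) (cop a) = f a.
Proof.
move=> fl; rewrite -{2}[a]counitr tlift_comp //.
by apply: eq_tlift => b c; rewrite linZE.
Qed.

Lemma cop_antl W (f : A -> W) a : is_linear f ->
  tlift (fun b c => f (ant b * c)) (cop a) = (cou a : K) *: f 1.
Proof. by move=> fl; rewrite -linZE // -antipodel tlift_comp. Qed.

Lemma cop_antr W (f : A -> W) a : is_linear f ->
  tlift (fun b c => f (b * ant c)) (cop a) = (cou a : K) *: f 1.
Proof. by move=> fl; rewrite -linZE // -antipoder tlift_comp. Qed.

Lemma ant1 : ant 1 = 1 :> A.
Proof.
have := antipodel (1 : A); rewrite cop1 tlift_tens; last by lin.
by rewrite mulr1 cou1 scale1r.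
Qed.

Lemma cop_mul W (f : A -> A -> W) a b : is_bilinear f ->
  tlift f (cop (a * b)) =
  tlift (fun a1 a2 => tlift (fun b1 b2 => f (a1 * b1) (a2 * b2)) (cop b)) (cop a).
Proof.
move=> fb; have fl := tlift_is_linear fb; have [f1 f2] := fb; rewrite copM.
move: (cop a); apply: eq_tensor_lin; [lin | lin | move=> a1 a2].
move: (cop b); apply: eq_tensor_lin; [lin | lin | move=> b1 b2].
by rewrite tens_mul !tlift_tens //; lin.
Qed.

End Sweedler.

(** * The quotient of ker eps by a crossed submodule *)

Section AugQuot.
Variables (K : fieldType) (A : hopfAlg K) (M : set A).
Hypothesis sM : is_subspace M.

Definition aug_class (a : A) : aug_quot M := qproj _ (aug_proj a).
Local Notation pt := aug_class.

Lemma aug_val_is_linear : is_linear (@aug_val K A).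
Proof. by move=> c x y; rewrite -[LHS]/(\val _) linearP. Qed.

Lemma aug_proj_is_linear : is_linear (@aug_proj K A).
Proof.
move=> c x y; apply: val_inj; rewrite -[RHS]/(aug_val _) aug_val_is_linear /=.
by rewrite linearP scalerDl scalerBr scalerA opprD addrACA.
Qed.

Lemma aug_class_is_linear : is_linear pt.
Proof. by move=> c x y; rewrite /pt aug_proj_is_linear linearP. Qed.

HB.instance Definition _ := GRing.isLinear.Build K A (aug_quot M) *:%R pt
  aug_class_is_linear.

Lemma augM_subspace : is_subspace [set v : aug A | M (aug_val v)].
Proof.
split=> [|c u v Mu Mv]; first by have := sM.1; rewrite -(is_linear0 aug_val_is_linear).
by have := sM.2 c _ _ Mu Mv; rewrite -aug_val_is_linear.
Qed.

Lemma aug_class_eq0 a : pt a = 0 <-> M (a - (cou a)%:A).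
Proof. by rewrite /pt qproj_eq0 lspan_id //; exact: augM_subspace. Qed.

Lemma aug_class1 : pt 1 = 0.
Proof. by apply/aug_class_eq0; rewrite cou1 scale1r subrr; exact: sM.1. Qed.

Lemma aug_projK (v : aug A) : aug_proj (aug_val v) = v.
Proof.
apply: val_inj => /=; have /eqP -> := aug_valP v.
by rewrite scale0r subr0.
Qed.

Lemma aug_class_repr v : pt (aug_val (qrepr v)) = v.
Proof. by rewrite /pt aug_projK qreprK. Qed.

Lemma cou_aug (v : aug A) : cou (aug_val v) = 0.
Proof. by have /eqP := aug_valP v. Qed.

Lemma repr_aug_class a : M (aug_val (qrepr (pt a)) - (a - (cou a)%:A)).
Proof.
have /qproj_eq : qproj _ (qrepr (pt a)) = qproj _ (aug_proj a) :> aug_quot M.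
  by rewrite qreprK.
by rewrite lspan_id ?[_ (_ - _)]/= ?(linBE _ _ aug_val_is_linear) //; exact: augM_subspace.
Qed.

(** The factorization through ker eps / M of a linear map on A that kills 1
    and M. *)
Definition aug_lift (W : lmodType K) (f : A -> W) (v : aug_quot M) : W :=
  f (aug_val (qrepr v)).

Section Lift.
Variables (W : lmodType K) (f : A -> W).
Hypotheses (fl : is_linear f) (f1 : f 1 = 0) (fM : forall m, M m -> f m = 0).

Lemma aug_liftE a : aug_lift f (pt a) = f a.
Proof.
have := fM (repr_aug_class a); rewrite !(linBE _ _ fl) (linZE _ _ fl) f1 scaler0 subr0.
by move/eqP; rewrite subr_eq0 => /eqP.
Qed.

Lemma aug_lift_is_linear : is_linear (aug_lift f).
Proof.
move=> c u v; rewrite -{1}[u]aug_class_repr -{1}[v]aug_class_repr.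
by rewrite -aug_class_is_linear aug_liftE fl.
Qed.
End Lift.

End AugQuot.

(** * The bicovariant calculus of a crossed submodule *)
Section CalcOf.
Variables (K : fieldType) (A : hopfAlg K) (M : set A).
Hypothesis Mx : is_crossed M.

Local Notation pt := (@aug_class K A M).
Local Notation G := (calc_of M).

Let sM : is_subspace M. Proof. by case: Mx. Qed.
Let M_cou m : M m -> cou m = 0. Proof. by case: Mx => _ h _ _; exact: h. Qed.
Let M_mul a m : M m -> M (a * m). Proof. by case: Mx => _ _ h _; exact: h. Qed.

Let aug0 a m : M m -> pt (a * m) = 0.
Proof.
move=> Mm; apply/aug_class_eq0 => //; rewrite couM (M_cou Mm) mulr0 scale0r subr0.
exact: M_mul.
Qed.

(** The left action with the class v as an argument: it is linear in v since
    A M is contained in M. *)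
Definition calc_lact (a : A) (v : aug_quot M) (b : A) : forms G :=
  tlift (fun a1 a2 => pt (a1 * aug_val (qrepr v)) (x) (a2 * b)) (cop a).

Lemma aug_act_lin a : is_linear (fun v : aug_quot M => pt (a * aug_val (qrepr v))).
Proof.
have l : is_linear (fun x : A => pt (a * (x - (cou x)%:A))).
  move=> c x y; rewrite -linearP; congr pt; rewrite -mulr_linr; congr (_ * _).
  by rewrite linearP scalerDl scalerBr scalerA opprD addrACA.
have -> : (fun v : aug_quot M => pt (a * aug_val (qrepr v))) =
          aug_lift (fun x : A => pt (a * (x - (cou x)%:A))).
  by apply/funext => v; rewrite /aug_lift cou_aug scale0r subr0.
apply: aug_lift_is_linear => //; first by rewrite cou1 scale1r subrr mulr0 linear0.
by move=> m Mm; rewrite (M_cou Mm) scale0r subr0 aug0.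
Qed.

Lemma calc_lact_lin a : is_bilinear (calc_lact a).
Proof.
have h a1 := aug_act_lin a1; split=> [b|v]; rewrite /calc_lact; last by lin.
apply: lin_tlift_par => a1 a2; apply: lin_tensl; exact: h.
Qed.

Lemma lact_tens a v b : lact a (v (x) b : forms G) = calc_lact a v b.
Proof. by rewrite /lact /= tlift_tens //; exact: calc_lact_lin. Qed.

(** In place of the representative chosen in the definition of the left action
    any element of ker eps can be used. *)
Lemma lact_class a x b : cou x = 0 ->
  lact a (pt x (x) b : forms G) =
  tlift (fun a1 a2 => pt (a1 * x) (x) (a2 * b)) (cop a).
Proof.
move=> x0; rewrite lact_tens /calc_lact; apply: eq_tlift => a1 a2; congr (_ (x) _).
have := repr_aug_class sM x; rewrite x0 scale0r subr0 => /(aug0 a1)/eqP.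
by rewrite mulrBr linearB subr_eq0 => /eqP.
Qed.

Lemma ract_tens v b c : ract (v (x) b : forms G) c = v (x) (b * c).
Proof. by rewrite /ract /= tlift_tens //; lin. Qed.

Lemma ddE a : dd G a = tlift (fun a1 a2 => pt a1 (x) a2) (cop a).
Proof.
rewrite /dd /=; have l : is_bilinear (fun a1 a2 => pt a1 (x) a2 : tensor _ A) by lin.
by rewrite (linBE _ _ (tlift_is_linear l)) tlift_tens // aug_class1 // tens0l subr0.
Qed.

Lemma lact_is_bilinear : is_bilinear (@lact K A G).
Proof.
split=> [w|a]; last by apply: tlift_is_linear; exact: calc_lact_lin.
change (is_linear (fun a => tlift (calc_lact a) w)); rewrite /calc_lact; lin.
Qed.

Lemma ract_is_bilinear : is_bilinear (@ract K A G).
Proof.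
change (is_bilinear (fun w c =>
  tlift (fun v b => v (x) (b * c) : tensor (aug_quot M) A) w)); lin.
Qed.

Lemma dd_is_linear : is_linear (dd G).
Proof.
have -> : dd G = fun a => tlift (fun a1 a2 => pt a1 (x) a2) (cop a).
  by apply/funext; exact: ddE.
lin.
Qed.

(** Representatives can be chosen in ker eps, where the left action is the
    expected formula. *)
Lemma forms_ext (W : lmodType K) (h h' : forms G -> W) :
  is_linear h -> is_linear h' ->
  (forall x b, cou x = 0 -> h (pt x (x) b) = h' (pt x (x) b)) -> h =1 h'.
Proof.
move=> hl hl' e; apply: eq_tensor_lin => // v b.
by rewrite -[v]aug_class_repr; apply: e; exact: cou_aug.
Qed.

Lemma calc_lact1 (w : forms G) : lact 1 w = w.
Proof.
move: w; apply: forms_ext => //; first exact: lact_is_bilinear.2.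
move=> x b x0; rewrite lact_class // cop1 tlift_tens ?mul1r //; lin.
Qed.

Lemma calc_ract1 (w : forms G) : ract w 1 = w.
Proof.
move: w; apply: forms_ext => //; first exact: ract_is_bilinear.1.
by move=> x b x0; rewrite ract_tens mulr1.
Qed.

Lemma calc_ractM a b (w : forms G) : ract w (a * b) = ract (ract w a) b.
Proof.
have [r1 r2] := ract_is_bilinear.
move: w; apply: forms_ext; [lin | lin |].
by move=> x c x0; rewrite !ract_tens mulrA.
Qed.

Lemma calc_lactM a b (w : forms G) : lact (a * b) w = lact a (lact b w).
Proof.
have [r1 r2] := lact_is_bilinear.
move: w; apply: forms_ext; [lin | lin |].
move=> x c x0; rewrite !lact_class // cop_mul; last by lin.
rewrite (tlift_comp _ _ (r2 a)).
have e (b1 b2 : A) : lact a (pt (b1 * x) (x) (b2 * c) : forms G) =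
  tlift (fun a1 a2 => pt (a1 * b1 * x) (x) (a2 * b2 * c)) (cop a).
  rewrite lact_class; last by rewrite couM x0 mulr0.
  by apply: eq_tlift => a1 a2; rewrite !mulrA.
under [RHS]eq_tlift => b1 b2 do rewrite e.
move: (cop a); apply: eq_tensor_lin; [lin | lin |].
move=> a1 a2; rewrite tlift_tens; last by lin.
by apply: eq_tlift => b1 b2; rewrite tlift_tens //; lin.
Qed.

Lemma calc_lract a b (w : forms G) : ract (lact a w) b = lact a (ract w b).
Proof.
have [r1 r2] := lact_is_bilinear; have [s1 s2] := ract_is_bilinear.
move: w; apply: forms_ext; [lin | lin |].
move=> x c x0; rewrite ract_tens !lact_class // (tlift_comp _ _ (s1 b)).
by apply: eq_tlift => a1 a2; rewrite ract_tens mulrA.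
Qed.

Lemma calc_leibniz a b : dd G (a * b) = ract (dd G a) b + lact a (dd G b).
Proof.
have [r1 r2] := lact_is_bilinear; have [s1 s2] := ract_is_bilinear.
rewrite !ddE cop_mul; last by lin.
rewrite (tlift_comp _ _ (r2 a)) (tlift_comp _ _ (s1 b)).
have e (b1 b2 : A) : lact a (pt b1 (x) b2 : forms G) =
    tlift (fun a1 a2 => pt (a1 * b1) (x) (a2 * b2)) (cop a) -
    (cou b1 : K) *: tlift (fun a1 a2 => pt a1 (x) (a2 * b2)) (cop a).
  have -> : pt b1 = pt (b1 - (cou b1)%:A).
    by rewrite linearB linearZ /= aug_class1 // scaler0 subr0.
  rewrite lact_class; last by rewrite linearB linearZ /= cou1 [_ *: _]mulr1 subrr.
  rewrite [RHS]addrC -[- (_ *: tlift _ _)]scaleNr -tlift_linear_fun; apply: eq_tlift => a1 a2.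
  by rewrite mulrBr mulr_algr linearB linearZ [_ - _]addrC -scaleNr tensDl.
under [X in _ + X]eq_tlift => b1 b2 do rewrite e.
move: (cop a); apply: eq_tensor_lin; [lin | lin |].
move=> a1 a2; rewrite tlift_tens; last by lin.
rewrite tlift_tens; last by lin.
under [X in _ + X]eq_tlift => b1 b2.
  by rewrite tlift_tens ?tlift_tens; [over | lin | lin].
by rewrite tlift_sub (cop_counitl b (f := fun x => pt a1 (x) (a2 * x))) ?ract_tens 1?addrC ?subrK //; lin.
Qed.

(** The left coaction: v (x) b is sent to v_(1) S v_(3) b_(1) (x) (v_(2) (x) b_(2)),
    which depends on v modulo M only because Ad_L preserves M. *)
Definition coact_tens (b : A) (t : tensor A A) : tensor A (forms G) :=
  tlift (fun a x => tlift (fun b1 b2 => (a * b1) (x) (pt x (x) b2 : forms G)) (cop b)) t.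

Definition coactl (w : forms G) : tensor A (forms G) :=
  tlift (fun v b => aug_lift (fun x => coact_tens b (AdL x)) v) w.

Lemma coact_tens_lin : is_bilinear coact_tens.
Proof. by rewrite /coact_tens; lin. Qed.

Lemma AdL_is_linear : is_linear (@AdL K A).
Proof. by rewrite /AdL; lin. Qed.

Let coact_lin b : is_linear (fun x => coact_tens b (AdL x)).
Proof. by have [r1 r2] := coact_tens_lin; have l := AdL_is_linear; lin. Qed.

Lemma AdL1 : AdL 1 = 1 (x) 1 :> tensor A A.
Proof.
rewrite /AdL cop1 tlift_tens ?cop1 ?tlift_tens; [|lin|lin].
by rewrite ant1 mul1r.
Qed.

Let coact_AdL1 b : coact_tens b (AdL 1) = 0.
Proof.
rewrite AdL1 /coact_tens tlift_tens ?aug_class1 //; last by lin.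
by apply: tlift0 => *; rewrite tens0l tens0r.
Qed.

Let coact_AdLM b m : M m -> coact_tens b (AdL m) = 0.
Proof.
case: Mx => _ _ _ h /h; move: (AdL m); apply: lspan_min => [|_ [a [x [Mx' ->]]]].
  exact: preim_subspace (coact_tens_lin.2 b) (subspace0 _).
rewrite /= /coact_tens tlift_tens; last by lin.
have -> : aug_class M x = 0 by rewrite -[x]mul1r aug0.
by apply: tlift0 => *; rewrite tens0l tens0r.
Qed.

Lemma coact_lift_lin : is_bilinear (fun (v : aug_quot M) b =>
  aug_lift (fun x => coact_tens b (AdL x)) v).
Proof.
split=> [b|v]; last exact: (coact_tens_lin.1 _).
exact: aug_lift_is_linear (coact_lin b) (coact_AdL1 b) (@coact_AdLM b).
Qed.

Lemma coactl_is_linear : is_linear coactl.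
Proof. exact/tlift_is_linear/coact_lift_lin. Qed.

Lemma coactl_class x b : coactl (aug_class M x (x) b) = coact_tens b (AdL x).
Proof.
rewrite /coactl tlift_tens; last exact: coact_lift_lin.
exact: aug_liftE (coact_lin b) (coact_AdL1 b) (@coact_AdLM b) x.
Qed.

(** d a is the sum of a_(1) (x) a_(2), so the left coaction produces
    a_(1) S a_(3) a_(4) (x) (a_(2) (x) a_(5)), where the antipode cancels. *)
Lemma coactl_dd a : coactl (dd G a) = tlift (fun a1 a2 => a1 (x) dd G a2) (cop a).
Proof.
have cl := coactl_is_linear; rewrite ddE (tlift_comp _ _ cl).
under eq_tlift => x b do rewrite coactl_class.
pose F x1 y b := tlift (fun x2 x3 => tlift (fun b1 b2 =>
   (x1 * ant x3 * b1) (x) (pt x2 (x) b2 : forms G)) (cop b)) (cop y).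
transitivity (tlift (fun x b => tlift (fun x1 y => F x1 y b) (cop x)) (cop a)).
  apply: eq_tlift => x b; rewrite /AdL (tlift_comp _ _ (coact_tens_lin.2 b)).
  apply: eq_tlift => x1 y; rewrite (tlift_comp _ _ (coact_tens_lin.2 b)).
  by apply: eq_tlift => x2 x3; rewrite /coact_tens tlift_tens //; lin.
rewrite cop_assoc; [|rewrite /F; lin..].
apply: eq_tlift => x1 z; rewrite /F cop_assoc; [|lin..].
rewrite ddE (tlift_comp (h := fun u => x1 (x) u)); last by lin.
apply: eq_tlift => x2 w; rewrite -cop_assoc; [|lin..].
under eq_tlift => c b2.
  under eq_tlift => x3 b1 do rewrite -mulrA.
  rewrite (cop_antl c (f := fun u => (x1 * u) (x) (pt x2 (x) b2 : forms G))); last by lin.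
  over.
by rewrite (cop_counitl w (f := fun u => (x1 * 1) (x) (pt x2 (x) u : forms G))) ?mulr1 //; lin.
Qed.

Lemma coactl_ract w b : coactl (ract w b) = tlift (fun c u => tlift (fun b1 b2 =>
   (c * b1) (x) ract u b2) (cop b)) (coactl w).
Proof.
have cl := coactl_is_linear; have [r1 r2] := ract_is_bilinear.
move: w; apply: forms_ext; [lin|lin|] => x c x0.
have [_ k2] := coact_tens_lin.
rewrite ract_tens !coactl_class; move: (AdL x); apply: eq_tensor_lin; [lin|lin|].
move=> a y; rewrite /coact_tens !tlift_tens; [|lin..].
rewrite cop_mul; last by lin.
rewrite tlift_comp; last by lin.
apply: eq_tlift => c1 c2; rewrite tlift_tens; last by lin.
by apply: eq_tlift => b1 b2; rewrite ract_tens mulrA.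
Qed.

Lemma lact_dd a b : lact a (dd G b) = dd G (a * b) - ract (dd G a) b.
Proof. by rewrite calc_leibniz addrC addKr. Qed.

Lemma calc_left_covariant a b : coactl (lact a (dd G b)) =
  tlift (fun a1 a2 => tlift (fun b1 b2 => (a1 * b1) (x) lact a2 (dd G b2)) (cop b)) (cop a).
Proof.
have dl := dd_is_linear; have [r1 r2] := ract_is_bilinear.
rewrite lact_dd (linBE _ _ coactl_is_linear) coactl_ract !coactl_dd.
rewrite cop_mul; last by lin.
rewrite (tlift_comp (h := tlift _)); last by lin.
rewrite -tlift_sub; apply: eq_tlift => a1 a2; rewrite tlift_tens; last by lin.
rewrite -tlift_sub; apply: eq_tlift => b1 b2.
by rewrite lact_dd tensBr.
Qed.

(** The right coaction is the coproduct of the second factor: the classes v are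
    right invariant. *)
Definition coactr (w : forms G) : tensor (forms G) A :=
  tlift (fun v b => tlift (fun b1 b2 => (v (x) b1 : forms G) (x) b2) (cop b)) w.

Lemma coactr_is_linear : is_linear coactr.
Proof. by apply: tlift_is_linear; lin. Qed.

Lemma coactr_tens v b :
  coactr (v (x) b) = tlift (fun b1 b2 => (v (x) b1 : forms G) (x) b2) (cop b).
Proof. by rewrite /coactr tlift_tens //; lin. Qed.

Lemma coactr_dd a : coactr (dd G a) = tlift (fun a1 a2 => dd G a1 (x) a2) (cop a).
Proof.
have cl := coactr_is_linear; rewrite ddE (tlift_comp _ _ cl).
under eq_tlift => x b do rewrite coactr_tens.
rewrite -cop_assoc; [|lin..]; apply: eq_tlift => x b.
by rewrite ddE (tlift_comp (h := fun u => u (x) b)) //; lin.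
Qed.

Lemma coactr_ract w b : coactr (ract w b) = tlift (fun u c => tlift (fun b1 b2 =>
   ract u b1 (x) (c * b2)) (cop b)) (coactr w).
Proof.
have cl := coactr_is_linear; have [r1 r2] := ract_is_bilinear.
move: w; apply: forms_ext; [lin|lin|] => x c x0.
rewrite ract_tens !coactr_tens cop_mul; last by lin.
rewrite (tlift_comp (h := tlift _)); last by lin.
apply: eq_tlift => c1 c2; rewrite tlift_tens; last by lin.
by apply: eq_tlift => b1 b2; rewrite ract_tens.
Qed.

Lemma calc_right_covariant a b : coactr (lact a (dd G b)) =
  tlift (fun a1 a2 => tlift (fun b1 b2 => lact a1 (dd G b1) (x) (a2 * b2)) (cop b)) (cop a).
Proof.
have dl := dd_is_linear; have [r1 r2] := ract_is_bilinear.
rewrite lact_dd (linBE _ _ coactr_is_linear) coactr_ract !coactr_dd.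
rewrite cop_mul; last by lin.
rewrite (tlift_comp (h := tlift _)); last by lin.
rewrite -tlift_sub; apply: eq_tlift => a1 a2; rewrite tlift_tens; last by lin.
rewrite -tlift_sub; apply: eq_tlift => b1 b2.
by rewrite lact_dd tensBl.
Qed.

(** The form v (x) 1 is recovered from d as (d v_(1)) S v_(2). *)
Lemma rinvE x : (pt x (x) 1 : forms G) =
  tlift (fun x1 x2 => ract (dd G x1) (ant x2)) (cop x).
Proof.
have dl := dd_is_linear; have [r1 r2] := ract_is_bilinear.
under eq_tlift => x1 x2.
  rewrite ddE (tlift_comp _ _ (r1 _)).
  under eq_tlift => y z do rewrite ract_tens.
  over.
rewrite cop_assoc; [|lin..].
under eq_tlift => y z.
  rewrite (cop_antr z (f := fun u => pt y (x) u)); last by lin.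
  over.
by rewrite (cop_counitr x (f := fun y => pt y (x) 1)) //; lin.
Qed.

(** By [rinvE] the forms v (x) b are sums of (d x) c = d(x c) - x d c. *)
Lemma calc_dd_span (w : forms G) :
  lspan [set lact a (dd G b) | a in setT & b in setT] w.
Proof.
have sL := lspan_subspace [set lact a (dd G b) | a in setT & b in setT].
have dl := dd_is_linear; have [r1 r2] := ract_is_bilinear.
move: w; apply: tensor_ind => // v b; rewrite -[v]aug_class_repr.
have -> : pt (aug_val (qrepr v)) (x) b = ract (pt (aug_val (qrepr v)) (x) 1 : forms G) b.
  by rewrite ract_tens mul1r.
rewrite rinvE (tlift_comp _ _ (r1 _)) tlift.unlock /lext.
apply: subspace_sum => // p _ _; apply: subspaceZ => //.
have e a c : lspan [set lact a (dd G b) | a in setT & b in setT] (lact a (dd G c)).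
  by apply: sub_lspan; exists a => //; exists c.
rewrite -calc_ractM; set c := (_ * _).
have -> : ract (dd G p.1) c = lact 1 (dd G (p.1 * c)) - lact p.1 (dd G c).
  by rewrite calc_lact1 lact_dd opprB addrC subrK.
by apply: subspaceB.
Qed.

(** Woronowicz: a crossed submodule defines a bicovariant calculus. *)
Lemma calc_of_bicovariant : bicovariant G.
Proof.
split.
- exact: lact_is_bilinear.
- exact: ract_is_bilinear.
- exact: calc_lact1.
- exact: calc_lactM.
- exact: calc_ract1.
- exact: calc_ractM.
- exact: calc_lract.
- exact: dd_is_linear.
- exact: calc_leibniz.
- exact: calc_dd_span.
- by exists coactl; [exact: coactl_is_linear | exact: calc_left_covariant].
- by exists coactr; [exact: coactr_is_linear | exact: calc_right_covariant].
Qed.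

End CalcOf.

(** * Exactness of tensor products over a field *)

Section TensorKernel.
Variable K : fieldType.
Implicit Types U V W : lmodType K.

Lemma lspan_family V n (u : nat -> V) x :
  lspan [set u i | i in [set i | (i < n)%N]] x ->
  exists c : nat -> K, x = \sum_(i < n) c i *: u i.
Proof.
pose S := [set x | exists c : nat -> K, x = \sum_(i < n) c i *: u i].
have sS : is_subspace S.
  split; first by exists (fun=> 0); rewrite big1 // => i _; rewrite scale0r.
  move=> a _ _ [c ->] [d ->]; exists (fun i => a * c i + d i).
  rewrite scaler_sumr -big_split; apply: eq_bigr => i _.
  by rewrite scalerDl scalerA.
move: x; apply: lspan_min => // _ [i /= lin <-]; exists (fun j => (j == i)%:R).
rewrite (bigD1 (Ordinal lin)) //= eqxx scale1r big1 ?addr0 // => j ji.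
by rewrite (negbTE (ji : j != i :> nat)) scale0r.
Qed.

Lemma separate_span V (W : set V) x : is_subspace W -> ~ W x ->
  exists f : V -> K^o, [/\ is_linear f, forall w, W w -> f w = 0 & f x = 1].
Proof.
move=> sW nWx; have nx : qproj W x <> 0 by move/qproj_eq0/(lspan_id _ sW).
have [f [fl fx]] := separating_functional nx.
exists (fun y => f (qproj W y)); split=> // [|w Ww]; first by lin.
by have /qproj_eq0 -> : lspan W w; [apply/lspan_id | exact: is_linear0].
Qed.

Lemma tensor_sum U V (t : tensor U V) : exists n (u : nat -> U) (v : nat -> V),
  t = \sum_(i < n) u i (x) v i.
Proof.
move: t; apply: tensor_ind => [|x y]; last by exists 1%N, (fun=> x), (fun=> y); rewrite big_ord1.
split=> [|c _ _ [n [u [v ->]]] [m [u' [v' ->]]]].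
  by exists 0%N, (fun=> 0), (fun=> 0); rewrite big_ord0.
exists (n + m)%N, (fun i => if (i < n)%N then c *: u i else u' (i - n)%N),
  (fun i => if (i < n)%N then v i else v' (i - n)%N).
rewrite big_split_ord /= scaler_sumr; congr (_ + _); apply: eq_bigr => i _.
  by rewrite ltn_ord tensZl.
by rewrite ltnNge leq_addr /= addKn.
Qed.

(** Tensor products over a field are exact.  A sum of n pure tensors is treated
    by induction on n: if the first factor of the last one is a combination
    of the others, merge it into them, and otherwise separate it from them by a
    functional, which shows that its second factor is in the kernel. *)
Lemma tensor_kerr U V W (g : V -> W) (t : tensor U V) : is_linear g ->
  tlift (fun u v => u (x) g v) t = 0 ->
  lspan [set t | exists u v, g v = 0 /\ t = u (x) v] t.
Proof.
move=> gl; have [n [u [v ->]]] := tensor_sum t.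
have bl : is_bilinear (fun u v => u (x) g v : tensor U W) by lin.
rewrite (lin_sumE _ _ _ (tlift_is_linear bl)).
under eq_bigr => i _ do rewrite tlift_tens //.
set S := [set t | _]; have sS := lspan_subspace S.
elim: n u v => [|n IH] u v; first by rewrite !big_ord0 => _; exact: sS.1.
rewrite !big_ord_recr /=.
have [un|un] := pselect (lspan [set u i | i in [set i | (i < n)%N]] (u n)).
  have [c uE] := lspan_family un; pose v' i := v i + c i *: v n.
  have e (Z : lmodType K) (h : V -> Z) : is_linear h ->
      \sum_(i < n) u i (x) h (v i) + u n (x) h (v n) = \sum_(i < n) u i (x) h (v' i).
    move=> hl; rewrite uE (lin_sumE _ _ _ (lin_tensl (h (v n)) (@lin_id _ U))) -big_split /=.
    apply: eq_bigr => i _; rewrite /v' (linDE _ _ hl) (linZE _ _ hl) tensAr.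
    by rewrite tensZl tensZr.
  by rewrite (e _ g) // (e _ (fun v => v)) //; apply: IH.
have [f [fl f0 f1]] := separate_span (lspan_subspace _) un.
move=> e; have gn : g (v n) = 0.
  have bf : is_bilinear (fun u w => (f u : K) *: w : W) by lin.
  have := congr1 (tlift (fun u w => (f u : K) *: w)) e.
  rewrite (is_linear0 (tlift_is_linear bf)) (linDE _ _ (tlift_is_linear bf)).
  rewrite (lin_sumE _ _ _ (tlift_is_linear bf)) big1 => [|i _]; last first.
    rewrite tlift_tens // f0 ?scale0r //.
    by apply: sub_lspan; exists (i : nat) => //=.
  by rewrite add0r tlift_tens // f1 scale1r.
apply: subspaceD => //; first by apply: IH; rewrite gn tens0r addr0 in e.
by apply: sub_lspan; exists (u n), (v n).
Qed.

(** Obtained from [tensor_kerr] by exchanging the factors. *)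
Lemma tensor_kerl U V W (g : U -> W) (t : tensor U V) : is_linear g ->
  (forall u, g u = 0 -> u = 0) -> tlift (fun u v => g u (x) v) t = 0 -> t = 0.
Proof.
move=> gl g0 e; pose flip (X Y : lmodType K) (s : tensor X Y) := tlift (fun x y => y (x) x) s.
have flipl X Y : is_linear (@flip X Y) by rewrite /flip; lin.
have flipK X Y (s : tensor X Y) : flip _ _ (flip _ _ s) = s.
  by move: s; apply: eq_tensor_lin; [lin | lin |] => x y; rewrite /flip !tlift_tens //; lin.
have : tlift (fun v u => v (x) g u) (flip _ _ t) = 0.
  rewrite -[RHS](is_linear0 (flipl _ _)) -e !(tlift_comp _ _ (flipl _ _)).
  rewrite /flip tlift_comp; last by lin.
  by apply: eq_tlift => u v; rewrite !tlift_tens //; lin.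
move=> /(tensor_kerr gl) h; rewrite -[t]flipK -[RHS](is_linear0 (flipl _ _)).
congr flip; apply: (lspan_min (subspace0 _) _ h).
by move=> _ [u [v [/g0 -> ->]]]; rewrite /= tens0r.
Qed.

Lemma tens1_inj U (A : hopfAlg K) (u : U) : u (x) (1 : A) = 0 -> u = 0.
Proof.
move=> /(congr1 (tlift (fun (u : U) b => (cou b : K) *: u))).
have bl : is_bilinear (fun (u : U) (b : A) => (cou b : K) *: u) by lin.
by rewrite (is_linear0 (tlift_is_linear bl)) tlift_tens // cou1 scale1r.
Qed.

End TensorKernel.

(** * Maps between calculi *)
Section CompareCalculi.
Variables (K : fieldType) (A : hopfAlg K).

Lemma calc_iso_refl (G : calculus A) : calc_iso A G G.
Proof. by exists id; split; [split | exists id]. Qed.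

Lemma calc_map_rinv (M : set A) (G : calculus A) (f : forms (calc_of M) -> forms G) x :
  is_crossed M -> calc_map f ->
  f (aug_class M x (x) 1) = tlift (fun x1 x2 => ract (dd G x1) (ant x2)) (cop x).
Proof.
move=> Mx [fl _ fr fd]; rewrite (rinvE Mx) (tlift_comp _ _ fl).
by apply: eq_tlift => x1 x2; rewrite fr fd.
Qed.

(** A map of calculi commutes with d, so by [rinvE] it sends x (x) 1 to x (x) 1;
    for x in M the image vanishes. *)
Lemma calc_map_sub (M M' : set A) (f : forms (calc_of M) -> forms (calc_of M')) :
  is_crossed M -> is_crossed M' -> calc_map f -> M `<=` M'.
Proof.
move=> Mx Mx' fc x Mxx; have x0 : cou x = 0 by case: Mx => _ h _ _; exact: h.
have [sM _ _ _] := Mx; have [sM' _ _ _] := Mx'; have [fl _ _ _] := fc.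
have := calc_map_rinv x Mx fc; rewrite -rinvE //.
have /aug_class_eq0 -> // : M (x - (cou x)%:A) by rewrite x0 scale0r subr0.
rewrite tens0l (is_linear0 fl) => /esym/tens1_inj/aug_class_eq0.
by rewrite x0 scale0r subr0; apply.
Qed.

Lemma calc_iso_crossed (M M' : set A) : is_crossed M -> is_crossed M' ->
  calc_iso A (calc_of M) (calc_of M') -> M = M'.
Proof.
move=> Mx Mx' [f [fc [g fK gK]]]; apply/seteqP; split; first exact: calc_map_sub fc.
have [fl fa fr fd] := fc; apply: (@calc_map_sub _ _ g) => //; split.
- by move=> c x y; apply: (can_inj fK); rewrite fl !gK.
- by move=> a w; apply: (can_inj fK); rewrite fa !gK.
- by move=> a w; apply: (can_inj fK); rewrite fr !gK.
- by move=> a; apply: (can_inj fK); rewrite fd !gK.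
Qed.

End CompareCalculi.

Section QuotientCalculi.
Variables (K : fieldType) (A : hopfAlg K) (M : set A) (G' : calculus A).
Variable f : forms (calc_of M) -> forms G'.
Hypotheses (Mx : is_crossed M) (G'b : bicovariant G') (fq : calc_quotient_map f).
Local Notation G := (calc_of M).
Local Notation pt := (@aug_class K A M).

(** The crossed submodule of a quotient calculus G'. *)
Definition quot_submod : set A := [set x | cou x = 0 /\ f (pt x (x) 1) = 0].

Let fl : is_linear f. Proof. by case: fq => -[]. Qed.
Let sM : is_subspace M. Proof. by case: Mx. Qed.

Let fpt_lin : is_linear (fun y : A => f (pt y (x) 1)).
Proof. by lin. Qed.

Lemma quot_submod_sup : M `<=` quot_submod.
Proof.
move=> x Mxx; have x0 : cou x = 0 by case: Mx => _ h _ _; exact: h.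
split=> //; have /aug_class_eq0 -> // : M (x - (cou x)%:A) by rewrite x0 scale0r subr0.
by rewrite tens0l (is_linear0 fl).
Qed.

Let f_lact a w : f (lact a w) = lact a (f w). Proof. by case: fq => -[]. Qed.
Let f_ract a w : f (ract w a) = ract (f w) a. Proof. by case: fq => -[]. Qed.
Let f_dd a : f (dd G a) = dd G' a. Proof. by case: fq => -[]. Qed.

(* the coactions of a bicovariant calculus are known on the forms a d b only *)
Let lin_ext (W : lmodType K) (h h' : forms G -> W) : is_linear h -> is_linear h' ->
  (forall a b, h (lact a (dd G b)) = h' (lact a (dd G b))) -> h =1 h'.
Proof.
move=> hl hl' e w; apply/eqP; rewrite -subr_eq0; apply/eqP; move: w (calc_dd_span Mx w).
have l : is_linear (fun w => h w - h' w) by lin.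
move=> w; move: w; apply: lspan_min; first exact: preim_subspace l (subspace0 _).
by move=> _ [a _ [b _ <-]] /=; rewrite e subrr.
Qed.

Lemma quot_coactl : exists2 D : forms G' -> tensor A (forms G'), is_linear D &
  forall w, D (f w) = tlift (fun a u => a (x) f u) (coactl w).
Proof.
have [D Dl DE] := left_covariant G'b; exists D => //.
have cl := coactl_is_linear Mx; apply: lin_ext; [lin | lin |] => a b.
rewrite f_lact f_dd DE calc_left_covariant // tlift_comp; last by lin.
apply: eq_tlift => a1 a2; rewrite tlift_comp; last by lin.
by apply: eq_tlift => b1 b2; rewrite tlift_tens ?f_lact ?f_dd //; lin.
Qed.

Lemma quot_coactr : exists2 D : forms G' -> tensor (forms G') A, is_linear D &
  forall w, D (f w) = tlift (fun u a => f u (x) a) (coactr w).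
Proof.
have [D Dl DE] := right_covariant G'b; exists D => //.
have cl := @coactr_is_linear _ _ M; apply: lin_ext; [lin | lin |] => a b.
rewrite f_lact f_dd DE calc_right_covariant // tlift_comp; last by lin.
apply: eq_tlift => a1 a2; rewrite tlift_comp; last by lin.
by apply: eq_tlift => b1 b2; rewrite tlift_tens ?f_lact ?f_dd //; lin.
Qed.

(** The right invariant forms killed by a quotient calculus are those of a
    crossed submodule: it is a left ideal because av (x) 1 is
    a_(1) (v (x) 1) S a_(2), and it is preserved by Ad_L because of the left
    coaction. *)
Lemma quot_submod_crossed : is_crossed quot_submod.
Proof.
have [r1 r2] := ract_bilinear G'b; have [l1 l2] := lact_bilinear G'b.
have s' : is_subspace quot_submod.
  split; first by rewrite /quot_submod /= linear0 linear0 tens0l (is_linear0 fl).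
  move=> c x y [x0 fx] [y0 fy]; split; first by rewrite linearP x0 y0 scaler0 addr0.
  by rewrite (fpt_lin c x y) fx fy scaler0 addr0.
split=> [//|x [//]|a x [x0 fx]|x [x0 fx]].
  split; first by rewrite couM x0 mulr0.
  have <- : tlift (fun a1 a2 => ract (lact a1 (pt x (x) 1 : forms G)) (ant a2)) (cop a) =
         pt (a * x) (x) 1.
    have rl := ract_is_bilinear M; have [rl1 rl2] := rl.
    under eq_tlift => a1 a2.
      rewrite lact_class // (tlift_comp _ _ (rl1 _)).
      under eq_tlift => y z do rewrite ract_tens mulr1.
      over.
    rewrite cop_assoc; [|lin..].
    under eq_tlift => y z.
      rewrite (cop_antr z (f := fun u => pt (y * x) (x) u)); last by lin.
      over.
    by rewrite (cop_counitr a (f := fun y => pt (y * x) (x) 1)) //; lin.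
  rewrite (tlift_comp _ _ fl); apply: tlift0 => a1 a2.
  by rewrite f_ract f_lact fx (is_linear0 (l2 _)) (is_linear0 (r1 _)).
have [D Dl DE] := quot_coactl.
have := DE (pt x (x) 1); rewrite fx (is_linear0 Dl) (coactl_class Mx).
have e1 : tlift (fun a u => a (x) f u) (coact_tens M 1 (AdL x)) =
          tlift (fun a y => a (x) f (pt y (x) 1)) (AdL x).
  rewrite /coact_tens tlift_comp; last by lin.
  apply: eq_tlift => a y; rewrite cop1 !tlift_tens ?mulr1 //; lin.
rewrite e1 => /esym/(tensor_kerr fpt_lin) h.
have bp : is_bilinear (fun a y : A => a (x) (y - (cou y)%:A)) by lin.
have -> : AdL x = tlift (fun a y : A => a (x) (y - (cou y)%:A)) (AdL x).
  under eq_tlift => a y do rewrite tensBr tensZr.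
  have bc : is_bilinear (fun a y : A => (cou y : K) *: (a (x) (1 : A))) by lin.
  rewrite tlift_sub; have <- : AdL x = tlift (fun u v => u (x) v) (AdL x).
    by move: (AdL x); apply: eq_tensor_lin => [//||u v]; [lin | rewrite tlift_tens //; lin].
  rewrite {3}/AdL (tlift_comp _ _ (tlift_is_linear bc)).
  under [X in _ - X]eq_tlift => a y.
    rewrite (tlift_comp _ _ (tlift_is_linear bc)).
    under eq_tlift => v2 v3 do rewrite tlift_tens //.
    rewrite (cop_counitl y (f := fun u => (a * ant u) (x) (1 : A))); last by lin.
    over.
  rewrite (cop_antr x (f := fun u => u (x) (1 : A))); last by lin.
  by rewrite x0 scale0r subr0.
move: h; move: (AdL x); apply: lspan_min.
  exact: preim_subspace (tlift_is_linear bp) (lspan_subspace _).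
move=> _ [a [y [fy ->]]] /=; rewrite tlift_tens //.
apply: sub_lspan; exists a, (y - (cou y)%:A); split=> //; split.
  by rewrite linearB linearZ /= cou1 [_ *: _]mulr1 subrr.
by rewrite linearB linearZ /= aug_class1 // scaler0 subr0.
Qed.

Lemma quot_submod_full : (forall x, cou x = 0 -> quot_submod x) ->
  forall w', w' = 0 :> forms G'.
Proof.
have [r1 r2] := ract_bilinear G'b.
move=> h w'; have [_ /(_ w')[w <-]] := fq; move: w.
have l0 := @lin_const0 _ (tensor (aug_quot M) A) (forms G').
apply: forms_ext => // x b x0; have [_ fx] := h x x0.
have -> : pt x (x) b = ract (pt x (x) 1 : forms G) b by rewrite ract_tens mul1r.
by rewrite f_ract fx (is_linear0 (r1 _)).
Qed.

(** The projection of a form onto its right invariant part turns an element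
    sum of v_i (x) b_i of the kernel of f, through the right coaction, into the
    relation sum of f(v_i (x) 1) (x) b_i = 0, and f is injective on right
    invariant forms. *)
Lemma quot_submod_inj : quot_submod `<=` M -> injective f.
Proof.
have [r1 r2] := ract_bilinear G'b; move=> sub.
have gl : is_linear (fun v : aug_quot M => f (v (x) 1)) by lin.
have g0 v : f (v (x) 1) = 0 -> v = 0.
  move=> fv; rewrite -[v]aug_class_repr; apply/aug_class_eq0 => //.
  rewrite cou_aug scale0r subr0; apply: sub; split; first exact: cou_aug.
  by rewrite aug_class_repr.
move=> w1 w2 e; apply/eqP; rewrite -subr_eq0; apply/eqP.
have fw : f (w1 - w2) = 0 by rewrite (linBE _ _ fl) e subrr.
move: (w1 - w2) fw => w fw; apply: (tensor_kerl gl g0).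
have [D Dl DE] := quot_coactr.
have bR : is_bilinear (fun (u : forms G') c => ract u (ant c)) by lin.
pose P (u : forms G') := tlift (fun u c => ract u (ant c)) (D u).
have Pl : is_linear P by rewrite /P; lin.
have PE v b : P (f (v (x) b)) = (cou b : K) *: f (v (x) 1).
  rewrite /P DE tlift_comp; last by lin.
  rewrite coactr_tens tlift_comp; last by lin.
  under eq_tlift => b1 b2.
    by rewrite !tlift_tens // -?f_ract ?ract_tens; [over | lin].
  by rewrite (cop_antr b (f := fun u => f (v (x) u))) //; lin.
have -> : tlift (fun v b => f (v (x) 1) (x) b) w = tlift (fun u b => P u (x) b) (D (f w)).
  have cr := @coactr_is_linear _ _ M.
  have bf : is_bilinear (fun (u : forms G) (a : A) => f u (x) a) by lin.
  have bP : is_bilinear (fun (u : forms G') (a : A) => P u (x) a) by lin.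
  move: w {fw}; apply: eq_tensor_lin; [lin | lin |] => v b.
  rewrite DE coactr_tens tlift_tens; last by lin.
  rewrite !(tlift_comp _ _ (tlift_is_linear bf)) tlift_comp; last by lin.
  under [RHS]eq_tlift => b1 b2.
    by rewrite (tlift_tens _ _ bf) (tlift_tens _ _ bP) PE tensZl; over.
  by rewrite (cop_counitl b (f := fun u => f (v (x) 1) (x) u)) //; lin.
by rewrite fw (is_linear0 Dl); apply: is_linear0; lin.
Qed.

End QuotientCalculi.

(** * Bases and dimension *)

Section FiniteDimension.
Variables (K : fieldType) (V : lmodType K).
Implicit Types W : set V.

Lemma is_basisI W n (b : 'I_n -> V) : (forall i, W (b i)) ->
  (forall v, W v -> exists c : 'I_n -> K, v = \sum_(i < n) c i *: b i) ->
  (forall c : 'I_n -> K, \sum_(i < n) c i *: b i = 0 -> forall i, c i = 0) ->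
  is_basis W b.
Proof.
move=> Wb gen free; split=> // v /gen[c ->]; exists [ffun i => c i]; split.
  by apply: eq_bigr => i _; rewrite ffunE.
move=> d /eqP; rewrite -subr_eq0 -sumrB => /eqP e; apply/ffunP => i; rewrite ffunE.
apply/eqP; rewrite -subr_eq0; apply/eqP; apply: (free (fun i => c i - d i)).
by rewrite -[RHS]e; apply: eq_bigr => j _; rewrite scalerBl.
Qed.

Lemma basis_coords W n (b : 'I_n -> V) m (w : 'I_m -> V) : is_basis W b ->
  (forall i, W (w i)) -> exists A : 'M[K]_(m, n), forall i, w i = \sum_j A i j *: b j.
Proof.
move=> [_ gen] Ww.
have /choice[c cE] : forall i, exists c : {ffun 'I_n -> K}, w i = \sum_j c j *: b j.
  by move=> i; have [c [cE _]] := gen _ (Ww i); exists c.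
exists (\matrix_(i, j) c i j) => i; rewrite cE.
by apply: eq_bigr => j _; rewrite mxE.
Qed.

Lemma sum_coords n (b : 'I_n -> V) m (w : 'I_m -> V) (A : 'M[K]_(m, n)) (u : 'rV[K]_m) :
  (forall i, w i = \sum_j A i j *: b j) ->
  \sum_i u 0 i *: w i = \sum_j (u *m A) 0 j *: b j.
Proof.
move=> wE; under eq_bigr => i _ do rewrite wE scaler_sumr.
rewrite exchange_big; apply: eq_bigr => j _; rewrite mxE scaler_suml.
by apply: eq_bigr => i _; rewrite scalerA.
Qed.

(** More vectors than the dimension: their coordinate matrix has a nonzero row
    kernel. *)
Lemma dim_dependent W n m (w : 'I_m -> V) : has_dim W n -> (n < m)%N ->
  (forall i, W (w i)) ->
  exists2 c : 'I_m -> K, (exists i, c i != 0) & \sum_i c i *: w i = 0.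
Proof.
move=> [b bb] nm Ww; have [A AE] := basis_coords bb Ww.
have : kermx A != 0.
  rewrite -mxrank_eq0 mxrank_ker subn_eq0 -ltnNge.
  exact: leq_ltn_trans (rank_leq_col A) nm.
case/rowV0Pn => u /sub_kermxP uA /rV0Pn[i ui].
exists (fun i => u 0 i); first by exists i.
by rewrite (sum_coords _ AE) uA big1 // => j _; rewrite mxE scale0r.
Qed.

(** n independent vectors in dimension n: their coordinate matrix is
    invertible. *)
Lemma dim_basis W n (w : 'I_n -> V) : W 0 -> has_dim W n -> (forall i, W (w i)) ->
  (forall c : 'I_n -> K, \sum_(i < n) c i *: w i = 0 -> forall i, c i = 0) ->
  is_basis W w.
Proof.
move=> W0 [b bb] Ww free; have [A AE] := basis_coords bb Ww.
have Af : row_free A.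
  rewrite -kermx_eq0; apply/eqP/row_matrixP => i; rewrite row0; apply/rowP => j; rewrite mxE [RHS]mxE.
  have : row i (kermx A) *m A = 0 by apply/sub_kermxP/row_sub.
  move=> uA; have := free (fun j => row i (kermx A) 0 j); rewrite (sum_coords _ AE) uA.
  rewrite big1 => [h|k _]; last by rewrite mxE scale0r.
  by have := h (erefl _) j; rewrite !mxE.
have Au : A \in unitmx by rewrite -row_free_unit.
apply: is_basisI => // v Wv; have [_ /(_ v Wv)[d [dE _]]] := bb.
pose u := (\row_j d j) *m invmx A; exists (fun i => u 0 i).
rewrite (sum_coords u AE) /u mulmxKV // dE.
by apply: eq_bigr => j _; rewrite mxE.
Qed.

Lemma is_basis_seq (T : eqType) W (s : seq T) (w : T -> V) : uniq s ->
  (forall t, t \in s -> W (w t)) ->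
  (forall v, W v -> exists c : T -> K, v = \sum_(t <- s) c t *: w t) ->
  (forall c : T -> K, \sum_(t <- s) c t *: w t = 0 -> forall t, t \in s -> c t = 0) ->
  has_dim W (size s).
Proof.
move=> us Ww gen free; exists (fun i => w (tnth (in_tuple s) i)); apply: is_basisI.
- by move=> i; apply/Ww/mem_tnth.
- by move=> v /gen[c ->]; exists (fun i => c (tnth (in_tuple s) i)); rewrite big_tnth.
move=> c e i; pose d t := if insub (index t s) is Some j then c j else 0.
have dE j : d (tnth (in_tuple s) j) = c j.
  have t0 := tnth (in_tuple s) j.
  by rewrite /d (tnth_nth t0) /= index_uniq // insubT //= => h; congr c; apply: val_inj.
rewrite -dE; apply: free; last exact: mem_tnth.
by rewrite big_tnth -[RHS]e; apply: eq_bigr => j _; rewrite dE.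
Qed.

End FiniteDimension.

(** * Gaussian binomials and the monomials X^n g^s *)

Section Gauss.
Variables (K : fieldType) (p : K).

(** Gaussian binomial coefficients. *)
Fixpoint gauss (n k : nat) : K :=
  match n, k with
  | _, 0%N => 1
  | 0%N, _.+1 => 0
  | n'.+1, k'.+1 => gauss n' k'.+1 + p ^+ (n' - k') * gauss n' k'
  end.

Lemma gauss0 n : gauss n 0 = 1. Proof. by case: n. Qed.

Lemma gaussS n k :
  gauss n.+1 k.+1 = gauss n k.+1 + p ^+ (n - k) * gauss n k.
Proof. by []. Qed.

Lemma gauss_small n k : (n < k)%N -> gauss n k = 0.
Proof.
elim: n k => [|n IH] [|k] // nk; rewrite gaussS !IH ?mulr0 ?addr0 //.
exact: ltnW.
Qed.

Lemma gaussnn n : gauss n n = 1.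
Proof.
elim: n => [//|n IH]; rewrite gaussS gauss_small // IH subnn.
by rewrite add0r mul1r.
Qed.

Lemma gaussSn n : gauss n.+1 n = \sum_(i < n.+1) p ^+ i.
Proof.
elim: n => [|n IH]; first by rewrite gauss0 big_ord1.
rewrite gaussS gaussnn IH subSnn expr1 [RHS]big_ord_recl expr0; congr (_ + _).
by rewrite mulr_sumr; apply: eq_bigr => i _; rewrite -exprS.
Qed.

(** The Pascal rule with the power of p on the other term; the two together
    drive the induction for the adjoint coaction. *)
Lemma gaussSr n k :
  gauss n.+1 k.+1 = p ^+ k.+1 * gauss n k.+1 + gauss n k.
Proof.
elim: n k => [|n IH] k.
  by rewrite gaussS sub0n expr0 mul1r /= mulr0.
rewrite gaussS; case: k => [|k].
  by rewrite [in LHS]IH [in RHS]gaussS !gauss0 !subn0 !exprS expr0; ring.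
rewrite [in LHS](IH k.+1) [in LHS](IH k) [gauss n.+1 k.+2]gaussS [gauss n.+1 k.+1]gaussS subSS.
have [kn|nk] := leqP k.+1 n; last by rewrite (gauss_small nk); ring.
have -> : (n - k = (n - k.+1).+1)%N by lia.
by rewrite !exprS; ring.
Qed.

End Gauss.

Section BqMonomials.
Variables (K : fieldType) (q : K) (q0 : q != 0).
Local Notation B := (Bq q0).
Local Notation p := (q^-1).

Definition bmon (n : nat) (s : int) : B := Bq_mon q0 n s.

Lemma bmonM n s m t :
  bmon n s * bmon m t = q ^ (- (s * m%:Z)) *: bmon (n + m) (s + t).
Proof. exact: Bq_monM. Qed.

Lemma bmonXM n m t : bmon n 0 * bmon m t = bmon (n + m) t.
Proof. by rewrite bmonM mul0r oppr0 scale1r add0r. Qed.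

Lemma bmonMg n s t : bmon n s * bmon 0 t = bmon n (s + t).
Proof. by rewrite bmonM mulr0 oppr0 scale1r addn0. Qed.

Lemma bmon_gM s m t : bmon 0 s * bmon m t = q ^ (- (s * m%:Z)) *: bmon m (s + t).
Proof. by rewrite bmonM. Qed.

Lemma bmon1 : bmon 0 0 = 1. Proof. exact: Bq_mon1. Qed.

Lemma bmonX n : bmon 1 0 ^+ n = bmon n 0. Proof. exact: Bq_XE. Qed.

Lemma cou_bmon n s : cou (bmon n s) = (n == 0%N)%:R.
Proof. exact: Bq_cou_mon. Qed.

Lemma bmon_ext (V : lmodType K) (h h' : B -> V) : is_linear h -> is_linear h' ->
  (forall n s, h (bmon n s) = h' (bmon n s)) -> h =1 h'.
Proof. by move=> hl hl' e; apply: eq_sc_lin => // -[n s]; apply: e. Qed.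

Definition bcoef (n : nat) (s : int) : B -> K^o := sc_coef (T := Bq_table q0) (n, s).

Lemma bcoef_is_linear n s : is_linear (bcoef n s).
Proof. exact: sclin_is_linear. Qed.

HB.instance Definition _ n s := GRing.isLinear.Build K B K^o *:%R (bcoef n s)
  (bcoef_is_linear n s).

Lemma bcoef_mon n s m t : bcoef n s (bmon m t) = ((m == n) && (t == s))%:R.
Proof. by exact: (sc_coefE (T := Bq_table q0)). Qed.

Lemma bmon_expand (x : B) : exists2 S : seq (nat * int), uniq S &
  x = \sum_(b <- S) bcoef b.1 b.2 x *: bmon b.1 b.2.
Proof.
have [S uS {1}->] := sc_expand x; exists S => //.
by apply: eq_bigr => -[n s] _.
Qed.

(** The q-binomial theorem for X (x) 1 + g (x) X. *)
Lemma cop_bmon n s : cop (bmon n s) =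
  \sum_(j < n.+1) gauss p n j *: (bmon (n - j) (j%:Z + s) (x) bmon j s).
Proof.
elim: n => [|n IH].
  by rewrite big_ord1 gauss0 scale1r add0r [LHS]Bq_copg.
have -> : bmon n.+1 s = bmon 1 0 * bmon n s by rewrite bmonXM add1n.
rewrite copM IH [cop (bmon 1 0)]Bq_copX -!/(bmon _ _) mulrDl !mulr_sumr.
have e1 (j : 'I_n.+1) : bmon 1 0 (x) 1 * (gauss p n j *: (bmon (n - j) (j%:Z + s) (x) bmon j s))
   = gauss p n j *: (bmon (n.+1 - j) (j%:Z + s) (x) bmon j s).
  rewrite -scalerAr tens_mul mul1r bmonXM; congr (_ *: (bmon _ _ (x) _)).
  by have := ltn_ord j; lia.
have e2 (j : 'I_n.+1) : bmon 0 1 (x) bmon 1 0 * (gauss p n j *: (bmon (n - j) (j%:Z + s) (x) bmon j s))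
   = (p ^+ (n - j) * gauss p n j) *: (bmon (n.+1 - j.+1) (j.+1%:Z + s) (x) bmon j.+1 s).
  rewrite -scalerAr tens_mul bmonXM bmon_gM mul1r tensZl scalerA mulrC -exprnN exprVn subSS.
  by rewrite addrA -intS.
under eq_bigr => j _ do rewrite e1.
under [X in _ + X]eq_bigr => j _ do rewrite e2.
rewrite [RHS]big_ord_recl [X in X + _ = _]big_ord_recl !gauss0 -addrA; congr (_ + _).
rewrite [X in X + _](_ : _ = \sum_(j < n.+1) gauss p n j.+1 *:
    (bmon (n.+1 - j.+1) (j.+1%:Z + s) (x) bmon j.+1 s)); last first.
  by rewrite big_ord_recr /= gauss_small // scale0r addr0.
rewrite -big_split; apply: eq_bigr => j _ /=.
by rewrite -scalerDl.
Qed.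

End BqMonomials.

(** The elements X^k r(g) for polynomials r. *)
HB.lock Definition bpoly (K : fieldType) (q : K) (q0 : q != 0) (k : nat) (r : {poly K}) :
  Bq q0 := bmon q0 k 0 * horner_alg (bmon q0 0 1) r.

Section BqPolynomials.
Variables (K : fieldType) (q : K) (q0 : q != 0).
Local Notation B := (Bq q0).
Local Notation p := (q^-1).
Local Notation bmon := (bmon q0).
Local Notation bpoly := (bpoly q0).
Local Notation bcoef := (@bcoef K q q0).

Lemma bpoly_is_linear k : is_linear (bpoly k).
Proof. by move=> c x y; rewrite bpoly.unlock linearP /= mulr_algl mulr_linr. Qed.

HB.instance Definition _ k := GRing.isLinear.Build K {poly K} B *:%R (bpoly k)
  (bpoly_is_linear k).

Lemma horner_bmon i : horner_alg (bmon 0 1) 'X^i = bmon 0 i.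
Proof.
rewrite rmorphXn /= horner_algX; elim: i => [|i IH]; first by rewrite expr0 -bmon1.
by rewrite exprS IH bmonMg -intS.
Qed.

Lemma bpolyX k i : bpoly k 'X^i = bmon k i.
Proof. by rewrite bpoly.unlock horner_bmon bmonMg add0r. Qed.

Lemma bpoly1 k : bpoly k 1 = bmon k 0.
Proof. by rewrite -(expr0 'X) bpolyX. Qed.

Lemma bmonX_bpoly m k r : bmon m 0 * bpoly k r = bpoly (m + k) r.
Proof. by rewrite bpoly.unlock mulrA bmonXM. Qed.

Lemma bmon_g_bpoly i k r : bmon 0 (i : nat) * bpoly k r = p ^+ (i * k) *: bpoly k ('X^i * r).
Proof.
rewrite bpoly.unlock mulrA bmon_gM addr0 -scalerAl rmorphM /= horner_bmon mulrA bmonMg add0r.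
by rewrite -PoszM -exprnN exprVn.
Qed.

Lemma bpoly_Mg k r i : bpoly k r * bmon 0 (i : nat) = bpoly k (r * 'X^i).
Proof. by rewrite bpoly.unlock -mulrA -horner_bmon -rmorphM. Qed.

Lemma bmon_bpolyC s k r :
  bmon 0 s * bpoly k r = q ^ (- (s * k%:Z)) *: (bpoly k r * bmon 0 s).
Proof.
move: r; apply: lin_poly_ext => [c x y|c x y|m]; first by rewrite linearP mulr_linr.
  by rewrite linearP mulr_linl scalerDr !scalerA mulrC.
by rewrite bpolyX bmon_gM bmonMg addrC.
Qed.

Lemma bcoef_bpoly n i k r : bcoef n i%:Z (bpoly k r) = (k == n)%:R * r`_i.
Proof.
move: r; apply: (lin_poly_ext (V := K^o)); [lin | |move=> m].
  by move=> c x y; rewrite coefD coefZ mulrDr mulrCA.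
rewrite bpolyX bcoef_mon coefXn eqz_nat [i == m]eq_sym.
by case: eqP => _; case: eqP => _; rewrite ?mul1r ?mul0r.
Qed.

Lemma cou_bpoly k r : cou (bpoly k r) = (k == 0%N)%:R * r.[1].
Proof.
move: r; apply: (lin_poly_ext (V := K^o)); [lin | |move=> m].
  by move=> c x y; rewrite hornerD hornerZ mulrDr mulrCA.
by rewrite bpolyX cou_bmon hornerXn expr1n mulr1.
Qed.

(** Up to a power of g on the left every element is polynomial in g. *)
Lemma bpoly_norm (a : B) : exists n0, forall n : nat, (n0 <= n)%N ->
  exists P : nat -> {poly K}, bmon 0 n * a = \sum_(k < n) bpoly k (P k).
Proof.
pose N (a : B) := exists n0, forall n : nat, (n0 <= n)%N ->
  exists P : nat -> {poly K}, bmon 0 n * a = \sum_(k < n) bpoly k (P k).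
rewrite -/(N a); have [S _ ->] := bmon_expand a; apply: subspace_sum => [|-[m s] _ _].
  split; first by exists 0%N => n _; exists (fun=> 0); rewrite mulr0 big1 // => k _; rewrite linear0.
  move=> c x y [n0 h] [n1 h']; exists (maxn n0 n1) => n; rewrite geq_max => /andP[/h[P xE] /h'[P' yE]].
  exists (fun k => c *: P k + P' k); rewrite mulr_linr xE yE scaler_sumr -big_split.
  by apply: eq_bigr => k _; rewrite linearP.
rewrite /=; set c := bcoef _ _ _; exists (m.+1 + `|s|)%N => n nP.
have mn : (m < n)%N by apply: leq_trans nP; rewrite leq_addr.
exists (fun k => if k == m then (c * q ^ (- (n%:Z * m%:Z))) *: 'X^(`|n%:Z + s|) else 0).
rewrite (bigD1 (Ordinal mn)) //= eqxx big1 => [|k km]; last first.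
  by rewrite (negbTE (km : k != m :> nat)) linear0.
rewrite addr0 linearZ /= bpolyX -scalerAr bmon_gM scalerA.
by congr (_ *: bmon _ _); lia.
Qed.

Lemma bmon_gK (n : int) : bmon 0 (- n) * bmon 0 n = 1.
Proof. by rewrite bmonMg addNr bmon1. Qed.

End BqPolynomials.

(** * The adjoint coaction on X^k r(g) *)

Section BqAdjoint.
Variables (K : fieldType) (q : K) (q0 : q != 0).
Local Notation B := (Bq q0).
Local Notation p := (q^-1).
Local Notation bmon := (bmon q0).
Local Notation bpoly := (bpoly q0).
Local Notation bcoef := (@bcoef K q q0).

(** From Ad_L(a v) = a_(1) v_(1) S v_(3) S a_(3) (x) a_(2) v_(2): multiplying by
    X turns Ad_L(v) into a combination of three terms, one for each Sweedler
    component of X that can carry X. *)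
Lemma bq_AdL_X (v : B) : AdL (bmon 1 0 * v) = tlift (fun a b =>
  (bmon 1 0 * a) (x) b + (bmon 0 1 * a) (x) (bmon 1 0 * b)
  - (bmon 0 1 * a * bmon 0 (-1) * bmon 1 0) (x) (bmon 0 1 * b)) (AdL v).
Proof.
pose f (v1 w : B) := tlift (fun v2 v3 => (v1 * ant v3) (x) v2) (cop w) : tensor B B.
have fb : is_bilinear f by rewrite /f; lin.
have copX : cop (bmon 1 0) = bmon 1 0 (x) 1 + bmon 0 1 (x) bmon 1 0 by exact: Bq_copX.
have antX : ant (bmon 1 0) = - (bmon 0 (-1) * bmon 1 0) by exact: Bq_antX.
have antM (x y : B) : ant (x * y) = ant y * ant x by exact: Bq_antM.
rewrite /AdL -/(f) cop_mul // copX tliftD; last by lin.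
rewrite !tlift_tens; [|lin..].
set T := fun a b => _ - _.
have Tb : is_bilinear T by rewrite /T; lin.
rewrite (tlift_comp _ _ (tlift_is_linear Tb)) -tlift_add; apply: eq_tlift => b1 b2.
rewrite [X in _ + X]/f cop_mul; last by lin.
rewrite copX tliftD; last by lin.
rewrite !tlift_tens; [|lin..].
rewrite (tlift_comp _ _ (tlift_is_linear Tb)) /f -!tlift_add.
rewrite mul1r -tlift_add; apply: eq_tlift => c1 c2.
rewrite tlift_tens // /T !mul1r antM antX !mulrA -addrA; congr (_ + (_ + _)).
by rewrite mulrN !mulrA tensNl.
Qed.

Lemma bq_AdL_g r s : AdL (bpoly 0 r * bmon 0 s) = 1 (x) (bpoly 0 r * bmon 0 s) :> tensor B B.
Proof.
have l := @AdL_is_linear _ B.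
have e t : AdL (bmon 0 t) = 1 (x) bmon 0 t :> tensor B B.
  have copg u : cop (bmon 0 u) = bmon 0 u (x) bmon 0 u by exact: Bq_copg.
  have antg : ant (bmon 0 t) = bmon 0 (- t) by exact: Bq_antg.
  rewrite /AdL copg tlift_tens; last by lin.
  by rewrite copg tlift_tens ?antg ?bmonMg ?subrr ?bmon1 //; lin.
move: r; apply: lin_poly_ext; [lin | lin |] => m.
by rewrite bpolyX bmonMg e.
Qed.

(** The polynomial (1 - p^j g) ... (1 - p^(k-1) g). *)
Definition adfactor (k j : nat) : {poly K} := \prod_(j <= i < k) (1 - p ^+ i *: 'X).

Lemma adfactorSr k j : (j <= k)%N -> adfactor k.+1 j = adfactor k j * (1 - p ^+ k *: 'X).
Proof. by move=> jk; rewrite /adfactor big_nat_recr. Qed.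

Lemma adfactorSl k j : (j < k)%N -> adfactor k j = (1 - p ^+ j *: 'X) * adfactor k j.+1.
Proof. by move=> jk; rewrite /adfactor big_ltn. Qed.

Lemma adfactornn k : adfactor k k = 1.
Proof. by rewrite /adfactor big_geq. Qed.

(** Induction on k by [bq_AdL_X].  The coefficient of X^(k+1-j) g^j receives
    (1 - p^(k+j) g) from the term j of the previous step and p^(k-j) times the
    term j - 1; both Pascal rules are needed to see that the sum is the
    coefficient for k + 1. *)
Lemma bq_AdL k r s : AdL (bpoly k r * bmon 0 s) = \sum_(j < k.+1) gauss p k j *:
  (bmon (k - j) j (x) (bpoly j (adfactor k j * r) * bmon 0 s)).
Proof.
elim: k => [|k IH].
  by rewrite big_ord1 gauss0 scale1r bmon1 adfactornn mul1r bq_AdL_g.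
have -> : bpoly k.+1 r = bmon 1 0 * bpoly k r by rewrite bmonX_bpoly.
rewrite -mulrA bq_AdL_X IH; set T := fun a b => _ - _.
have Tb : is_bilinear T by rewrite /T; lin.
pose t j (x : {poly K}) := bmon (k.+1 - j) j (x) (bpoly j x * bmon 0 s) : tensor B B.
have tl j : is_linear (t j) by rewrite /t; lin.
have TE (j : 'I_k.+1) : T (bmon (k - j) j) (bpoly j (adfactor k j * r) * bmon 0 s) =
    t j ((1 - p ^+ (k + j) *: 'X) * (adfactor k j * r)) +
    p ^+ (k - j) *: t j.+1 (adfactor k j * r).
  have jk : (j <= k)%N by rewrite -ltnS.
  rewrite /T !mulrA bmonXM bmonX_bpoly -['X]expr1 bmon_g_bpoly mul1n !bmon_gM.
  rewrite -!scalerAl bmonMg bmonM scalerA !tensZl tensZr scalerA.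
  have qn (n : nat) : q ^ (- n%:Z) = p ^+ n by rewrite -exprnN exprVn.
  rewrite mulr1 (_ : (1 : int) + j - 1 = j%:Z) ?addr0; last by lia.
  rewrite mul1r !qn -(exprD p) -(mulrA (1 - _)) mulrBl mul1r (linBE _ _ (tl j)).
  rewrite -scalerAl (linZE _ _ (tl j)) /t subSS expr1 addrAC -exprD.
  have -> : (1 + (k - j) = k.+1 - j)%N by move: jk; clear; lia.
  have -> : (k - j + 1 = k.+1 - j)%N by move: jk; clear; lia.
  have -> : (k - j + j + j = k + j)%N by move: jk; clear; lia.
  by [].
rewrite (lin_sumE _ _ _ (tlift_is_linear Tb)).
under eq_bigr => j _.
  rewrite (linZE _ _ (tlift_is_linear Tb)) tlift_tens // TE scalerDr scalerA.
  over.
rewrite big_split /= [RHS]big_ord_recl [X in X + _ = _]big_ord_recl -addrA.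
rewrite gauss0 /= !scale1r; congr (_ + _).
  by rewrite -/(t 0 _) adfactorSr // addn0 mulrCA mulrA.
rewrite [X in X + _](_ : _ = \sum_(j < k.+1)
    gauss p k j.+1 *: t j.+1 ((1 - p ^+ (k + j.+1) *: 'X) * (adfactor k j.+1 * r))); last first.
  by rewrite big_ord_recr /= gauss_small // scale0r addr0.
rewrite -big_split; apply: eq_bigr => j _ /=.
have jk : (j <= k)%N by rewrite -ltnS.
rewrite /bump add1n -/(t j.+1 _) -!(linZE _ _ (tl _)) -(linDE _ _ (tl _)); congr (t _ _).
have [->|jk'] : j = k :> nat \/ (j < k)%N by lia.
    rewrite gauss_small // !gaussnn subnn !adfactornn.
  by rewrite scale0r !add0r expr0 !mul1r.
rewrite add0n (adfactorSl jk') adfactorSr //.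
set a := gauss p k j.+1; set b := gauss p k j.
have e1 : p ^+ (k + j.+1) = p ^+ k * p ^+ j.+1 by rewrite exprD.
have e2 : p ^+ k = p ^+ (k - j) * p ^+ j by rewrite -exprD subnK.
have e3 : p ^+ k * (a + p ^+ (k - j) * b) = p ^+ k * (p ^+ j.+1 * a + b).
  by have := gaussSr p k j; rewrite gaussS => ->.
have -> : (a + p ^+ (k - j) * b) *: (adfactor k j.+1 * (1 - p ^+ k *: 'X) * r) =
   (a + p ^+ (k - j) * b) *: (adfactor k j.+1 * r) -
   (p ^+ k * (a + p ^+ (k - j) * b)) *: ('X * (adfactor k j.+1 * r)).
  by rewrite -!mul_polyC !polyCM; ring.
by rewrite e3 e1 -!mul_polyC !(polyCM, polyCD) e2 !polyCM; ring.
Qed.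

End BqAdjoint.

(** * Graded left ideals of k[X, g, g^-1] *)

(** Euclidean division by an element of least degree. *)
Lemma poly_ideal_principal (K : fieldType) (S : set {poly K}) : is_subspace S ->
  (forall u r, S r -> S (u * r)) -> (exists2 r, r != 0 & S r) ->
  exists2 d, d != 0 & forall r, S r <-> d %| r.
Proof.
move=> sS SM [r0 r00 Sr0].
have ex : exists n, `[< exists r, [/\ r != 0, S r & size r = n] >].
  by exists (size r0); apply/asboolP; exists r0.
case: (ex_minnP ex) => n /asboolP[d [d0 Sd dn]] nmin.
exists d => // r; split=> [Sr|/dvdpP[u ->]]; last exact: SM.
apply/eqP/eqP; apply: contraT => rd.
have Sm : S (r %% d) by rewrite -[r %% d](addKr (r %/ d * d)) addrC -divp_eq; apply: subspaceB => //; apply: SM.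
have /nmin : `[< exists r', [/\ r' != 0, S r' & size r' = size (r %% d)] >].
  by apply/asboolP; exists (r %% d).
by rewrite -dn leqNgt ltn_modp d0.
Qed.

Section GradedSubmodules.
Variables (K : fieldType) (q : K) (q0 : q != 0).
Local Notation B := (Bq q0).
Local Notation p := (q^-1).
Local Notation bmon := (bmon q0).
Local Notation bpoly := (bpoly q0).
Local Notation bcoef := (@bcoef K q q0).
Implicit Types (d : nat -> {poly K}) (r : {poly K}).

(** The sum of the X^k d_k(g) k[g, g^-1]. *)
Definition Mgr d : set B :=
  lspan [set m | exists k s, m = bpoly k (d k) * bmon 0 s].

Lemma Mgr_sub d : is_subspace (Mgr d). Proof. exact: lspan_subspace. Qed.

Lemma Mgr_in d k r s : d k %| r -> Mgr d (bpoly k r * bmon 0 s).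
Proof.
case/dvdpP => u ->; rewrite mulrC -[u]coefK poly_def mulr_sumr linear_sum mulr_suml.
apply: subspace_sum (Mgr_sub d) _ => i _ _; rewrite -scalerAr linearZ -scalerAl /=.
apply: subspaceZ (Mgr_sub d) _; apply: sub_lspan; exists k, (i%:Z + s).
by rewrite -bpoly_Mg -mulrA bmonMg.
Qed.

Lemma Mgr_in0 d k r : d k %| r -> Mgr d (bpoly k r).
Proof. by move=> /(@Mgr_in _ _ _ 0); rewrite bmon1 mulr1. Qed.

Lemma eq_Mgr d d' : (forall k, d k %= d' k) -> Mgr d = Mgr d'.
Proof.
move=> e; apply/seteqP; split; apply: lspan_min; try exact: Mgr_sub.
  by move=> _ [k [s ->]]; apply: Mgr_in; rewrite -(eqp_dvdl _ (e k)) dvdpp.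
by move=> _ [k [s ->]]; apply: Mgr_in; rewrite (eqp_dvdl _ (e k)) dvdpp.
Qed.

(** A large power of g clears the negative powers of g in finitely many
    generators. *)
Lemma Mgr_norm d x : Mgr d x -> exists n0, forall n : nat, (n0 <= n)%N ->
  exists2 P : nat -> {poly K}, (forall k, d k %| P k) &
    bmon 0 n * x = \sum_(k < n) bpoly k (P k).
Proof.
pose N (x : B) := exists n0, forall n : nat, (n0 <= n)%N ->
  exists2 P : nat -> {poly K}, (forall k, d k %| P k) &
    bmon 0 n * x = \sum_(k < n) bpoly k (P k).
rewrite -/(N x); move: x; apply: lspan_min.
  split; first by exists 0%N => n _; exists (fun=> 0) => [k|]; rewrite ?dvdp0 ?mulr0 ?big1 // => k _; rewrite linear0.
  move=> c x y [n0 h] [n1 h']; exists (maxn n0 n1) => n; rewrite geq_max.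
  move=> /andP[/h[P Pd xE] /h'[P' Pd' yE]].
  exists (fun k => c *: P k + P' k) => [k|]; first by rewrite -mul_polyC dvdp_add ?dvdp_mull.
  rewrite mulr_linr xE yE scaler_sumr -big_split.
  by apply: eq_bigr => k _; rewrite linearP.
move=> _ [m [s ->]] /=; exists (m.+1 + `|s|)%N => n nP.
have mn : (m < n)%N by apply: leq_trans nP; rewrite leq_addr.
exists (fun k => if k == m then q ^ (- (n%:Z * m%:Z)) *: (d m * 'X^(`|n%:Z + s|)) else 0).
  by move=> k; case: eqP => [->|_]; rewrite ?dvdp0 // dvdpZr ?dvdp_mulr // expfz_neq0.
rewrite (bigD1 (Ordinal mn)) //= eqxx big1 => [|k km]; last first.
  by rewrite (negbTE (km : k != m :> nat)) linear0.
rewrite addr0 linearZ /= -bpoly_Mg mulrA bmon_bpolyC -scalerAl -mulrA bmonMg.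
by congr (_ *: (_ * bmon _ _)); lia.
Qed.

(** Divisibility in k[g, g^-1] is divisibility in k[g] for d_k prime to g, that
    is, for d_k(0) <> 0. *)
Lemma Mgr_sum d n (P : nat -> {poly K}) : (forall k, ~~ root (d k) 0) ->
  Mgr d (\sum_(k < n) bpoly k (P k)) -> forall k, (k < n)%N -> d k %| P k.
Proof.
move=> d0 /Mgr_norm[n0 h] k kn; have [Q Qd e] := h (maxn n0 n) (leq_maxl _ _).
set m := maxn n0 n in e; have nm : (n <= m)%N by apply: leq_maxr.
have cop : coprimep (d k) 'X^m.
  by rewrite coprimep_expr // -['X]subr0 -polyC0 coprimep_XsubC.
rewrite -(Gauss_dvdpl (P k) cop); suff <- : q ^+ (m * k) *: Q k = P k * 'X^m.
  by rewrite dvdpZr // expf_neq0.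
apply/polyP => i; rewrite coefZ.
have := congr1 (bcoef k i%:Z) e; rewrite mulr_sumr !linear_sum /= [in RHS](bigD1 (Ordinal (leq_trans kn nm))) //=.
rewrite bcoef_bpoly eqxx mul1r [in RHS]big1 ?addr0 => [<-|j jk]; last first.
  by rewrite bcoef_bpoly (negbTE (jk : j != k :> nat)) mul0r.
rewrite (bigD1 (Ordinal kn)) //= big1 ?addr0 => [|j jk]; last first.
  by rewrite bmon_g_bpoly linearZ /= bcoef_bpoly (negbTE (jk : j != k :> nat)) mul0r scaler0.
rewrite bmon_g_bpoly linearZ /= bcoef_bpoly eqxx mul1r mulrA.
by rewrite -exprMn mulfV // expr1n mul1r mulrC.
Qed.

Lemma Mgr_bpoly d k r : (forall k, ~~ root (d k) 0) -> Mgr d (bpoly k r) -> d k %| r.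
Proof.
move=> d0 h; have := @Mgr_sum d k.+1 (fun j => if j == k then r else 0) d0.
rewrite big_ord_recr /= eqxx big1 => [|j _]; last by rewrite (ltn_eqF (ltn_ord j)) linear0.
by rewrite add0r => /(_ h k (leqnn _)); rewrite eqxx.
Qed.

Lemma Mgr_left d a x : (forall k, d k.+1 %| d k) -> Mgr d x -> Mgr d (a * x).
Proof.
move=> dd; have dm m k : d (m + k)%N %| d k.
  by elim: m => [|m IH] //; rewrite addSn; apply: dvdp_trans IH.
move: x; apply: lspan_min.
  exact: preim_subspace (lin_mulr a (@lin_id _ B)) (Mgr_sub d).
move=> _ [k [s ->]] /=; have [S _ ->] := bmon_expand a.
rewrite mulr_suml; apply: subspace_sum (Mgr_sub d) _ => -[m t] _ _ /=.
rewrite -scalerAl; apply: subspaceZ (Mgr_sub d) _.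
rewrite -[t]add0r -bmonMg -mulrA [bmon 0 t * _]mulrA bmon_bpolyC -!scalerAl -scalerAr.
apply: subspaceZ (Mgr_sub d) _; rewrite -!mulrA bmonMg mulrA bmonX_bpoly.
exact: Mgr_in.
Qed.

(** The crossed submodules among the graded ones: the left ideal condition is
    that d_(k+1) divides d_k, and by the formula for Ad_L the remaining
    condition is that d_k divides (1 - q^-k g) d_(k+1). *)
Lemma Mgr_crossed d : root (d 0%N) 1 -> (forall k, d k.+1 %| d k) ->
  (forall k, d k %| (1 - p ^+ k *: 'X) * d k.+1) -> is_crossed (Mgr d).
Proof.
move=> d1 dd du; have sM := Mgr_sub d; split=> //.
- move=> m; move: m; apply: lspan_min.
    exact: preim_subspace (lin_linear (@cou _ B)) (subspace0 _).
  move=> _ [k [s ->]]; change (cou (bpoly k (d k) * bmon 0 s) = 0).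
  rewrite couM cou_bpoly.
  by case: k => [|k]; rewrite ?(eqP d1) ?mulr0 !mul0r.
- by move=> a m; apply: Mgr_left.
have dk j k : (j <= k)%N -> d j %| adfactor q k j * d k.
  move=> jk; rewrite -(subnKC jk); move: (k - j)%N => n {jk}; elim: n j => [|n IH] j.
    by rewrite addn0 adfactornn mul1r.
  apply: dvdp_trans (du j) _; rewrite adfactorSl; last by lia.
  by rewrite -mulrA; apply: dvdp_mul => //; rewrite -addSnnS.
apply: lspan_min.
  exact: preim_subspace (@AdL_is_linear _ B) (lspan_subspace _).
move=> _ [k [s ->]] /=; rewrite bq_AdL; apply: subspace_sum (lspan_subspace _) _ => j _ _.
apply: subspaceZ (lspan_subspace _) _; apply: sub_lspan.
exists (bmon (k - j) j), (bpoly j (adfactor q k j * d k) * bmon 0 s).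
by split=> //; apply/Mgr_in/dk; rewrite -ltnS.
Qed.

End GradedSubmodules.

Arguments Mgr {K q} q0 d.

(** * Crossed submodules of finite codimension *)

Section CrossedClassification.
Variables (K : fieldType) (q : K) (q0 : q != 0).
Local Notation B := (Bq q0).
Local Notation p := (q^-1).
Local Notation bmon := (bmon q0).
Local Notation bpoly := (bpoly q0).
Local Notation bcoef := (@bcoef K q q0).
Implicit Types (d : nat -> {poly K}) (r : {poly K}).

(** Finite codimension in ker eps, in a form that passes to larger submodules. *)
Definition fincodim (A : hopfAlg K) (M : set A) := exists n, forall w : 'I_n -> A,
  (forall i, cou (w i) = 0) ->
  exists2 c : 'I_n -> K, (exists i, c i != 0) & M (\sum_i c i *: w i).

Lemma fincodim_sub (A : hopfAlg K) (M M' : set A) : M `<=` M' -> fincodim M -> fincodim M'.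
Proof.
move=> sub [n h]; exists n => w /h[c c0 Mc]; exists c => //; exact: sub.
Qed.

Lemma has_dim_fincodim (A : hopfAlg K) (M : set A) n : is_subspace M ->
  has_dim [set: aug_quot M] n -> fincodim M.
Proof.
move=> sM hd; exists n.+1 => w w0.
have [c c0 e] := dim_dependent (w := fun i => aug_class M (w i)) hd (leqnn _) (fun=> I).
exists c => //; have : aug_class M (\sum_i c i *: w i) = 0.
  by rewrite -[RHS]e linear_sum; apply: eq_bigr => i _; rewrite linearZ.
have cw : cou (\sum_i c i *: w i) = 0.
  by rewrite linear_sum big1 // => i _; rewrite linearZ /= w0 scaler0.
by move/(aug_class_eq0 sM); rewrite cw scale0r subr0.
Qed.

Variable M : set B.
Hypothesis Mx : is_crossed M.

Let sM : is_subspace M. Proof. by case: Mx. Qed.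
Let M_mul a m : M m -> M (a * m). Proof. by case: Mx => _ _ h _; exact: h. Qed.

(** Ad_L with the coefficient of X^n g^j taken in its first factor; the cases
    n = 0 and n = 1 are the ones that matter. *)
Definition slice (n : nat) (j : nat) (x : B) : B :=
  tlift (fun a b => (bcoef n j a : K) *: b) (AdL x).

Lemma slice_is_linear n j : is_linear (slice n j).
Proof. by have l := @AdL_is_linear _ B; rewrite /slice; lin. Qed.

Lemma slice_crossed n j x : M x -> M (slice n j x).
Proof.
case: Mx => _ _ _ h /h; rewrite /slice; move: (AdL x).
have bl : is_bilinear (fun a b : B => (bcoef n j a : K) *: b) by lin.
apply: lspan_min; first exact: preim_subspace (tlift_is_linear bl) sM.
by move=> _ [a [m [Mm ->]]] /=; rewrite tlift_tens //; apply: subspaceZ.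
Qed.

Lemma slice_bpoly n j k r : slice n j (bpoly k r) =
  if k == (n + j)%N then gauss p k j *: bpoly j (adfactor q k j * r) else 0.
Proof.
have bl : is_bilinear (fun a b : B => (bcoef n j a : K) *: b) by lin.
rewrite /slice -[bpoly k r]mulr1 -(bmon1 q0) bq_AdL (lin_sumE _ _ _ (tlift_is_linear bl)).
under eq_bigr => i _.
  rewrite (linZE _ _ (tlift_is_linear bl)) tlift_tens // bcoef_mon bmon1 mulr1.
  over.
case: eqP => [->|ne].
  have jn : (j < (n + j).+1)%N by lia.
  rewrite (bigD1 (Ordinal jn)) //= addnK !eqxx scale1r big1 ?addr0 // => i ij.
  rewrite (_ : _ && _ = false) ?scale0r ?scaler0 //; apply/negbTE; apply: contra ij.
  by case/andP => _ /eqP[e]; apply/eqP; apply: val_inj.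
rewrite big1 // => i _; rewrite (_ : _ && _ = false) ?scale0r ?scaler0 //.
apply/negbTE/negP => /andP[/eqP e1 /eqP[e2]]; have := ltn_ord i; lia.
Qed.

(** Hence a crossed submodule is graded by the degree in X. *)
Lemma crossed_graded n (P : nat -> {poly K}) : M (\sum_(k < n) bpoly k (P k)) ->
  forall k, (k < n)%N -> M (bpoly k (P k)).
Proof.
move=> h k kn; have := slice_crossed 0 k h.
rewrite (lin_sumE _ _ _ (slice_is_linear _ _)) (bigD1 (Ordinal kn)) //= big1 => [|j jk].
  by rewrite slice_bpoly eqxx gaussnn scale1r adfactornn mul1r addr0.
rewrite slice_bpoly; case: eqP => // e; case/eqP: jk; exact: val_inj.
Qed.

Hypothesis qgen : forall n, \sum_(i < n.+1) p ^+ i != 0.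

(** The coefficient of X g^k in the adjoint coaction of X^(k+1) r is
    (1 + p + ... + p^k) X^k (1 - p^k g) r. *)
Lemma crossed_lower k r : M (bpoly k.+1 r) -> M (bpoly k ((1 - p ^+ k *: 'X) * r)).
Proof.
move=> /(slice_crossed 1 k); rewrite slice_bpoly add1n eqxx gaussSn => /(subspaceZK sM (qgen k)).
by rewrite adfactorSr // adfactornn mul1r.
Qed.

(* the ideal of k[g] of the component of degree k *)
Let Mk k : set {poly K} := [set r | M (bpoly k r)].

Let Mk_sub k : is_subspace (Mk k).
Proof. exact: preim_subspace (@bpoly_is_linear _ _ q0 k) sM. Qed.

Let p0 : p != 0. Proof. by rewrite invr_eq0. Qed.

Let Mk_XM k i r : Mk k ('X^i * r) <-> Mk k r.
Proof.
have e : bmon 0 i%:Z * bpoly k r = p ^+ (i * k) *: bpoly k ('X^i * r) by exact: bmon_g_bpoly.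
split=> [h|/(M_mul (bmon 0 i%:Z))]; last by rewrite e; apply: (subspaceZK sM); rewrite expf_neq0.
rewrite /Mk /= -[bpoly k r]mul1r -(bmon_gK q0 i%:Z) -mulrA e; apply: M_mul.
exact: subspaceZ.
Qed.

Let Mk_mul k u r : Mk k r -> Mk k (u * r).
Proof.
move=> Mr; rewrite -[u]coefK poly_def mulr_suml; apply: subspace_sum (Mk_sub k) _ => i _ _.
by rewrite -scalerAl; apply: subspaceZ (Mk_sub k) _; apply/Mk_XM.
Qed.

Hypothesis Mfin : fincodim M.

(* finite codimension forces a linear relation modulo M among the elements
   X^k (1 - g) g^i of ker eps *)
Let Mk_neq0 k : exists2 r, r != 0 & Mk k r.
Proof.
have [n h] := Mfin; have [i|c [i ci] Mc] := h (fun i => bpoly k ((1 - 'X) * 'X^i)).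
  by rewrite cou_bpoly hornerM hornerD hornerN hornerC hornerX subrr mul0r mulr0.
exists ((1 - 'X) * \sum_i c i *: 'X^i); last first.
  rewrite /Mk /= mulr_sumr linear_sum; move: Mc; congr M; apply: eq_bigr => j _.
  by rewrite -scalerAr linearZ.
rewrite mulf_neq0 //; first by rewrite -opprB oppr_eq0 polyXsubC_eq0.
apply/eqP => /polyP/(_ i); rewrite coef0 coef_sum (bigD1 i) //= coefZ coefXn eqxx mulr1.
rewrite big1 => [|j ji]; first by rewrite addr0 => /eqP; rewrite (negbTE ci).
by rewrite coefZ coefXn eq_sym (negbTE (ji : j != i :> nat)) mulr0.
Qed.

(** A crossed submodule of finite codimension is given by polynomials d_k
    generating its homogeneous components, with d_(k+1) | d_k | (1 - q^-k g) d_(k+1). *)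
Lemma crossed_Mgr : exists d, [/\ M = Mgr q0 d, forall k, d k.+1 %| d k,
  forall k, d k %| (1 - p ^+ k *: 'X) * d k.+1, root (d 0%N) 1 &
  exists m, forall k, (m <= k)%N -> d k %= 1].
Proof.
have /choice[d dP] : forall k : nat, exists d : {poly K}, d != 0 /\ forall r, Mk k r <-> d %| r.
  move=> k; have [d d0 dk] := poly_ideal_principal (Mk_sub k) (@Mk_mul k) (Mk_neq0 k).
  by exists d.
have dM k r : M (bpoly k r) <-> d k %| r by have [_ h] := dP k; apply: h.
have d0 k : d k != 0 by have [] := dP k.
have dnn k : M (bpoly k (d k)) by apply/dM.
have dd k : d k.+1 %| d k by apply/dM; rewrite -add1n -bmonX_bpoly; apply: M_mul.
exists d; split=> //.
- apply/seteqP; split=> [x Mxx|]; last first.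
    apply: lspan_min => // _ [k [s ->]]; apply: (subspaceZK (c := q ^ (- (s * k%:Z))) sM).
      by rewrite expfz_neq0.
    by rewrite -bmon_bpolyC; apply: M_mul.
  have [n h] := bpoly_norm x; have [P e] := h n (leqnn n).
  have -> : x = bmon 0 (- n%:Z) * (bmon 0 n * x) by rewrite mulrA bmon_gK mul1r.
  apply: Mgr_left => //; rewrite e; apply: subspace_sum (Mgr_sub _ _) _ => k _ _.
  apply/Mgr_in0/dM; apply: (crossed_graded (n := n)) => //.
  by rewrite -e; apply: M_mul.
- by move=> k; apply/dM/crossed_lower.
- have [_ /(_ _ (dnn 0%N)) h _ _] := Mx; apply/eqP.
  by move: h; rewrite cou_bpoly mul1r.
(* a relation modulo M among X, ..., X^n contains some X^(i+1), because M is
   graded; hence d_(i+1) = 1 *)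
have [n h] := Mfin; have [i|c [i ci] Mc] := h (fun i => bmon i.+1 0).
  by rewrite cou_bmon.
exists i.+1 => k ik; rewrite -size_poly_eq1 -dvdp1; apply: (@dvdp_trans _ (d i.+1)).
  by rewrite -(subnKC ik); elim: (k - i.+1)%N => [|m IH]; rewrite ?addn0 // addnS; apply: dvdp_trans IH.
have := crossed_graded (n := n.+1) (P := fun j => if j is j'.+1 then (if insub j' is Some l then c l else 0)%:P else 0).
rewrite big_ord_recl linear0 add0r.
have -> : \sum_(j < n) bpoly (lift ord0 j) (if lift ord0 j : nat is j'.+1 then
    (if insub j' is Some l then c l else 0)%:P else 0) = \sum_j c j *: bmon j.+1 0.
  apply: eq_bigr => j _ /=; rewrite /bump add1n /= valK.
  by rewrite -bpoly1 -linearZ alg_polyC.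
move=> /(_ Mc i.+1); rewrite ltnS ltn_ord valK => /(_ isT)/dM.
by rewrite -alg_polyC dvdpZr.
Qed.

End CrossedClassification.

(** * Finite sets of positive integers and their crossed submodules *)

Section PositiveSets.
Implicit Types (I J : {fset nat}) (k n m : nat).

(** Functions of k that stabilize for large k are treated by induction
    downwards. *)
Lemma down_ind (P : nat -> Prop) m : (forall k, (m <= k)%N -> P k) ->
  (forall k, P k.+1 -> P k) -> forall k, P k.
Proof.
move=> big step k; have [n] : exists n, (m <= k + n)%N by exists m; rewrite leq_addl.
elim: n k => [|n IH] k; first by rewrite addn0; apply: big.
by rewrite addnS -addSn => /IH/step.
Qed.

Lemma big_gtn_split (R : Type) (idx : R) (op : Monoid.com_law idx) I (F : nat -> R) k :
  \big[op/idx]_(n <- I | (k < n)%N) F n =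
  op (if k.+1 \in I then F k.+1 else idx) (\big[op/idx]_(n <- I | (k.+1 < n)%N) F n).
Proof.
rewrite (bigID (pred1 k.+1)) /=; congr (op _ _); last first.
  by apply: eq_bigl => n; rewrite [RHS]ltn_neqAle eq_sym andbC.
rewrite (eq_bigl (pred1 k.+1)) => [|n] /=; last by case: eqP => [->|]; rewrite ?ltnSn ?andbF.
case: ifP => kI; first (rewrite big_mkcond (bigD1_seq k.+1) ?fset_uniq //= eqxx big1 ?Monoid.mulm1 // => n /negbTE).
  by move=> ->.
by rewrite big_seq_cond big1 // => n /andP[nI /eqP e]; rewrite e kI in nI.
Qed.

Lemma fset_bound I : exists m, forall n, n \in I -> (n <= m)%N.
Proof. by exists (\max_(n <- I) n) => n nI; apply: (leq_bigmax_seq (F := id)). Qed.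

Lemma cI_sum I k : cI I k = (\sum_(n <- I | (k < n)%N) 1)%N.
Proof.
rewrite /cI -sum1_size; rewrite [LHS](_ : _ = \sum_(n <- [seq n <- I | (k < n)%N]) 1)%N.
  by rewrite big_filter.
apply: perm_big; apply: uniq_perm; rewrite ?fset_uniq ?filter_uniq ?fset_uniq //.
by move=> n; rewrite mem_filter !inE andbC.
Qed.

Lemma cI_split I k : cI I k = ((k.+1 \in I) + cI I k.+1)%N.
Proof. by rewrite !cI_sum big_gtn_split; case: ifP. Qed.

Lemma cI_large I m k : (forall n, n \in I -> (n <= m)%N) -> (m <= k)%N -> cI I k = 0%N.
Proof.
move=> Im mk; rewrite cI_sum big_seq_cond big1 // => n /andP[/Im nm kn].
by have := leq_trans kn (leq_trans nm mk); rewrite ltnn.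
Qed.

Lemma cI_inj I J : 0%N \notin I -> 0%N \notin J -> cI I =1 cI J -> I = J.
Proof.
move=> I0 J0 e; apply/fsetP => -[|n]; first by rewrite (negbTE I0) (negbTE J0).
have := e n; rewrite (cI_split I) (cI_split J) e => /addIn.
by case: (n.+1 \in I); case: (n.+1 \in J).
Qed.

Lemma cI0_gt0 I : posfin I -> (0 < cI I 0)%N.
Proof.
move=> [I0 /eqP/fset0Pn[n nI]]; rewrite cI_sum sum1_count -has_count.
by apply/hasP; exists n => //; case: n nI I0 => [->|].
Qed.

(** A sequence decreasing to 0 by steps of at most one is the counting function
    of the set of the places where it drops. *)
Lemma cI_of_steps (c : nat -> nat) m : (forall k, (m <= k)%N -> c k = 0%N) ->
  (forall k, (c k.+1 <= c k <= (c k.+1).+1)%N) ->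
  exists2 I : {fset nat}, 0%N \notin I & forall k, c k = cI I k.
Proof.
move=> c0 cS; pose I := [fset n in iota 1 m | c n.-1 != c n]%fset.
exists I => [|k]; first by rewrite !inE mem_iota.
have Im n : n \in I -> (n <= m)%N by rewrite !inE mem_iota add1n ltnS => /andP[/andP[]].
move: k; apply: (@down_ind _ m) => [k mk|k IH]; first by rewrite c0 // (cI_large Im).
rewrite cI_split -IH !inE mem_iota add1n ltnS /=; have := cS k.
have [mk|km] := leqP m k; first by rewrite !c0 //; lia.
by case: eqP; lia.
Qed.

(** Both sides count the pairs (k, n) with k < n in I. *)
Lemma cI_total I m : (forall n, n \in I -> (n <= m)%N) ->
  (\sum_(k < m) cI I k = \sum_(n <- I) n)%N.
Proof.
move=> Im; transitivity (\sum_(k < m) \sum_(n <- I) (if (k < n)%N then 1 else 0))%N.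
  by apply: eq_bigr => k _; rewrite cI_sum big_mkcond.
rewrite exchange_big big_seq [RHS]big_seq; apply: eq_bigr => n nI /=.
by rewrite -big_mkcond /= -(big_ord_widen _ (fun=> 1%N)) ?Im // sum1_card card_ord.
Qed.

End PositiveSets.

Section CrossedOfSet.
Variables (K : fieldType) (q : K) (q0 : q != 0).
Local Notation B := (Bq q0).
Local Notation p := (q^-1).
Local Notation bmon := (bmon q0).
Local Notation bpoly := (bpoly q0).
Implicit Types (I J : {fset nat}).

(** The generator d_k of the set I; 1 - q^(1-n) g with n = k + 1 is the factor
    1 - p^k g of the adjoint coaction. *)
Definition setpoly I k : {poly K} :=
  \prod_(n <- I | (k < n)%N) (1 - q ^ (1 - n%:Z) *: 'X).

Lemma setpoly_split I k : setpoly I k =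
  (if k.+1 \in I then 1 - p ^+ k *: 'X else 1) * setpoly I k.+1.
Proof.
rewrite /setpoly big_gtn_split; case: ifP => // _; rewrite exprVn exprnN.
by have -> : 1 - k.+1%:Z = - k%:Z by lia.
Qed.

Lemma setpoly_large I m k : (forall n, n \in I -> (n <= m)%N) -> (m <= k)%N ->
  setpoly I k = 1.
Proof.
move=> Im mk; rewrite /setpoly big_seq_cond big1 // => n /andP[/Im nm kn].
by have := leq_trans kn (leq_trans nm mk); rewrite ltnn.
Qed.

Lemma size_linear_factor (c : K) : c != 0 -> size (1 - c *: 'X) = 2.
Proof.
move=> c0; rewrite addrC size_polyDl ?size_polyN ?size_scale ?size_polyX //.
by rewrite size_poly1.
Qed.

Let p0 k : p ^+ k != 0. Proof. by rewrite expf_neq0 // invr_eq0. Qed.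

Lemma size_setpoly I k : size (setpoly I k) = (cI I k).+1.
Proof.
have [m Im] := fset_bound I.
move: k; apply: (@down_ind _ m) => [k mk|k IH]; first by rewrite (setpoly_large Im) // size_poly1 (cI_large Im).
rewrite setpoly_split cI_split; case: ifP => _; last by rewrite mul1r IH.
have s1 : setpoly I k.+1 != 0 by rewrite -size_poly_gt0 IH.
have s2 : 1 - p ^+ k *: 'X != 0 :> {poly K} by rewrite -size_poly_gt0 size_linear_factor.
by rewrite size_mul // size_linear_factor // IH.
Qed.

Lemma setpoly_neq0 I k : setpoly I k != 0.
Proof. by rewrite -size_poly_gt0 size_setpoly. Qed.

Lemma root_setpoly I k x :
  root (setpoly I k) x = has (fun n => (k < n)%N && (q ^ (1 - n%:Z) * x == 1)) I.
Proof.
rewrite /root /setpoly horner_prod prodf_seq_eq0; apply: eq_has => n /=.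
by rewrite !hornerE subr_eq0 eq_sym.
Qed.

Lemma setpoly_root0 I k : ~~ root (setpoly I k) 0.
Proof.
rewrite root_setpoly; apply/hasPn => n _; rewrite mulr0 eq_sym oner_eq0 andbF //.
Qed.

Lemma setpoly_dvd I k : setpoly I k.+1 %| setpoly I k.
Proof. by rewrite [setpoly I k]setpoly_split dvdp_mull. Qed.

Lemma setpoly_dvdl I k : setpoly I k %| (1 - p ^+ k *: 'X) * setpoly I k.+1.
Proof. by rewrite [setpoly I k]setpoly_split; case: ifP => _; [exact: dvdpp | rewrite mul1r dvdp_mull]. Qed.

Definition Mset I : set B := Mgr q0 (setpoly I).

Lemma Mset_crossed I : root (setpoly I 0) 1 -> is_crossed (Mset I).
Proof.
move=> h; apply: Mgr_crossed => //; [exact: setpoly_dvd | exact: setpoly_dvdl].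
Qed.

Lemma Mset_sub I J : Mset I `<=` Mset J -> forall k, setpoly J k %| setpoly I k.
Proof.
move=> IJ k; apply: (Mgr_bpoly (d := setpoly J) (q0 := q0)) (setpoly_root0 J) _; apply: IJ.
exact: Mgr_in0.
Qed.

(** The degree of d_k is c_I(k), which determines I. *)
Lemma Mset_inj I J : 0%N \notin I -> 0%N \notin J -> Mset I = Mset J -> I = J.
Proof.
move=> I0 J0 e; apply: cI_inj => // k; apply: succn_inj; rewrite -!size_setpoly.
by apply: eqp_size; rewrite /eqp !Mset_sub ?e.
Qed.

(** Going down from large k, either d_k and d_(k+1) are associated, or d_k
    gains the factor 1 - q^-k g, which puts k+1 into the set. *)
Lemma chain_setpoly (d : nat -> {poly K}) m : (forall k, d k.+1 %| d k) ->
  (forall k, d k %| (1 - p ^+ k *: 'X) * d k.+1) ->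
  (forall k, (m <= k)%N -> d k %= 1) ->
  exists2 I, 0%N \notin I & forall k, d k %= setpoly I k.
Proof.
move=> dd du d1; pose I := [fset n in iota 1 m | ~~ (d n.-1 %| d n)]%fset.
exists I => [|k]; first by rewrite !inE mem_iota.
have Im n : n \in I -> (n <= m)%N by rewrite !inE mem_iota add1n ltnS => /andP[/andP[]].
move: k; apply: (@down_ind _ m) => [k mk|k IH]; first by rewrite (setpoly_large Im) // d1.
rewrite setpoly_split !inE mem_iota add1n ltnS /=.
have [dk|ndk] := boolP (d k %| d k.+1).
  rewrite andbF mul1r; apply: eqp_trans IH; by rewrite /eqp dk dd.
have [mk|km] := leqP m k.
  case/negP: ndk; rewrite (eqp_dvdl _ (d1 _ mk)); exact: dvd1p.
rewrite ltnS km /=; apply: eqp_trans (_ : _ %= (1 - p ^+ k *: 'X) * d k.+1) _; last by rewrite eqp_mull.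
have dS0 : d k.+1 != 0.
  by apply: contraTneq IH => ->; rewrite eqp_sym eqp0 setpoly_neq0.
have [u uE] := dvdpP _ _ (dd k); rewrite uE eqp_mul2r //.
have uf : u %| 1 - p ^+ k *: 'X by have := du k; rewrite {1}uE dvdp_mul2r.
have f0 : 1 - p ^+ k *: 'X != 0 :> {poly K} by rewrite -size_poly_gt0 size_linear_factor.
rewrite -dvdp_size_eqp // size_linear_factor //.
have := dvdp_leq f0 uf; rewrite size_linear_factor //.
have u0 : u != 0 by apply: contraTneq uf => ->; rewrite dvd0p.
have : (0 < size u)%N by rewrite size_poly_gt0.
have : size u != 1%N.
  apply: contra ndk; rewrite size_poly_eq1 => u1; rewrite uE.
  by rewrite -{2}[d k.+1]mul1r dvdp_mul2r // (eqp_dvdl _ u1) dvd1p.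
by case: (size u) => [|[|[|n]]].
Qed.

(** The sum of powers of p is the q-integer [n+1] at p, by which [crossed_lower]
    divides. *)
Theorem crossed_classification (M : set B) :
  (forall n, \sum_(i < n.+1) p ^+ i != 0) -> is_crossed M -> fincodim M ->
  exists I, [/\ 0%N \notin I, M = Mset I & root (setpoly I 0) 1].
Proof.
move=> qgen Mx Mfin; have [d [-> dd du d1 [m dm]]] := crossed_Mgr Mx qgen Mfin.
have [I I0 dI] := chain_setpoly dd du dm; exists I; split=> //; first exact: eq_Mgr.
by rewrite -(eqp_root (dI 0%N)).
Qed.

End CrossedOfSet.

Arguments Mset {K q} q0 I.

(** * The dimension of the calculus of a set *)

Section Staircase.
Variables (I : {fset nat}) (m : nat).

(** The places (k, j) with j < c_I(k), other than (0, 0). *)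
Definition stairs : seq (nat * nat) :=
  rem (0%N, 0%N) [seq (k, j) | k <- iota 0 m, j <- iota 0 (cI I k)].

Hypothesis Im : forall n, n \in I -> (n <= m)%N.
Hypothesis c0 : (0 < cI I 0)%N.

Let stairs0_uniq : uniq [seq (k, j) | k <- iota 0 m, j <- iota 0 (cI I k)].
Proof.
apply: allpairs_uniq_dep => [|k _|[k j] [k' j'] _ _ /= [-> ->] //]; exact: iota_uniq.
Qed.

Let mem_stairs0 k j :
  ((k, j) \in [seq (k, j) | k <- iota 0 m, j <- iota 0 (cI I k)]) = (j < cI I k)%N.
Proof.
apply/allpairsPdep/idP => [[k' [j' [_ + [-> ->]]]]|jk]; first by rewrite mem_iota.
exists k, j; rewrite !mem_iota !add0n; split=> //.
by rewrite /= ltnNge; apply: contraTN jk => mk; rewrite (cI_large Im).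
Qed.

Lemma stairs_uniq : uniq stairs. Proof. exact: rem_uniq. Qed.

Lemma mem_stairs k j : ((k, j) \in stairs) = ((k, j) != (0%N, 0%N)) && (j < cI I k)%N.
Proof. by rewrite mem_rem_uniq // !inE mem_stairs0. Qed.

Lemma size_stairs : size stairs = (\sum_(n <- I) n)%N.-1.
Proof.
rewrite size_rem ?mem_stairs0 // size_allpairs_dep -(cI_total Im).
rewrite sumnE big_map -[m]subn0 -/(index_iota 0 m) big_mkord subn0.
by under eq_bigr => k _ do rewrite size_iota.
Qed.

Lemma big_stairs (V : zmodType) (F : nat -> nat -> V) : F 0%N 0%N = 0 ->
  \sum_(t <- stairs) F t.1 t.2 = \sum_(k < m) \sum_(j < cI I k) F k j.
Proof.
move=> F0; transitivity (\sum_(t <- [seq (k, j) | k <- iota 0 m, j <- iota 0 (cI I k)]) F t.1 t.2).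
  by rewrite [RHS](big_rem (0%N, 0%N)) ?mem_stairs0 //= F0 add0r.
rewrite big_allpairs_dep /= -[m]subn0 -/(index_iota 0 m) big_mkord subn0.
apply: eq_bigr => k _; rewrite -[cI I k]subn0 -/(index_iota 0 _) big_mkord.
by rewrite !subn0.
Qed.

End Staircase.

Section Dimension.
Variables (K : fieldType) (q : K) (q0 : q != 0) (I : {fset nat}).
Local Notation B := (Bq q0).
Local Notation bmon := (bmon q0).
Local Notation bpoly := (bpoly q0).
Local Notation d := (setpoly q I).
Local Notation M := (Mset q0 I).
Hypothesis I1 : root (d 0%N) 1.

Let Y : {poly K} := 1 - 'X.

(** Substituting 1 - X is an involution, so the powers of 1 - X are as good a
    basis as those of X; their advantage is that all but the first lie in
    ker eps. *)
Lemma poly_1subX (r : {poly K}) n : (size r <= n)%N ->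
  exists e : nat -> K, r = \sum_(j < n) e j *: Y ^+ j.
Proof.
move=> rn; have YY : Y \Po Y = 'X by rewrite /Y comp_polyB comp_polyX comp_polyC; ring.
have sY : size Y = 2 by rewrite /Y -['X]scale1r size_linear_factor ?oner_neq0.
pose e := r \Po Y; have ern : (size e <= n)%N by rewrite /e size_comp_poly2.
exists (fun j => e`_j); have -> : r = e \Po Y by rewrite /e -comp_polyA YY comp_polyXr.
rewrite comp_polyE (big_ord_widen n (fun j => e`_j *: Y ^+ j) ern) big_mkcond.
by apply: eq_bigr => j _; case: ltnP => // h; rewrite nth_default // scale0r.
Qed.

Lemma poly_1subX_free n (e : nat -> K) : \sum_(j < n) e j *: Y ^+ j = 0 ->
  forall j, (j < n)%N -> e j = 0.
Proof.
have YY : Y \Po Y = 'X by rewrite /Y comp_polyB comp_polyX comp_polyC; ring.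
move=> e0 j jn; have : (\poly_(j < n) e j) \Po Y = 0.
  rewrite -[RHS]e0 poly_def linear_sum; apply: eq_bigr => i _.
  by rewrite linearZ /= comp_Xn_poly.
move=> /(congr1 (fun r => r \Po Y)); rewrite comp_poly0 -comp_polyA YY comp_polyXr.
by move=> /polyP/(_ j); rewrite coef_poly jn coef0.
Qed.

(** Modulo M every X^k g^s is X^k r(g) with r of degree less than c_I(k):
    g is invertible modulo the polynomial d_k. *)
Lemma bmon_reduce k s : exists2 r : {poly K}, (size r <= cI I k)%N &
  M (bmon k s - bpoly k r).
Proof.
have sM := Mgr_sub q0 d.
have [u Mu] : exists u, M (bmon k s - bpoly k u).
  case: s => n; first by exists 'X^n; rewrite bpolyX subrr; exact: sM.1.
  have cop : coprimep 'X^(n.+1) (d k).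
    by rewrite coprimep_sym coprimep_expr // -['X]subr0 -polyC0 coprimep_XsubC setpoly_root0.
  have [[u v] /= e] := Bezout_coprimepP _ _ cop.
  have [c c0 uv] : exists2 c, c != 0 & u * 'X^(n.+1) + v * d k = c%:P.
    by move: e; rewrite -size_poly_eq1 => /size_poly1P.
  exists (c^-1 *: u).
  have -> : bmon k (Negz n) - bpoly k (c^-1 *: u) = c^-1 *: (c *: bmon k (Negz n) - bpoly k u).
    by rewrite scalerBr scalerA mulVf // scale1r linearZ.
  apply: subspaceZ => //; rewrite -[Negz n]add0r -bmonMg -bpoly1 scalerAl -linearZ /=.
  rewrite alg_polyC -uv linearD mulrDl /= -bpoly_Mg -mulrA bmonMg NegzE subrr bmon1 mulr1.
  by rewrite [X in X - _]addrC addrK; apply: Mgr_in; rewrite dvdp_mull.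
exists (u %% d k); first by rewrite -ltnS -(size_setpoly q0) ltn_modp setpoly_neq0.
have -> : bmon k s - bpoly k (u %% d k) =
    (bmon k s - bpoly k u) + bpoly k (u %/ d k * d k).
  by rewrite {2}(divp_eq u (d k)) linearD /= opprD addrA addrAC subrK.
by apply: subspaceD => //; apply: Mgr_in0; rewrite dvdp_mull.
Qed.

(** A basis is given by the classes of X^k (1 - g)^j with j < c_I(k), where
    (k, j) = (0, 0), the class of 1, is left out. *)
Lemma Mset_dim : has_dim [set: aug_quot M] (\sum_(n <- I) n)%N.-1.
Proof.
have sM := Mgr_sub q0 d; have [m Im] := fset_bound I.
have c0 : (0 < cI I 0)%N.
  rewrite lt0n; apply: contraTneq I1 => c0; have := size_setpoly q0 I 0; rewrite c0.
  by move=> /eqP/size_poly1P[c cn0 ->]; rewrite rootC.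
have Mx := Mset_crossed q0 I1.
pose w (t : nat * nat) := aug_class M (bpoly t.1 (Y ^+ t.2)).
have w0 : w (0%N, 0%N) = 0 by rewrite /w expr0 bpoly1 bmon1 aug_class1.
have wE (c : nat * nat -> K) : \sum_(t <- stairs I m) c t *: w t =
    aug_class M (\sum_(k < m) bpoly k (\sum_(j < cI I k) c (k : nat, j : nat) *: Y ^+ j)).
  rewrite (eq_bigr (fun t => (fun k j => c (k, j) *: w (k, j)) t.1 t.2)); last by case.
  rewrite (big_stairs Im c0 (F := fun k j => c (k, j) *: w (k, j))); last by rewrite w0 scaler0.
  rewrite linear_sum; apply: eq_bigr => k _; rewrite !linear_sum.
  by apply: eq_bigr => j _; rewrite !linearZ.
rewrite -(size_stairs Im c0); apply: (@is_basis_seq _ _ _ _ _ w) => //.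
- exact: stairs_uniq.
- move=> v _; rewrite -[v]aug_class_repr; move: (aug_val _) => x.
  pose S := [set x : B | exists c : nat * nat -> K, aug_class M x = \sum_(t <- stairs I m) c t *: w t].
  have sS : is_subspace S.
    split; first by exists (fun=> 0); rewrite linear0 big1 // => t _; rewrite scale0r.
    move=> a y z [c yE] [c' zE]; exists (fun t => a * c t + c' t).
    rewrite linearP /= yE zE scaler_sumr -big_split; apply: eq_bigr => t _ /=.
    by rewrite scalerDl scalerA.
  rewrite -/(S x); have [T _ ->] := bmon_expand x.
  apply: (subspace_sum sS) => -[k s] _ _; apply: (subspaceZ _ sS) => /=.
  have [r rk Mr] := bmon_reduce k s; have [e rE] := poly_1subX rk.
  exists (fun t => if t.1 == k then e t.2 else 0); rewrite wE.
  have -> : aug_class M (bmon k s) = aug_class M (bpoly k r).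
    apply/eqP; rewrite -subr_eq0 -linearB; apply/eqP/aug_class_eq0 => //.
    by have [_ h _ _] := Mx; rewrite (h _ Mr) scale0r subr0.
  have [mk|km] := leqP m k.
    rewrite big1 => [|j _]; last first.
      rewrite big1 ?linear0 // => i _; rewrite (ltn_eqF (leq_trans (ltn_ord j) mk)).
      by rewrite scale0r.
    suff -> : r = 0 by rewrite linear0.
    by apply/eqP; rewrite -size_poly_leq0 -(cI_large Im mk).
  rewrite (bigD1 (Ordinal km)) //= eqxx [X in _ + X]big1 ?addr0 ?rE // => j jk.
  by rewrite big1 ?linear0 // => i _; rewrite (negbTE (jk : j != k :> nat)) scale0r.
move=> c e [k j] kjs; pose c' t := if t == (0%N, 0%N) then 0 else c t.
have cc t : t \in stairs I m -> c t = c' t.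
  by case: t => k' j'; rewrite mem_stairs // /c' => /andP[/negbTE ->].
rewrite cc //; move: e; rewrite big_seq; under eq_bigr => t ts do rewrite cc //.
rewrite -big_seq wE => /(aug_class_eq0 sM); set x := \sum_(k < m) _.
have x0 : cou x = 0.
  rewrite /x (lin_sumE _ _ _ (lin_linear (@cou _ B))) big1 // => i _; rewrite cou_bpoly.
  case: eqP => [->|_]; last by rewrite mul0r.
  rewrite mul1r horner_sum big1 // => l _; rewrite hornerZ horner_exp !hornerE subrr.
  by case: (l : nat) => [|l']; rewrite ?expr0n ?mulr0 // /c' eqxx mul0r.
rewrite x0 scale0r subr0 => Mxx; move: kjs; rewrite mem_stairs // => /andP[_ jk].
have km : (k < m)%N by rewrite ltnNge; apply: contraTN jk => mk; rewrite (cI_large Im).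
have := Mgr_sum (P := fun k => \sum_(j < cI I k) c' (k, j : nat) *: Y ^+ j)
  (setpoly_root0 _ I) Mxx km.
move=> /dvdp_leq h; apply: (@poly_1subX_free (cI I k) (fun j => c' (k, j))) => //.
apply/eqP; apply: contraT => r0; have := h r0; rewrite size_setpoly // ltnNge.
move=> /negP[]; apply: leq_trans (size_sum _ _ _) _; apply/bigmax_leqP => l _.
apply: leq_trans (size_scale_leq _ _) _; apply: leq_trans (size_poly_exp_leq _ _) _.
have -> : size Y = 2 by rewrite /Y -['X]scale1r size_linear_factor ?oner_neq0.
by rewrite mul1n.
Qed.

End Dimension.

(** * The difference operator on polynomials *)

Section ShiftDifference.
Variable K : fieldType.
Hypothesis char0 : [pchar K] =i pred0.

Lemma natrK_eq0 n : (n%:R == 0 :> K) = (n == 0%N).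
Proof. exact: (pcharf0P K).1. Qed.

Lemma natrK_inj : injective (fun n : nat => n%:R : K).
Proof.
move=> n m /= /eqP; wlog nm : n m / (n <= m)%N.
  by move=> h; case: (leqP n m) => [/h//|/ltnW/h h']; rewrite eq_sym => /h'.
by rewrite eq_sym -subr_eq0 -natrB // natrK_eq0 subn_eq0 => mn; apply/eqP; rewrite eqn_leq nm.
Qed.

(** This operator is both the adjoint action of X and the transpose of the
    multiplication by 1 - g. *)
Definition shiftdiff (r : {poly K}) : {poly K} := r - (r \Po ('X + 1)).

Lemma shiftdiff_is_linear : is_linear shiftdiff.
Proof.
move=> c x y; rewrite /shiftdiff comp_polyD comp_polyZ scalerBr opprD.
by rewrite addrACA.
Qed.

Lemma size_shiftdiffX m : (size (shiftdiff 'X^m) <= m)%N.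
Proof.
rewrite /shiftdiff comp_Xn_poly exprDn big_ord_recl subn0 expr0 mulr1 bin0 mulr1n.
rewrite opprD addrA subrr sub0r size_polyN; apply: leq_trans (size_sum _ _ _) _.
apply/bigmax_leqP => i _; rewrite expr1n mulr1 -scaler_nat.
apply: leq_trans (size_scale_leq _ _) _; rewrite size_polyXn /= /bump add1n.
by have := ltn_ord i; lia.
Qed.

Lemma coef_shiftdiffX m : (shiftdiff 'X^(m.+1))`_m = - m.+1%:R.
Proof.
rewrite /shiftdiff comp_Xn_poly exprDn coefB coefXn (ltn_eqF (ltnSn m)) sub0r coef_sum.
have m1 : (1 < m.+2)%N by [].
rewrite (bigD1 (Ordinal m1)) //= big1 => [|i i1].
  by rewrite addr0 subSS subn0 expr1n mulr1 coefMn coefXn eqxx bin1.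
rewrite expr1n mulr1 coefMn coefXn (_ : (m == m.+1 - i)%N = false) ?mul0rn //.
apply/eqP => e; case/eqP: i1; apply: val_inj => /=; have := ltn_ord i; lia.
Qed.

(** In characteristic 0 the difference operator lowers the degree by exactly one. *)
Lemma size_shiftdiff r : size (shiftdiff r) = (size r).-1.
Proof.
have [->|r0] := eqVneq r 0.
  by rewrite (is_linear0 shiftdiff_is_linear) size_poly0.
case rs: (size r) => [|s]; first by move/eqP: rs; rewrite size_poly_eq0 (negbTE r0).
have rE : shiftdiff r = \sum_(i < s.+1) r`_i *: shiftdiff 'X^i.
  rewrite -{1}[r]coefK poly_def rs (lin_sumE _ _ _ shiftdiff_is_linear).
  by apply: eq_bigr => i _; rewrite (linZE _ _ shiftdiff_is_linear).
apply/eqP; rewrite eqn_leq; apply/andP; split.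
  rewrite rE; apply: leq_trans (size_sum _ _ _) _; apply/bigmax_leqP => i _.
  apply: leq_trans (size_scale_leq _ _) _; apply: leq_trans (size_shiftdiffX _) _.
  by rewrite -ltnS.
case: s rs rE => [//|s] rs rE; rewrite ltnNge; apply/negP => /leq_sizeP/(_ s (leqnn s)).
rewrite rE coef_sum big_ord_recr /= big1 => [|i _]; last first.
  rewrite coefZ [(shiftdiff _)`_s]nth_default ?mulr0 //; apply: leq_trans (size_shiftdiffX _) _.
  by rewrite -ltnS.
rewrite add0r coefZ coef_shiftdiffX mulrN => /eqP.
rewrite oppr_eq0 mulf_eq0 (natrK_eq0) orbF => /eqP e.
by have := r0; rewrite -lead_coef_eq0 /lead_coef rs /= e eqxx.
Qed.

Lemma size_iter_shiftdiff c r : size (iter c shiftdiff r) = (size r - c)%N.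
Proof. by elim: c => [|c IH]; rewrite ?subn0 // iterS size_shiftdiff IH subnS. Qed.

Lemma poly_nat_roots (r : {poly K}) : (forall n : nat, r.[n%:R] = 0) -> r = 0.
Proof.
move=> h; apply: (@roots_geq_poly_eq0 _ _ [seq n%:R | n <- iota 0 (size r)]).
- by apply/allP => _ /mapP[n _ ->]; apply/eqP.
- by rewrite map_inj_uniq ?iota_uniq //; exact: natrK_inj.
- by rewrite size_map size_iota.
Qed.

End ShiftDifference.

(** * Quantum tangent spaces *)

Section TangentSpaces.
Variables (K : fieldType) (A : hopfAlg K).
Implicit Types (L W : set A) (h x : A).

Lemma cou_ant x : cou (ant x) = cou x.
Proof.
have lc := @lin_linear K A _ (@cou K A).
have := congr1 cou (antipodel x); rewrite (tlift_comp _ _ lc) linearZ /= cou1 [_ *: _]mulr1.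
move=> <-; rewrite -(cop_counitr x (f := fun y => cou (ant y))); last by lin.
by apply: eq_tlift => b c; rewrite couM mulrC.
Qed.

Lemma adl_is_bilinear : is_bilinear (@adl K A).
Proof. by rewrite /adl; lin. Qed.

Lemma adl1 x : adl 1 x = x.
Proof. by rewrite /adl cop1 tlift_tens ?ant1 ?mul1r ?mulr1 //; lin. Qed.

Lemma adl_unit h : adl h 1 = (cou h)%:A.
Proof. by rewrite /adl -antipoder; apply: eq_tlift => b c; rewrite mulr1. Qed.

Lemma cou_adl h x : cou (adl h x) = cou h * cou x.
Proof.
have lc := @lin_linear K A _ (@cou K A).
rewrite /adl (tlift_comp _ _ lc) -[RHS](cop_counitl h (f := fun y => (cou y * cou x : K^o))).
  by apply: eq_tlift => b c; rewrite !couM cou_ant -mulrA [cou x * _]mulrC.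
by move=> c y z; rewrite linearP mulrDl -scalerAl.
Qed.

Lemma adlM (antM : forall a b : A, ant (a * b) = ant b * ant a) a b x :
  adl (a * b) x = adl a (adl b x).
Proof.
rewrite /adl cop_mul; last by lin.
apply: eq_tlift => a1 a2; rewrite (tlift_comp (h := fun y => a1 * y * ant a2)); last by lin.
by apply: eq_tlift => b1 b2; rewrite antM !mulrA.
Qed.

(** With the unit added, tangent spaces are the left coideals containing 1 that
    are invariant under the adjoint action; in this form the coproduct of a
    monomial can be used directly. *)
Lemma coideal_tangent W : is_subspace W -> W 1 ->
  (forall h x, W x -> W (adl h x)) -> (forall x, W x -> tens_sub W (cop x)) ->
  is_tangent [set x | W x /\ cou x = 0].
Proof.
move=> sW W1 Wad Wcop; split=> [|x [] //|h x [Wx x0]|x [Wx x0]].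
- split; first by split; [exact: sW.1 | rewrite linear0].
  move=> c x y [Wx x0] [Wy y0]; split; first exact: sW.2.
  by rewrite linearP x0 y0 scaler0 addr0.
- by split; [exact: Wad | rewrite cou_adl x0 mulr0].
have bl : is_bilinear (fun x1 x2 : A => x1 (x) (x2 - cou x2 *: 1 : A)) by lin.
move: (cop x) (Wcop _ Wx); apply: lspan_min.
  exact: preim_subspace (tlift_is_linear bl) (lspan_subspace _).
move=> _ [a [y [Wy ->]]] /=; rewrite tlift_tens //; apply: sub_lspan.
exists a, (y - cou y *: 1); split=> //; split; first by apply: subspaceB => //; apply: subspaceZ.
by rewrite linearB linearZ /= cou1 [_ *: _]mulr1 subrr.
Qed.

(** The sum of L and the line of 1. *)
Definition unitize L : set A := [set x : A | L (x - (cou x)%:A)].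

Section Unitize.
Variable L : set A.
Hypothesis Lt : is_tangent L.

Let sL : is_subspace L. Proof. by case: Lt. Qed.

Lemma unitize_sub : is_subspace (unitize L).
Proof.
have l : is_linear (fun x : A => x - (cou x)%:A) by lin.
exact: preim_subspace l sL.
Qed.

Lemma unitize1 : unitize L 1.
Proof. by rewrite /unitize /= cou1 scale1r subrr; exact: sL.1. Qed.

Lemma unitizeP x : L x <-> unitize L x /\ cou x = 0.
Proof.
rewrite /unitize /=; split=> [Lx|[+ x0]]; last by rewrite x0 scale0r subr0.
by have [_ h _ _] := Lt; rewrite (h _ Lx) scale0r subr0.
Qed.

Lemma unitize_adl h x : unitize L x -> unitize L (adl h x).
Proof.
move=> Wx; have -> : adl h x = adl h (x - (cou x)%:A) + (cou x * cou h)%:A.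
  by rewrite (linBE _ _ (adl_is_bilinear.2 h)) (linZE _ _ (adl_is_bilinear.2 h)) adl_unit scalerA subrK.
apply: (subspaceD unitize_sub); last exact: subspaceZ unitize_sub unitize1.
by have [_ _ ad _] := Lt; have /unitizeP[] := ad h _ Wx.
Qed.

(** The coideal condition, tested by a functional on the first factor. *)
Lemma unitize_slice (f : A -> K^o) x : is_linear f -> unitize L x ->
  unitize L (tlift (fun a b => (f a : K) *: b) (cop x)).
Proof.
move=> fl Wx; have bf : is_bilinear (fun a b : A => (f a : K) *: b) by lin.
have fL := tlift_is_linear bf.
rewrite -[x](subrK (cou x)%:A) linearD [cop (_ *: _)]linearZ /= cop1 (linDE _ _ fL) (linZE _ _ fL) tlift_tens //.
apply: (subspaceD unitize_sub); last first.
  by apply: (subspaceZ _ unitize_sub); apply: (subspaceZ _ unitize_sub); exact: unitize1.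
have [_ _ _ /(_ _ Wx)] := Lt; move: (x - _) => y.
have bl : is_bilinear (fun x1 x2 : A => x1 (x) (x2 - cou x2 *: 1 : A)) by lin.
have l : is_linear (fun x : A => x - (cou x)%:A) by lin.
rewrite /unitize /= -[X in L X]/((fun x => x - (cou x)%:A) (tlift (fun a b : A => (f a : K) *: b) (cop y))).
have -> : (fun x => x - (cou x)%:A) (tlift (fun a b : A => (f a : K) *: b) (cop y)) =
   tlift (fun a b : A => (f a : K) *: b)
     (tlift (fun x1 x2 : A => x1 (x) (x2 - cou x2 *: 1 : A)) (cop y)).
  rewrite (tlift_comp _ _ l) (tlift_comp _ _ fL); apply: eq_tlift => a b.
  by rewrite tlift_tens // scalerBr scalerA [cou (_ *: _)]linearZ.
move: (tlift _ (cop y)) => t; move: t; apply: lspan_min; first exact: preim_subspace fL sL.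
by move=> _ [a [m [Lm ->]]] /=; rewrite tlift_tens //; apply: subspaceZ.
Qed.

End Unitize.

End TangentSpaces.

(** * Spans of monomials *)
Section Monomials.
Variables (K : fieldType) (A : hopfAlg K) (T : eqType) (e : T -> A).
Variables (coef : T -> A -> K^o) (t1 : T).
Hypothesis coefl : forall t, is_linear (coef t).
Hypothesis coefE : forall t u, coef t (e u) = (u == t)%:R.
Hypothesis expand : forall x, exists2 S : seq T, uniq S & x = \sum_(t <- S) coef t x *: e t.
Hypothesis e1 : e t1 = 1.

Definition monomial_span (P : set T) : set A := lspan [set x | exists2 t, P t & x = e t].

(** The projection to ker eps of the span of the monomials in P. *)
Definition aug_monomial_span (P : set T) : set A :=
  lspan [set x | exists2 t, P t & x = e t - (cou (e t))%:A].

(** A subspace that contains the monomials of its elements. *)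
Lemma monomial_subspace W : is_subspace W ->
  (forall x t, W x -> coef t x != 0 -> W (e t)) -> W = monomial_span [set t | W (e t)].
Proof.
move=> sW Wm; apply/seteqP; split=> [x Wx|]; last first.
  by apply: lspan_min => // _ [t Wt ->].
have [S _ ->] := expand x; apply: subspace_sum (lspan_subspace _) _ => t _ _.
have [->|ct] := eqVneq (coef t x) 0; first by rewrite scale0r; exact: (lspan_subspace _).1.
apply: subspaceZ (lspan_subspace _) _; apply: sub_lspan; exists t => //.
exact: Wm ct.
Qed.

Lemma monomial_span_aug (P : set T) : P t1 ->
  [set x | monomial_span P x /\ cou x = 0] = aug_monomial_span P.
Proof.
move=> P1; have l : is_linear (fun x : A => x - (cou x)%:A) by lin.
have sl := lspan_subspace [set x | exists2 t, P t & x = e t].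
apply/seteqP; split=> [x [Wx x0]|x Lx].
  rewrite -[x]subr0 -[0 in X in _ - X](scale0r (1 : A)) -x0.
  move: x Wx {x0}; apply: lspan_min; first exact: preim_subspace l (lspan_subspace _).
  by move=> _ [t Pt ->] /=; apply: sub_lspan; exists t.
split; last first.
  move: x Lx; apply: lspan_min; first exact: preim_subspace (lin_linear (@cou K A)) (subspace0 _).
  move=> _ [t Pt ->]; change (cou (e t - (cou (e t))%:A) = 0).
  by rewrite linearB linearZ /= cou1 [_ *: _]mulr1 subrr.
move: x Lx; apply: lspan_min => // _ [t Pt ->] /=.
apply: subspaceB => //; first by apply: sub_lspan; exists t.
by apply: subspaceZ => //; apply: sub_lspan; exists t1.
Qed.

Lemma eq_aug_monomial_span (P Q : set T) : (forall t, t != t1 -> P t <-> Q t) ->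
  aug_monomial_span P = aug_monomial_span Q.
Proof.
have sub (P' Q' : set T) : (forall t, t != t1 -> P' t -> Q' t) ->
    aug_monomial_span P' `<=` aug_monomial_span Q'.
  move=> PQ; apply: lspan_min => [|_ [t Pt ->]]; first exact: lspan_subspace.
  have [->|tt1] := eqVneq t t1; last by apply: sub_lspan; exists t; first exact: PQ.
  by rewrite e1 cou1 scale1r subrr; exact: (lspan_subspace _).1.
by move=> PQ; apply/seteqP; split; apply: sub => t /PQ[].
Qed.

Lemma monomial_coef1 t : coef t 1 = (t1 == t)%:R.
Proof. by rewrite -e1. Qed.

Lemma monomial_span_coef (P : set T) x t : monomial_span P x -> coef t x != 0 -> P t.
Proof.
move=> Wx; apply: contraNP => nPt; apply/eqP; move: x Wx.
apply: lspan_min; first exact: preim_subspace (coefl t) (subspace0 _).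
move=> _ [u Pu ->] /=; rewrite coefE; case: eqP => // ut.
by case: nPt; rewrite -ut.
Qed.

Lemma aug_monomial_dim (S : seq T) : uniq S -> t1 \notin S ->
  has_dim (aug_monomial_span [set t | t \in S]) (size S).
Proof.
move=> uS t1S; apply: (is_basis_seq (w := fun t => e t - (cou (e t))%:A) uS).
- by move=> t tS; apply: sub_lspan; exists t.
- move=> v; move: v; apply: lspan_min.
    split; first by exists (fun=> 0); rewrite big1 // => t _; rewrite scale0r.
    move=> a _ _ [c ->] [c' ->]; exists (fun t => a * c t + c' t).
    rewrite scaler_sumr -big_split; apply: eq_bigr => t _ /=.
    by rewrite scalerDl scalerA.
  move=> _ [t tS ->]; exists (fun u => (u == t)%:R).
  rewrite (bigD1_seq t) //= eqxx scale1r big1 ?addr0 // => u /negbTE ->.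
  by rewrite scale0r.
move=> c ec t tS; have := congr1 (coef t) ec.
rewrite (lin_sumE _ _ _ (coefl t)) (is_linear0 (coefl t)) (bigD1_seq t) //= => <-.
rewrite (linZE _ _ (coefl t)) (linBE _ _ (coefl t)) (linZE _ _ (coefl t)) monomial_coef1 coefE eqxx.
have t1t : t1 == t = false by apply: contraNF t1S => /eqP ->.
rewrite t1t scaler0 subr0 [_ *: _]mulr1 big1 ?addr0 // => u ut.
rewrite (linZE _ _ (coefl t)) (linBE _ _ (coefl t)) (linZE _ _ (coefl t)) monomial_coef1 coefE t1t.
by rewrite (negbTE ut) scaler0 subr0 scaler0.
Qed.

(** A finite basis involves finitely many monomials. *)
Lemma findim_support (L : set A) n : has_dim L n ->
  exists S : seq T, forall x t, L x -> coef t x != 0 -> t \in S.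
Proof.
move=> [b [_ gen]].
have /choice[s sP] : forall i : 'I_n, exists S : seq T, forall t, coef t (b i) != 0 -> t \in S.
  move=> i; have [S _ bS] := expand (b i); exists S => t.
  apply: contraNT => tS; apply/eqP; rewrite bS (lin_sumE _ _ _ (coefl t)) big1_seq // => u /andP[_ uS].
  rewrite (linZE _ _ (coefl t)) coefE (_ : (u == t) = false) ?scaler0 //.
  by apply: contraNF tS => /eqP <-.
exists (flatten [seq s i | i <- enum 'I_n]) => x t /gen[c [-> _]] xt.
apply/flatten_mapP.
have [i ct] : exists i, coef t (b i) != 0.
  apply: contrapT => nex; case/eqP: xt; rewrite (lin_sumE _ _ _ (coefl t)) big1 // => i _.
  rewrite (linZE _ _ (coefl t)); have [->|ct] := eqVneq (coef t (b i)) 0; first by rewrite scaler0.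
  by case: nex; exists i.
by exists i; [rewrite mem_enum | exact: sP].
Qed.

End Monomials.

Section Eigenvectors.
Variables (K : fieldType) (V : lmodType K).

(** Applying f - a_u removes the component of eigenvalue a_u and rescales the
    others by nonzero factors; induction on the number of components. *)
Lemma eigen_components (W : set V) (f : V -> V) (T : eqType) (s : seq T)
    (v : T -> V) (a : T -> K) : is_subspace W -> is_linear f ->
  (forall x, W x -> W (f x)) -> uniq s -> {in s &, injective a} ->
  (forall t, t \in s -> f (v t) = a t *: v t) ->
  W (\sum_(t <- s) v t) -> forall t, t \in s -> W (v t).
Proof.
move=> sW fl Wf; elim: s v => [//|u s IH] v /= /andP[us uniqs] ainj fv.
rewrite big_cons => Wx.
have Wv t : t \in s -> W (v t).
  move=> ts; have tu : a t - a u != 0.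
    rewrite subr_eq0; apply: contraNneq us => /ainj; rewrite !inE eqxx ts orbT.
    by move=> /(_ isT isT) <-.
  apply: (subspaceZK sW tu); move: t ts {tu}.
  apply: (IH (fun t => (a t - a u) *: v t)) => //.
  - by move=> x y xs ys; apply: ainj; rewrite inE ?xs ?ys orbT.
  - by move=> t ts; rewrite (linZE _ _ fl) fv ?inE ?ts ?orbT // !scalerA mulrC.
  have -> : \sum_(t <- s) (a t - a u) *: v t =
      f (v u + \sum_(t <- s) v t) - a u *: (v u + \sum_(t <- s) v t).
    rewrite (linDE _ _ fl) fv ?mem_head // scalerDr opprD addrACA subrr add0r.
    rewrite (lin_sumE _ _ _ fl) scaler_sumr -sumrB; apply: eq_big_seq => t ts.
    by rewrite scalerBl fv // inE ts orbT.
  by apply: subspaceB => //; [exact: Wf | exact: subspaceZ].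
move=> t; rewrite inE => /orP[/eqP ->|]; last exact: Wv.
rewrite -[v u](addrK (\sum_(t <- s) v t)); apply: subspaceB => //.
by apply: subspace_sum => // t' ts' _; exact: Wv.
Qed.

End Eigenvectors.

(** * Tangent spaces of the deformed algebra *)

Section DeformedTangents.
Variables (K : fieldType) (q : K) (q0 : q != 0).
Hypothesis qgen : forall n, (0 < n)%N -> q ^+ n != 1.
Local Notation B := (Bq q0).
Local Notation p := (q^-1).
Local Notation bcoef := (@bcoef K q q0).

(* uncurried forms of the monomials and coefficients, as the results on spans of
   monomials take them *)
Definition bm (t : nat * int) : B := bmon q0 t.1 t.2.
Definition bc (t : nat * int) : B -> K^o := bcoef t.1 t.2.

Lemma bc_lin t : is_linear (bc t). Proof. exact: bcoef_is_linear. Qed.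

Lemma bcE t u : bc t (bm u) = (u == t)%:R.
Proof. by case: t u => n s [m r]; rewrite /bc /bm bcoef_mon. Qed.

Lemma bm_expand x : exists2 S : seq (nat * int), uniq S & x = \sum_(t <- S) bc t x *: bm t.
Proof. exact: bmon_expand. Qed.

Lemma bm1 : bm (0%N, 0) = 1. Proof. exact: bmon1. Qed.

Lemma qz_neq1 (z : int) : z != 0 -> q ^ z != 1.
Proof.
case: z => n n0; first by rewrite -exprnP qgen // lt0n.
by rewrite NegzE -exprnN invr_eq1 qgen.
Qed.

Lemma p_inj : injective (fun n : nat => p ^+ n).
Proof.
move=> n m /= e; have : q ^ (n%:Z - m%:Z) = 1.
  by rewrite expfzDr // -exprnN -exprnP -exprVn -e exprVn mulfV // expf_neq0.
by move/eqP; apply: contraTeq => nm; apply: qz_neq1; rewrite subr_eq0.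
Qed.

Lemma qgen_sum n : \sum_(i < n.+1) p ^+ i != 0.
Proof.
apply: contraNneq (qgen (ltn0Sn n)) => e.
by rewrite -invr_eq1 -exprVn -subr_eq0 subrX1 e mulr0.
Qed.

Lemma adl_bmon_g (t : int) n s : adl (bmon q0 0 t) (bmon q0 n s) = q ^ (- (t * n%:Z)) *: bmon q0 n s.
Proof.
have copg : cop (bmon q0 0 t) = bmon q0 0 t (x) bmon q0 0 t by exact: Bq_copg.
have antg : ant (bmon q0 0 t) = bmon q0 0 (- t) by exact: Bq_antg.
rewrite /adl copg tlift_tens ?antg; last by lin.
by rewrite bmon_gM -scalerAl bmonMg addrAC subrr add0r.
Qed.

Lemma adl_bmon_X n s :
  adl (bmon q0 1 0) (bmon q0 n s) = (1 - q ^ (- (n%:Z + s))) *: bmon q0 n.+1 s.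
Proof.
have copX : cop (bmon q0 1 0) = bmon q0 1 0 (x) 1 + bmon q0 0 1 (x) bmon q0 1 0 by exact: Bq_copX.
have antX : ant (bmon q0 1 0) = - (bmon q0 0 (-1) * bmon q0 1 0) by exact: Bq_antX.
rewrite /adl copX tliftD ?tlift_tens; [|lin..].
rewrite ant1 mulr1 antX bmonXM mulrN mulrA bmon_gM -!scalerAl bmonMg bmonM scalerA.
rewrite addrAC subrr add0r addr0 add1n addn1 -expfzDr // scalerBl scale1r.
by rewrite mul1r mulr1 opprD.
Qed.

Section Support.
Variable L : set B.
Hypothesis Lt : is_tangent L.
Local Notation W := (unitize L).

Let sW : is_subspace W. Proof. exact: unitize_sub. Qed.

(** Coefficient extraction in the first factor of the coproduct. *)
Lemma bslice_mon n t m s : tlift (fun a b : B => (bcoef n t a : K) *: b) (cop (bmon q0 m s)) =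
  if (n <= m)%N && ((m - n)%N%:Z + s == t) then gauss p m (m - n) *: bmon q0 (m - n) s else 0.
Proof.
have bl : is_bilinear (fun a b : B => (bcoef n t a : K) *: b) by lin.
rewrite cop_bmon (lin_sumE _ _ _ (tlift_is_linear bl)).
under eq_bigr => j _ do rewrite (linZE _ _ (tlift_is_linear bl)) tlift_tens // bcoef_mon.
have z (j : 'I_m.+1) : (j : nat) != (m - n)%N \/ (n <= m)%N = false \/ (j%:Z + s == t) = false ->
    gauss p m j *: (((m - j == n)%N && (j%:Z + s == t))%:R *: bmon q0 j s) = 0.
  move=> h; rewrite (_ : _ && _ = false) ?scale0r ?scaler0 //.
  apply/negbTE/negP => /andP[/eqP e1 e2]; have := ltn_ord j.
  by case: h => [/eqP|[|]]; [lia | lia | rewrite e2].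
case: ifP => [/andP[nm e]|ne].
  have jm : (m - n < m.+1)%N by lia.
  rewrite (bigD1 (Ordinal jm)) //= e subKn // eqxx scale1r big1 ?addr0 // => j ij.
  by apply: z; left; apply: contraNneq ij => ij; apply/eqP/val_inj.
rewrite big1 // => j _; apply: z; have [jE|] := eqVneq (j : nat) (m - n)%N; last by left.
by right; move: ne; rewrite -jE; case: leqP => //=; [right | left].
Qed.

(** The functional dual to g^c, applied to the first factor of the coproduct,
    keeps the monomials X^k g^s with k + s = c.  Among these g acts with the
    distinct eigenvalues p^k. *)
Lemma bq_tangent_monomial x t : W x -> bc t x != 0 -> W (bm t).
Proof.
case: t => n s Wx xt; have [S uS xS] := bm_expand x.
pose S' := [seq u <- S | u.1%:Z + u.2 == n%:Z + s].
have Wx' : W (\sum_(u <- S') bc u x *: bm u).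
  have bl : is_bilinear (fun a b : B => (bcoef 0 (n%:Z + s) a : K) *: b) by lin.
  suff <- : tlift (fun a b : B => (bcoef 0 (n%:Z + s) a : K) *: b) (cop x) =
      \sum_(u <- S') bc u x *: bm u.
    by have h := unitize_slice Lt (@bcoef_is_linear _ _ q0 0 (n%:Z + s)) Wx.
  rewrite {1}xS !linear_sum (lin_sumE _ _ _ (tlift_is_linear bl)) [RHS]big_filter [RHS]big_mkcond.
  apply: eq_bigr => u _; rewrite linearZ (linZE _ _ (tlift_is_linear bl)).
  by rewrite bslice_mon subn0 gaussnn scale1r /=; case: ifP; rewrite ?scaler0.
have gl : is_linear (adl (bmon q0 0 1)) by exact: (adl_is_bilinear _).2.
have tS : (n, s) \in S'.
  rewrite mem_filter eqxx /=; apply: contraNT xt => tS; apply/eqP.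
  rewrite xS (lin_sumE _ _ _ (bc_lin _)) big1_seq // => u /andP[_ uS'].
  rewrite (linZE _ _ (bc_lin _)) bcE (_ : (u == _) = false) ?scaler0 //.
  by apply: contraNF tS => /eqP <-.
have Wg y : W y -> W (adl (bmon q0 0 1) y) by exact: unitize_adl.
have inj : {in S' &, injective (fun u : nat * int => p ^+ u.1)}.
  move=> [a b] [a' b']; rewrite !mem_filter /= => /andP[/eqP h _] /andP[/eqP h' _] /p_inj e.
  by rewrite e; congr (_, _); move: h h'; rewrite e; lia.
have eig u : u \in S' -> adl (bmon q0 0 1) (bc u x *: bm u) = p ^+ u.1 *: (bc u x *: bm u).
  move=> _; rewrite (linZE _ _ gl) /bm adl_bmon_g mul1r -exprnN exprVn.
  by rewrite !scalerA mulrC.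
apply: (subspaceZK sW xt).
exact: (eigen_components sW gl Wg (filter_uniq _ uS) inj eig Wx' tS).
Qed.

(** The functional dual to X g^(n+s) lowers the exponent of X by one. *)
Lemma bq_tangent_down n s : W (bm (n.+1, s)) -> W (bm (n, s)).
Proof.
move=> /(unitize_slice Lt (@bcoef_is_linear _ _ q0 1 (n%:Z + s))).
rewrite bslice_mon ltnS leq0n andTb subn1 [n.+1.-1]/= eqxx gaussSn; apply: (subspaceZK sW).
exact: qgen_sum.
Qed.

(** ad_X raises the exponent of X unless n + s = 0. *)
Lemma bq_tangent_up n s : n%:Z + s != 0 -> W (bm (n, s)) -> W (bm (n.+1, s)).
Proof.
move=> ns /(unitize_adl Lt (bmon q0 1 0)); rewrite /bm adl_bmon_X; apply: subspaceZK => //.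
by rewrite subr_eq0 eq_sym qz_neq1 // oppr_eq0.
Qed.

End Support.
Implicit Types J : {fset nat}.

(** The strings X^k g^(1-n), k < n; the string of n = 1 is the monomial 1. *)
Definition Lexp J : set (nat * int) :=
  [set t | exists2 n, n \in (1%N |` J)%fset & t.2 = 1 - n%:Z /\ (t.1 < n)%N].

Definition Lset J : set B := aug_monomial_span bm (Lexp J).

Lemma Lexp1 J : Lexp J (0%N, 0).
Proof. by exists 1%N; rewrite ?fset1U1. Qed.

Lemma LsetE J : Lset J = [set x | monomial_span bm (Lexp J) x /\ cou x = 0].
Proof. by rewrite (monomial_span_aug bm1 (Lexp1 J)). Qed.

(** X kills the top monomial of each string: ad_X sends X^k g^s to a multiple of
    1 - q^-(k+s). *)
Lemma Lset_tangent J : is_tangent (Lset J).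
Proof.
have sW : is_subspace (monomial_span bm (Lexp J)) by exact: lspan_subspace.
have antM (a b : B) : ant (a * b) = ant b * ant a by exact: Bq_antM.
have mem t : Lexp J t -> monomial_span bm (Lexp J) (bm t) by move=> Jt; apply: sub_lspan; exists t.
rewrite LsetE; apply: coideal_tangent => //.
- by rewrite -bm1; apply/mem/Lexp1.
- move=> h; move: h; apply: (@Bq_gen_ind K q q0).
  + by move=> x; rewrite adl1.
  + by move=> c a b ha hb x Wx; rewrite ((adl_is_bilinear _).1 x); apply: sW.2; [exact: ha | exact: hb].
  + by move=> a b ha hb x Wx; rewrite (adlM antM); exact/ha/hb.
  move=> a ga x; move: x; apply: lspan_min.
    by have h := preim_subspace ((adl_is_bilinear B).2 a) sW.
  move=> _ [[k s] [n nJ [/= -> kn]] ->] /=.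
  have gk t : monomial_span bm (Lexp J) (adl (bmon q0 0 t) (bmon q0 k (1 - n%:Z))).
    by rewrite adl_bmon_g; apply: (subspaceZ _ sW); apply: (mem (k, _)); exists n.
  case: ga => ->; [|exact: gk|exact: gk].
  rewrite -/(bmon q0 1 0) adl_bmon_X.
  have [kn1|kn1] := ltnP k.+1 n.
    by apply: (subspaceZ _ sW); apply: (mem (k.+1, _)); exists n.
  have -> : k%:Z + (1 - n%:Z) = 0 by lia.
  by rewrite oppr0 expr0z subrr scale0r; exact: sW.1.
- apply: lspan_min.
    by have h := preim_subspace (lin_linear (@cop _ B)) (lspan_subspace _); exact: h.
  move=> _ [[k s] [n nJ [/= -> kn]] ->]; change (tens_sub (monomial_span bm (Lexp J)) (cop (bmon q0 k (1 - n%:Z)))).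
  rewrite cop_bmon; apply: subspace_sum (lspan_subspace _) _ => j _ _.
  apply: (subspaceZ _ (lspan_subspace _)); apply: sub_lspan.
  exists (bmon q0 (k - j) (j%:Z + (1 - n%:Z))), (bmon q0 j (1 - n%:Z)); split=> //.
  apply: (mem (j : nat, _)); exists n => //; split=> //=.
  by apply: leq_ltn_trans kn; rewrite -ltnS.
Qed.

Lemma Lset_findim J : exists n, has_dim (Lset J) n.
Proof.
pose S : seq (nat * int) := [seq t : nat * int <- [seq (k, 1 - n%:Z) | n <- (1%N |` J)%fset, k <- iota 0 n] |
  t != (0%N, 0)].
exists (size (undup S)).
rewrite /Lset (eq_aug_monomial_span bm1 (Q := [set t | t \in undup S])) => [|t t1].
  apply: (aug_monomial_dim bc_lin bcE bm1); first exact: undup_uniq.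
  by rewrite mem_undup mem_filter eqxx.
rewrite /= mem_undup mem_filter t1 andTb; split.
  case: t {t1} => k s [n nJ [/= -> kn]]; apply/allpairsPdep; exists n, k.
  by rewrite mem_iota.
by move=> /allpairsPdep[n [k [nJ kn ->]]]; exists n; rewrite // mem_iota in kn *.
Qed.

Lemma Lset_inj J J' : 0%N \notin J -> 1%N \notin J -> 0%N \notin J' -> 1%N \notin J' ->
  Lset J = Lset J' -> J = J'.
Proof.
have sub I I' n : 0%N \notin I -> 1%N \notin I -> Lset I = Lset I' -> n \in I -> n \in I'.
  move=> I0 I1 e nI; have n2 : (1 < n)%N by case: n nI I0 I1 => [|[|n]] // ->.
  have Ln : monomial_span bm (Lexp I) (bm (1%N, 1 - n%:Z)).
    by apply: sub_lspan; exists (1%N, 1 - n%:Z) => //; exists n; rewrite // fset1Ur.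
  have c0 : cou (bm (1%N, 1 - n%:Z)) = 0 by rewrite /bm cou_bmon.
  have : Lset I (bm (1%N, 1 - n%:Z)) by rewrite LsetE.
  rewrite e LsetE => -[/(monomial_span_coef bc_lin bcE) h _].
  have := h (1%N, 1 - n%:Z); rewrite bcE eqxx oner_eq0 => /(_ isT)[n' + [/= e' n1]].
  have -> : n = n' by lia.
  by rewrite !inE => /orP[/eqP e1|//]; rewrite e1 in n1.
by move=> *; apply/fsetP => n; apply/idP/idP; apply: sub.
Qed.

(** In a finite dimensional tangent space every string of monomials X^k g^s
    starts at k = 0 and can only stop at k = -s, where ad_X vanishes. *)
Theorem bq_tangent_classification (L : set B) N : is_tangent L -> has_dim L N ->
  exists J, [/\ 0%N \notin J, 1%N \notin J & L = Lset J].
Proof.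
move=> Lt Ln; have sW := unitize_sub Lt; have W1 := unitize1 Lt.
have [S SP] := findim_support bc_lin bcE bm_expand Ln.
have PS n s : unitize L (bm (n, s)) -> (n, s) != (0%N, 0) -> (n, s) \in S.
  move=> Wns ns0; apply: (SP (bm (n, s) - (cou (bm (n, s)))%:A)) => //.
  rewrite (linBE _ _ (bc_lin _)) (linZE _ _ (bc_lin _)) bcE eqxx (monomial_coef1 bcE bm1).
  by rewrite [_ == (n, s)]eq_sym (negbTE ns0) scaler0 subr0 oner_eq0.
have Ptop n s : unitize L (bm (n, s)) -> n%:Z + s <= 0.
  move=> Wns; have [//|ns] := Order.TotalTheory.leP (n%:Z + s) 0.
  have up i : unitize L (bm ((n + i)%N, s)).
    elim: i => [|i IH]; first by rewrite addn0.
    by rewrite addnS; apply: (bq_tangent_up Lt _ IH); lia.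
  pose m := \max_(t <- S) t.1.
  have : ((n + m.+1)%N, s) \in S by apply: PS; [exact: up | rewrite addnS].
  by move=> /(leq_bigmax_seq (P := xpredT) (F := fun t => t.1))/(_ isT) /=; rewrite -/m; lia.
have Pdown n s i : (i <= n)%N -> unitize L (bm (n, s)) -> unitize L (bm (i, s)).
  move=> /subnKC <-; elim: (n - i)%N => [|m IH]; first by rewrite addn0.
  by rewrite addnS => /(bq_tangent_down Lt).
have Pup n s i : (i <= n)%N -> n%:Z + s <= 0 -> unitize L (bm (i, s)) -> unitize L (bm (n, s)).
  move=> /subnKC <-; elim: (n - i)%N => [|m IH]; first by rewrite addn0.
  rewrite addnS => ms Wi; apply: (bq_tangent_up Lt); first by lia.
  by apply: IH => //; lia.
pose J := [fset n in [seq absz (1 - t.2) | t <- S] | (1 < n)%N && `[< unitize L (bm (0%N, 1 - n%:Z)) >]]%fset.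
exists J; split; [by rewrite !inE andbF | by rewrite !inE andbF |].
have eP : [set t | unitize L (bm t)] = Lexp J.
  apply/seteqP; split=> [[n s] /= Wns|[k s] [n + [/= -> kn]]]; last first.
    rewrite !inE => /orP[/eqP n1|/and3P[_ _ /asboolP W0]]; last by apply: (@Pup _ _ 0%N) => //; lia.
    have -> : k = 0%N by lia.
    by rewrite n1 subrr bm1.
  have ns := Ptop _ _ Wns; exists (absz (1 - s)); last by split=> /=; lia.
  have [->|s0] := eqVneq s 0; first by rewrite !inE.
  rewrite !inE; apply/orP; right; apply/and3P; split; first 1 last.
  - by lia.
  - apply/asboolP; have -> : 1 - (absz (1 - s))%:Z = s by lia.
    exact: Pdown (leq0n n) Wns.
  apply/mapP; exists (0%N, s) => //; apply: PS; first exact: Pdown (leq0n n) Wns.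
  by apply: contraNneq s0 => -[->].
rewrite LsetE -eP -(monomial_subspace bm_expand sW); last first.
  by move=> x t; exact: (bq_tangent_monomial Lt).
by apply/seteqP; split=> x /(unitizeP Lt).
Qed.

End DeformedTangents.

(** * Tangent spaces of the enveloping algebra *)

(** X^n r(H). *)
HB.lock Definition upoly (K : fieldType) (n : nat) (r : {poly K}) : UB K :=
  (Ub_mon K n 0 : UB K) * horner_alg (Ub_mon K 0 1 : UB K) r.

Section EnvelopingAlgebra.
Variable K : fieldType.
Local Notation U := (UB K).

(** X^n H^m. *)
Definition um (t : nat * nat) : U := Ub_mon K t.1 t.2.
Definition uc (t : nat * nat) : U -> K^o := sc_coef (T := Ub_table K) t.
Local Notation X := (um (1, 0)%N).
Local Notation H := (um (0, 1)%N).

Lemma uc_lin t : is_linear (uc t). Proof. exact: sclin_is_linear. Qed.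

HB.instance Definition _ t := GRing.isLinear.Build K U K^o *:%R (uc t) (uc_lin t).

Lemma ucE t u : uc t (um u) = (u == t)%:R.
Proof. by case: u => n m; exact: (sc_coefE (T := Ub_table K)). Qed.

Lemma um_expand x : exists2 S : seq (nat * nat), uniq S & x = \sum_(t <- S) uc t x *: um t.
Proof.
have [S uS {1}->] := sc_expand (x : scalg (Ub_table K)); exists S => //.
by apply: eq_bigr => -[n m] _.
Qed.

Lemma um1 : um (0, 0)%N = 1. Proof. exact: (scb1 (Ub_table K)). Qed.

Lemma umE n m : um (n, m) = X ^+ n * H ^+ m. Proof. exact: Ub_XHE. Qed.

Lemma XnE n : um (n, 0)%N = X ^+ n. Proof. by rewrite umE expr0 mulr1. Qed.

Lemma HX : H * X = X * H + X. Proof. exact: Ub_HX. Qed.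

Lemma cou_um n m : cou (um (n, m)) = ((n, m) == (0, 0)%N)%:R.
Proof.
apply: etrans (Ub_cou_mon _ _ _) _.
by case: n m => [|n] [|m]; rewrite !expr0n /= ?mulr0 ?mul0r ?mulr1.
Qed.

Lemma upoly_is_linear n : is_linear (@upoly K n).
Proof. by move=> c x y; rewrite upoly.unlock linearP /= mulr_algl mulr_linr. Qed.

HB.instance Definition _ n := GRing.isLinear.Build K {poly K} U *:%R (@upoly K n)
  (upoly_is_linear n).

Lemma upolyX n m : upoly n 'X^m = um (n, m).
Proof. by rewrite upoly.unlock rmorphXn /= horner_algX umE -XnE. Qed.

Lemma upolyE n r : upoly n r = \sum_(i < size r) r`_i *: um (n, i : nat).
Proof.
rewrite -{1}[r]coefK poly_def linear_sum; apply: eq_bigr => i _.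
by rewrite linearZ /= upolyX.
Qed.

Lemma uc_upoly n m k r : uc (n, m) (upoly k r) = (k == n)%:R * r`_m.
Proof.
move: r; apply: (lin_poly_ext (V := K^o)); [lin | |move=> i].
  by move=> c x y; rewrite coefD coefZ mulrDr mulrCA.
rewrite upolyX ucE coefXn xpair_eqE [m == i]eq_sym.
by case: eqP => _; case: eqP => _; rewrite ?mul1r ?mul0r.
Qed.

Lemma upoly_expand (x : U) : exists n (R : nat -> {poly K}), x = \sum_(k < n) upoly k (R k).
Proof.
have [S _ ->] := um_expand x.
pose P := [set x : U | exists n (R : nat -> {poly K}), x = \sum_(k < n) upoly k (R k)].
have wid n m (R : nat -> {poly K}) : (n <= m)%N ->
    \sum_(k < n) upoly k (R k) = \sum_(k < m) upoly k (if (k < n)%N then R k else 0).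
  move=> nm; rewrite (big_ord_widen _ (fun k => upoly k (R k)) nm) big_mkcond.
  by apply: eq_bigr => k _; case: ifP => _; rewrite ?linear0.
apply: (subspace_sum (W := P)) => [|[n m] _ _]; first split.
- by exists 0%N, (fun=> 0); rewrite big_ord0.
- move=> c x' y [n [R ->]] [m [R' ->]]; exists (maxn n m).
  exists (fun k => c *: (if (k < n)%N then R k else 0) + (if (k < m)%N then R' k else 0)).
  rewrite (wid n (maxn n m)) ?leq_maxl // (wid m (maxn n m)) ?leq_maxr //.
  rewrite scaler_sumr -big_split; apply: eq_bigr => k _.
  by rewrite linearP.
exists n.+1, (fun k => if k == n then uc (n, m) x *: 'X^m else 0).
rewrite big_ord_recr /= eqxx big1 ?add0r => [|k _]; first by rewrite linearZ /= upolyX.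
by rewrite (ltn_eqF (ltn_ord k)) linear0.
Qed.

Lemma HXn n : H * X ^+ n = X ^+ n * H + n%:R *: X ^+ n.
Proof.
elim: n => [|n IH]; first by rewrite !expr0 mul1r mulr1 scale0r addr0.
rewrite exprS mulrA HX mulrDl -mulrA IH mulrDr -!scalerAr !mulrA -exprS -addrA; congr (_ + _).
by rewrite -natr1 scalerDl scale1r.
Qed.

Lemma adl_prim (y x : U) : cop y = y (x) 1 + 1 (x) y -> ant y = - y ->
  adl y x = y * x - x * y.
Proof.
move=> cy sy; rewrite /adl cy tliftD; last by lin.
by rewrite !tlift_tens ?ant1 ?sy ?mulr1 ?mul1r ?mulrN //; lin.
Qed.

Lemma adl_H n m : adl H (um (n, m)) = n%:R *: um (n, m).
Proof.
rewrite adl_prim; [|exact: Ub_copH|exact: Ub_antH].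
rewrite (umE n m) mulrA HXn mulrDl -!mulrA -exprS -exprSr addrC addKr.
by rewrite -scalerAl.
Qed.

(** r(H) X = X r(H + 1). *)
Lemma upoly_mulX n r : upoly n r * X = upoly n.+1 (r \Po ('X + 1)).
Proof.
move: r; apply: lin_poly_ext => [c x y|c x y|m].
- by rewrite linearP mulr_linl.
- by rewrite comp_polyD comp_polyZ linearP.
have HmX k : H ^+ k * X = X * horner_alg H (('X + 1) ^+ k).
  elim: k => [|k IH]; first by rewrite !expr0 mul1r rmorph1 mulr1.
  rewrite exprS -mulrA IH mulrA HX exprS rmorphM rmorphD /= rmorph1 horner_algX.
  by rewrite !mulrDl mul1r mulrDr !mulrA.
rewrite upolyX (umE n m) -mulrA HmX mulrA -exprSr comp_Xn_poly upoly.unlock.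
by rewrite -XnE.
Qed.

(** The commutator of X and X^n r(H) is X^(n+1) (r(H) - r(H + 1)). *)
Lemma adl_X n m : adl X (um (n, m)) = upoly n.+1 (shiftdiff 'X^m).
Proof.
rewrite adl_prim; [|exact: Ub_copX|exact: Ub_antX].
rewrite linearB /= upolyX; congr (_ - _); first by rewrite (umE n m) (umE n.+1 m) mulrA -exprS.
by rewrite -upolyX upoly_mulX.
Qed.

Lemma cop_um n m : cop (um (n, m)) = \sum_(i < n.+1) \sum_(j < m.+1)
  ('C(n, i) * 'C(m, j))%:R *: (um (i : nat, j : nat) (x) um (n - i, m - j)%N).
Proof.
have c y : GRing.comm (y (x) 1) (1 (x) y : tensor U U).
  by rewrite /GRing.comm !tens_mul !mulr1 !mul1r.
have tX (y : U) i : (y (x) 1) ^+ i = (y ^+ i) (x) 1.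
  by elim: i => [|i IH]; rewrite ?expr0 // !exprS IH tens_mul mulr1.
have tX' (y : U) i : (1 (x) y) ^+ i = (1 : U) (x) (y ^+ i).
  by elim: i => [|i IH]; rewrite ?expr0 // !exprS IH tens_mul mulr1.
rewrite [LHS]Ub_cop_mon addrC [H (x) 1 + _]addrC.
rewrite !exprDn_comm; try by apply: commr_sym; apply: c.
rewrite mulr_suml; apply: eq_bigr => i _; rewrite mulr_sumr; apply: eq_bigr => j _.
rewrite !(tX, tX') !tens_mul !mul1r !mulr1 mulrnAl mulrnAr -mulrnA scaler_nat mulnC.
by rewrite tens_mul (umE i j) (umE (n - i) (m - j)).
Qed.

End EnvelopingAlgebra.

Section ClassicalTangents.
Variable K : fieldType.
Hypothesis char0 : [pchar K] =i pred0.
Local Notation U := (UB K).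
Local Notation um := (@um K).
Local Notation uc := (@uc K).
Local Notation X := (um (1, 0)%N).
Local Notation H := (um (0, 1)%N).
Implicit Type I : {fset nat}.

Section Support.
Variable L : set U.
Hypothesis Lt : is_tangent L.
Local Notation W := (unitize L).

Let sW : is_subspace W. Proof. exact: unitize_sub. Qed.

(* functionals on the first factor of the coproduct lower both exponents *)
Let uslice t n m : tlift (fun a b : U => (uc t a : K) *: b) (cop (um (n, m))) =
  if (t.1 <= n)%N && (t.2 <= m)%N
  then ('C(n, t.1) * 'C(m, t.2))%:R *: um (n - t.1, m - t.2)%N else 0.
Proof.
have bl : is_bilinear (fun a b : U => (uc t a : K) *: b) by lin.
have tl := tlift_is_linear bl; rewrite cop_um (lin_sumE _ _ _ tl).
under eq_bigr => i _.
  rewrite (lin_sumE _ _ _ tl); under eq_bigr => j _ do rewrite (linZE _ _ tl) tlift_tens // ucE.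
  over.
case: t {bl tl} => a b /=.
have z (i j : nat) : (i == a) && (j == b) = false -> ('C(n, i) * 'C(m, j))%:R *:
    ((((i, j) == (a, b))%:R : K) *: um (n - i, m - j)%N) = 0.
  by rewrite xpair_eqE => ->; rewrite scale0r scaler0.
case: ifP => [/andP[an bm]|nab].
  have an' : (a < n.+1)%N by []; have bm' : (b < m.+1)%N by [].
  rewrite (bigD1 (Ordinal an')) //= [X in _ + X]big1 ?addr0 => [|i ia].
    rewrite (bigD1 (Ordinal bm')) //= eqxx scale1r [X in _ + X]big1 ?addr0 // => j jb.
    by apply: z; apply/negbTE; apply: contra jb => /andP[_ e]; apply/eqP/val_inj/eqP.
  rewrite big1 // => j _; apply: z; apply/negbTE; apply: contra ia => /andP[e _].
  by apply/eqP/val_inj/eqP.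
rewrite big1 // => i _; rewrite big1 // => j _; apply: z; apply/negbTE.
apply: contraFN nab => /andP[/eqP <- /eqP <-].
by rewrite -(ltnS i) -(ltnS j) !ltn_ord.
Qed.

Let slice_d n m : W (um (n, m.+1)) -> W (um (n, m)).
Proof.
move=> /(unitize_slice Lt (@uc_lin _ (0, 1)%N)); rewrite uslice /= subn0 bin0 bin1 mul1n subn1.
by apply: (subspaceZK sW); rewrite (natrK_eq0 char0).
Qed.

Let slice_X n m : W (um (n.+1, m)) -> W (um (n, m)).
Proof.
move=> /(unitize_slice Lt (@uc_lin _ (1, 0)%N)); rewrite uslice /= subn0 bin0 bin1 muln1 subn1.
by apply: (subspaceZK sW); rewrite (natrK_eq0 char0).
Qed.

(* the functional dual to H differentiates with respect to H *)
Let slice_deriv n r : W (upoly n r) -> W (upoly n r^`()).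
Proof.
move=> /(unitize_slice Lt (@uc_lin _ (0, 1)%N)).
have bl : is_bilinear (fun a b : U => (uc (0, 1)%N a : K) *: b) by lin.
suff -> : tlift (fun a b : U => (uc (0, 1)%N a : K) *: b) (cop (upoly n r)) = upoly n r^`() by [].
have tl := tlift_is_linear bl.
move: r; apply: lin_poly_ext => [c x y|c x y|m].
- by rewrite linearP linearP tl.
- by rewrite derivD derivZ linearP.
rewrite upolyX uslice derivXn /= subn0 bin0 bin1 mul1n subn1 -scaler_nat linearZ /= upolyX.
by case: m => [|m]; rewrite ?scale0r.
Qed.

(** In characteristic 0 a space of polynomials stable under differentiation is
    spanned by powers: differentiation reaches all lower powers. *)
Let upoly_powers n r : W (upoly n r) -> forall j, (j < size r)%N -> W (um (n, j)).
Proof.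
suff main s : forall r : {poly K}, size r = s -> W (upoly n r) -> forall j, (j < s)%N -> W (um (n, j)).
  exact: (main _ r).
elim: s {r} => [r _ _ j|s IH r rs Wr]; first by rewrite ltn0.
have ds : size r^`() = s.
  apply/eqP; rewrite eqn_leq; apply/andP; split.
    by apply: leq_trans (size_poly _ _) _; rewrite rs.
  case: s rs {IH} => // s rs; rewrite ltnNge; apply/negP => /leq_sizeP/(_ s (leqnn s)).
  rewrite coef_deriv -mulr_natr => /eqP; rewrite mulf_eq0 (natrK_eq0 char0) orbF => /eqP r0.
  by have := lead_coef_eq0 r; rewrite /lead_coef rs /= r0 eqxx -size_poly_eq0 rs.
have low := IH _ ds (slice_deriv Wr).
move=> j; rewrite ltnS leq_eqVlt => /orP[/eqP ->|]; last exact: low.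
have r0 : r`_s != 0.
  have : lead_coef r != 0 by rewrite lead_coef_eq0 -size_poly_eq0 rs.
  by rewrite /lead_coef rs.
apply: (subspaceZK sW r0).
have -> : r`_s *: um (n, s) = upoly n r - \sum_(i < s) r`_i *: um (n, i : nat).
  by rewrite upolyE rs big_ord_recr /= [X in X - _]addrC addrK.
apply: (subspaceB sW Wr); apply: (subspace_sum sW) => i _ _.
apply: (subspaceZ _ sW); exact: low.
Qed.

(* ad_X gives X^(n+1) times a polynomial of degree m in H *)
Let adX_step n m : W (um (n, m.+1)) -> W (um (n.+1, m)).
Proof.
move=> /(unitize_adl Lt X); rewrite adl_X => /upoly_powers; apply.
rewrite ltnNge; apply/negP => /leq_sizeP/(_ m (leqnn m))/eqP.
by rewrite coef_shiftdiffX oppr_eq0 (natrK_eq0 char0).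
Qed.

Lemma uc_expand n (R : nat -> {poly K}) a j :
  uc (a, j) (\sum_(k < n) upoly k (R k)) = if (a < n)%N then (R a)`_j else 0.
Proof.
rewrite (lin_sumE _ _ _ (uc_lin _)); case: ltnP => an.
  rewrite (bigD1 (Ordinal an)) //= uc_upoly eqxx mul1r big1 ?addr0 // => k ka.
  by rewrite uc_upoly (negbTE (ka : k != a :> nat)) mul0r.
rewrite big1 // => k _; rewrite uc_upoly (_ : (k == a :> nat) = false) ?mul0r //.
by apply/ltn_eqF/(leq_trans _ an)/ltn_ord.
Qed.

(* X^n r(H) is an eigenvector of ad_H of eigenvalue n, and eigenvalues are
   distinct in characteristic 0 *)
Let ub_tangent_monomial x t : W x -> uc t x != 0 -> W (um t).
Proof.
case: t => a j Wx; have [n [R xE]] := upoly_expand x; rewrite xE uc_expand.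
case: ltnP => [an Raj|_ /eqP h]; last by case: (h erefl).
apply: (@upoly_powers a (R a)); last by rewrite ltnNge; apply: contra Raj => h; rewrite nth_default.
have hl : is_linear (adl H) by exact: (adl_is_bilinear U).2.
have WH y : W y -> W (adl H y) by exact: unitize_adl.
have eig k : k \in iota 0 n -> adl H (upoly k (R k)) = k%:R *: upoly k (R k).
  move=> _; rewrite upolyE (lin_sumE _ _ _ hl) scaler_sumr; apply: eq_bigr => i _.
  by rewrite (linZE _ _ hl) adl_H !scalerA mulrC.
have Ws : W (\sum_(k <- iota 0 n) upoly k (R k)).
  suff -> : \sum_(k <- iota 0 n) upoly k (R k) = x by [].
  by rewrite xE -(big_mkord xpredT (fun k => upoly k (R k))) /index_iota subn0.
have an' : a \in iota 0 n by rewrite mem_iota.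
exact: (eigen_components sW hl WH (iota_uniq 0 n) (in2W (natrK_inj char0)) eig Ws an').
Qed.

(** The monomials of a finite dimensional tangent space form a staircase with
    steps of height at most one. *)
Lemma ub_tangent_stairs N : has_dim L N -> exists2 I, posfin I &
  L = aug_monomial_span um [set t | (t.2 < cI I t.1)%N].
Proof.
move=> Ln; have [S SP] := findim_support (@uc_lin K) (@ucE K) (@um_expand K) Ln.
have W1 := unitize1 Lt.
have [P PW] : exists P : nat -> nat -> bool, forall n j, P n j <-> W (um (n, j)).
  by exists (fun n j => `[< W (um (n, j)) >]) => n j; split=> /asboolP.
have [m Pm] : exists m, forall n j, P n j -> (n < m)%N && (j < m)%N.
  exists (\max_(t <- (0, 0)%N :: S) maxn t.1 t.2).+1 => n j /PW Wnj.
  rewrite !ltnS -geq_max.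
  suff nj : (n, j) \in (0, 0)%N :: S.
    exact: (leq_bigmax_seq (P := xpredT) (F := fun t : nat * nat => maxn t.1 t.2) (n, j) nj isT).
  rewrite inE; have [//|nj0] := eqVneq (n, j) (0, 0)%N; rewrite orFb.
  apply: (SP (um (n, j) - (cou (um (n, j)))%:A) (n, j)); first exact: Wnj.
  rewrite (linBE _ _ (uc_lin _)) (linZE _ _ (uc_lin _)) ucE eqxx (monomial_coef1 (@ucE K) (um1 K)).
  by rewrite [_ == (n, j)]eq_sym (negbTE nj0) scaler0 subr0 oner_eq0.
have ex n : exists j, ~~ P n j.
  by exists m; apply/negP => /Pm; rewrite ltnn andbF.
pose c n := ex_minn (ex n).
have Pd n j : P n j.+1 -> P n j by move=> /PW h; apply/PW/slice_d.
have PX n j : P n.+1 j -> P n j by move=> /PW h; apply/PW/slice_X.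
have PA n j : P n j.+1 -> P n.+1 j by move=> /PW h; apply/PW/adX_step.
have Pc n j : P n j = (j < c n)%N.
  rewrite /c; case: ex_minnP => k nPk kmin; apply/idP/idP => [Pj|jk].
    rewrite ltnNge; apply: contra nPk => kj; move: Pj; rewrite -(subnKC kj).
    by elim: (j - k)%N => [|i IH]; rewrite ?addn0 // addnS => /Pd.
  by apply: contraLR jk => /kmin; rewrite -leqNgt.
have cm k : (m <= k)%N -> c k = 0%N.
  move=> mk; apply/eqP; rewrite -leqn0 leqNgt -Pc; apply/negP => /Pm.
  by rewrite ltnNge mk.
have cS k : (c k.+1 <= c k <= (c k.+1).+1)%N.
  apply/andP; split.
    by rewrite leqNgt; apply/negP; rewrite -Pc => /PX; rewrite Pc ltnn.
  by rewrite leqNgt; apply/negP; rewrite -Pc => /PA; rewrite Pc ltnn.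
have [I I0 cE] := cI_of_steps cm cS.
have P00 : P 0%N 0%N by apply/PW; rewrite um1.
exists I.
  split=> // eI; move: P00; rewrite Pc cE (@cI_large _ 0%N) // => n.
  by rewrite eI inE.
have PE : [set t | W (um t)] = [set t | (t.2 < cI I t.1)%N].
  apply/seteqP; split=> -[n j] /=; rewrite -cE -Pc; [exact: (PW n j).2 | exact: (PW n j).1].
rewrite -PE -(monomial_span_aug (um1 K)); last by rewrite /= um1.
rewrite -(monomial_subspace (@um_expand K) sW); last exact: ub_tangent_monomial.
by apply/seteqP; split=> x /(unitizeP Lt).
Qed.

End Support.

Lemma cI_anti I k n : (k <= n)%N -> (cI I n <= cI I k)%N.
Proof.
move=> /subnKC <-; elim: (n - k)%N => [|m IH]; first by rewrite addn0.
by rewrite addnS; apply: leq_trans IH; rewrite (cI_split I (k + m)) leq_addl.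
Qed.

(** The staircase of I, the exponent (0, 0) of the unit included. *)
Definition ustair I : set (nat * nat) := [set t | (t.2 < cI I t.1)%N].

Lemma LI_aug I : LI K I = aug_monomial_span um (ustair I).
Proof.
have sub := lspan_subspace; apply/seteqP; split; apply: lspan_min; try exact: sub.
  move=> _ [i [j [ij jc ->]]]; apply: sub_lspan; exists (i, j) => //.
  have -> : UX K ^+ i * UH K ^+ j = um (i, j) by rewrite [RHS]umE.
  by rewrite cou_um; case: eqP => // _; rewrite scale0r subr0.
move=> _ [[i j] ij ->]; rewrite cou_um.
have [->|ne] := eqVneq (i, j) (0, 0)%N; first by rewrite um1 scale1r subrr; exact: (sub _ _ _).1.
rewrite scale0r subr0; apply: sub_lspan; exists i, j; split=> //; first exact/eqP.
by rewrite [LHS]umE.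
Qed.

(** Steps of height at most one make the staircase stable under ad_X, which
    passes from (n, m) to the (n+1, j) with j < m. *)
Lemma LI_tangent I : posfin I -> is_tangent (LI K I).
Proof.
move=> Ip; have c0 := cI0_gt0 Ip.
have sW : is_subspace (monomial_span um (ustair I)) by exact: lspan_subspace.
have antM (a b : U) : ant (a * b) = ant b * ant a by exact: Ub_antM.
have mem t : ustair I t -> monomial_span um (ustair I) (um t) by move=> It; apply: sub_lspan; exists t.
rewrite LI_aug -(monomial_span_aug (um1 K)) //; apply: coideal_tangent => //.
- by rewrite -um1; apply: mem.
- move=> h; move: h; apply: (@Ub_gen_ind K).
  + by move=> x; rewrite adl1.
  + by move=> c a b ha hb x Wx; rewrite ((adl_is_bilinear _).1 x); apply: sW.2; [exact: ha | exact: hb].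
  + by move=> a b ha hb x Wx; rewrite (adlM antM); exact/ha/hb.
  move=> a ga x; move: x; apply: lspan_min.
    by have h := preim_subspace ((adl_is_bilinear U).2 a) sW.
  move=> _ [[n m] /= nm ->]; case: ga => ->; last first.
    change (monomial_span um (ustair I) (adl H (um (n, m)))).
    by rewrite adl_H; apply: (subspaceZ _ sW); apply: mem.
  change (monomial_span um (ustair I) (adl X (um (n, m)))).
  rewrite adl_X upolyE; apply: (subspace_sum sW) => j _ _; apply: (subspaceZ _ sW); apply: mem.
  rewrite /ustair /=; have jm : (j < m)%N.
    by apply: leq_trans (ltn_ord j) _; exact: size_shiftdiffX.
  apply: leq_trans jm _; move: nm; rewrite /ustair /= (cI_split I n).
  by case: (n.+1 \in I); rewrite ?add1n ?ltnS ?add0n // => /ltnW.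
- apply: lspan_min.
    by have h := preim_subspace (lin_linear (@cop _ U)) (lspan_subspace _); exact: h.
  move=> _ [[n m] nm ->]; change (tens_sub (monomial_span um (ustair I)) (cop (um (n, m)))).
  rewrite cop_um; apply: subspace_sum (lspan_subspace _) _ => i _ _.
  apply: subspace_sum (lspan_subspace _) _ => j _ _.
  apply: (subspaceZ _ (lspan_subspace _)); apply: sub_lspan.
  exists (um (i : nat, j : nat)), (um (n - i, m - j)%N); split=> //.
  apply: mem; rewrite /ustair /=; apply: leq_ltn_trans (leq_subr _ _) _.
  by apply: leq_trans nm _; apply: cI_anti; rewrite leq_subr.
Qed.

Lemma LI_dim I : posfin I -> has_dim (LI K I) (\sum_(n <- I) n)%N.-1.
Proof.
move=> Ip; have c0 := cI0_gt0 Ip; have [m Im] := fset_bound I.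
rewrite LI_aug -(size_stairs Im c0).
rewrite (eq_aug_monomial_span (um1 K) (Q := [set t | t \in stairs I m])) => [|[k j] kj].
  apply: (aug_monomial_dim (@uc_lin K) (@ucE K) (um1 K)); first exact: stairs_uniq.
  by rewrite mem_stairs.
by rewrite /ustair /= mem_stairs // kj.
Qed.

Lemma LI_inj I J : posfin I -> posfin J -> LI K I = LI K J -> I = J.
Proof.
have sub I' J' k j : posfin I' -> posfin J' -> LI K I' = LI K J' -> (j < cI I' k)%N -> (j < cI J' k)%N.
  move=> Ip Jp e jc; have [[-> ->]|ne] := eqVneq (k, j) (0, 0)%N; first exact: cI0_gt0.
  have : LI K I' (um (k, j)).
    apply: sub_lspan; exists k, j; split=> //; first exact/eqP.
    by rewrite [LHS]umE.
  rewrite e LI_aug -(monomial_span_aug (um1 K)); last exact: cI0_gt0.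
  move=> [Wk _]; have := monomial_span_coef (@uc_lin K) (@ucE K) (t := (k, j)) Wk.
  by rewrite ucE eqxx oner_eq0 => /(_ isT).
move=> Ip Jp e; apply: cI_inj; [by case: Ip | by case: Jp | move=> k].
apply/eqP; rewrite eqn_leq; apply/andP; split; rewrite leqNgt; apply/negP => h.
  by have := sub _ _ _ _ Ip Jp e h; rewrite ltnn.
by have := sub _ _ _ _ Jp Ip (esym e) h; rewrite ltnn.
Qed.

End ClassicalTangents.

(** * The classical pairing *)

Lemma lin_sclin (K : fieldType) (T : sctable K) (V W : lmodType K)
    (f : V -> scbase T -> W) (x : scalg T) :
  (forall a, is_linear (f^~ a)) -> is_linear (fun y => sclin (f y) x).
Proof.
move=> fl c y z; rewrite sclin.unlock /lext scaler_sumr -big_split; apply: eq_bigr => a _.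
by rewrite /= fl scalerDr !scalerA mulrC.
Qed.

Lemma Mset_gens (K : fieldType) (q : K) (q0 : q != 0) (I : {fset nat}) :
  Mset q0 I = lspan [set m | exists i s, m = bmon q0 1 0 ^+ i *
    (\prod_(n <- I | (i < n)%N) (1 - q ^ (1 - n%:Z) *: bmon q0 0 1)) * bmon q0 0 s].
Proof.
have hE c : horner_alg (bmon q0 0 1) (1 - c *: 'X) = 1 - c *: bmon q0 0 1.
  transitivity (bpoly q0 0 (1 - c *: 'X)); first by rewrite bpoly.unlock bmon1 mul1r.
  by rewrite linearB linearZ /= bpoly1 -['X]expr1 bpolyX bmon1.
congr lspan; apply/funext => m; rewrite /mkset; apply/propext.
split=> -[i [s ->]]; exists i, s; rewrite bpoly.unlock bmonX /setpoly rmorph_prod;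
  congr (_ * _ * _); apply: eq_bigr => n _;
  first [exact: hE | exact/esym/hE].
Qed.

Section ClassicalPairing.
Variable K : fieldType.
Hypothesis char0 : [pchar K] =i pred0.
Local Notation q1 := (oner_neq0 K).
Local Notation B := (CB K).
Local Notation U := (UB K).
Local Notation um := (@um K).
Local Notation bmon := (bmon q1).
Local Notation bpoly := (bpoly q1).

Lemma CU_pair_linl (y : B) : is_linear (fun x : U => CU_pair x y : K^o).
Proof. exact: sclin_is_linear. Qed.

Lemma CU_pair_linr (x : U) : is_linear (fun y : B => CU_pair x y : K^o).
Proof. by apply: lin_sclin => a; exact: sclin_is_linear. Qed.

Lemma CU_pair_mon n m r s :
  CU_pair (um (n, m)) (bmon r s) = (n == r)%:R * n`!%:R * s%:~R ^+ m.
Proof.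
pose F a : K^o := sclin (T := Bq_table q1) (fun b => CU_pair_basis K a b : K^o) (bmon r s).
exact: etrans (sclinE (T := Ub_table K) F (n, m)) (sclinE (T := Bq_table q1) _ (r, s)).
Qed.

Lemma CU_pair_upoly n P r s :
  CU_pair (upoly n P) (bmon r s) = (n == r)%:R * n`!%:R * P.[s%:~R].
Proof.
move: P; apply: (lin_poly_ext (V := K^o)) => [c x y|c x y|m].
- by rewrite linearP; exact: CU_pair_linl.
- by rewrite hornerD hornerZ mulrDr mulrCA.
by rewrite upolyX CU_pair_mon hornerXn.
Qed.

(** Multiplication by 1 - g is dual to the difference operator in H. *)
Lemma CU_pair_diff n P r c (s : int) :
  CU_pair (upoly n P) (bpoly r ((1 - 'X) ^+ c) * bmon 0 s) =
  (n == r)%:R * n`!%:R * (iter c (@shiftdiff K) P).[s%:~R].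
Proof.
elim: c s => [|c IH] s; first by rewrite expr0 bpoly1 bmonMg add0r CU_pair_upoly.
have -> : bpoly r ((1 - 'X) ^+ c.+1) * bmon 0 s =
    bpoly r ((1 - 'X) ^+ c) * bmon 0 s - bpoly r ((1 - 'X) ^+ c) * bmon 0 (1 + s).
  rewrite exprSr mulrBr mulr1 linearB mulrBl; congr (_ - _).
  by rewrite -['X in LHS]expr1 /= -bpoly_Mg -mulrA bmonMg.
rewrite (linBE _ _ (CU_pair_linr _)) !IH -mulrBr iterS /shiftdiff hornerD hornerN.
by rewrite horner_comp !hornerE [s%:~R + 1]addrC intrD.
Qed.

(** At q = 1 all factors coincide and only their number c_I(k) remains. *)
Lemma setpoly1 I k : setpoly (1 : K) I k = (1 - 'X) ^+ cI I k.
Proof.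
have [m Im] := fset_bound I.
move: k; apply: (@down_ind _ m) => [k mk|k IH].
  by rewrite (setpoly_large _ Im) // (cI_large Im).
rewrite (setpoly_split q1) cI_split IH invr1 expr1n scale1r exprD.
by case: (_ \in _); rewrite ?expr1 ?expr0.
Qed.

Lemma MI_Mset I : MI K I = Mset q1 I.
Proof.
rewrite /Mset; congr lspan; apply/funext => m; rewrite /mkset; apply/propext.
split=> -[i [s ->]]; exists i, s; rewrite bpoly.unlock setpoly1 rmorphXn rmorphB rmorph1 /= horner_algX;
  by rewrite -bmonX.
Qed.

Lemma CU_pair_MI I t m : (t.2 < cI I t.1)%N -> MI K I m -> CU_pair (um t) m = 0.
Proof.
case: t => n j /= jc; rewrite MI_Mset; move: m; apply: lspan_min.
  exact: preim_subspace (CU_pair_linr _) (subspace0 _).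
move=> _ [k [s ->]] /=; rewrite -upolyX setpoly1 CU_pair_diff.
have [<-|_] := eqVneq n k; last by rewrite !mul0r.
rewrite (_ : iter _ _ _ = 0) ?horner0 ?mulr0 //.
apply/eqP; rewrite -size_poly_eq0 (size_iter_shiftdiff char0) size_polyXn.
by rewrite subn_eq0.
Qed.

(** A vector x with components X^k r_k(H) annihilates M_I when the c_I(k)-th
    difference of each r_k vanishes at all natural numbers.  A polynomial with
    infinitely many zeros is 0, so this means that r_k has degree less than
    c_I(k). *)
Lemma LI_tangent_of I : posfin I -> LI K I = tangent_of CU_pair (MI K I).
Proof.
move=> Ip; rewrite LI_aug -(monomial_span_aug (um1 K)); last exact: cI0_gt0.
apply/seteqP; split=> x [Wx x0]; split=> //.
  move=> m Mm; move: x Wx {x0}; apply: lspan_min.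
    exact: preim_subspace (CU_pair_linl m) (subspace0 _).
  by move=> _ [t tI ->]; exact: CU_pair_MI tI Mm.
have [n [R xE]] := upoly_expand x.
have sW : is_subspace (monomial_span um (ustair I)) by exact: lspan_subspace.
rewrite xE; apply: (subspace_sum sW) => k _ _; rewrite upolyE.
apply: (subspace_sum sW) => j _ _; apply: (subspaceZ _ sW); apply: sub_lspan.
exists (k : nat, j : nat) => //; rewrite /ustair /=; apply: leq_trans (ltn_ord j) _.
rewrite -subn_eq0 -(size_iter_shiftdiff char0) size_poly_eq0; apply/eqP/(poly_nat_roots char0) => s.
have : MI K I (bpoly k ((1 - 'X) ^+ cI I k) * bmon 0 s%:Z).
  by rewrite MI_Mset -setpoly1; apply: Mgr_in.
move=> /x0; rewrite xE (lin_sumE _ _ _ (CU_pair_linl _)) (bigD1 k) //= big1 => [|i ik].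
  rewrite CU_pair_diff eqxx mul1r addr0 => /eqP; rewrite mulf_eq0 (natrK_eq0 char0).
  by rewrite (gtn_eqF (fact_gt0 k)) => /eqP.
by rewrite CU_pair_diff (negbTE (ik : i != k :> nat)) !mul0r.
Qed.

Lemma gauss_bin n k : gauss (1 : K) n k = 'C(n, k)%:R.
Proof.
elim: n k => [|n IH] [|k]; rewrite ?gauss0 ?bin0 //.
by rewrite gaussS !IH expr1n mul1r binS natrD.
Qed.

Lemma partial_is_linear (x : U) : is_linear (partial CU_pair x : B -> B).
Proof. by have h := CU_pair_linr x; rewrite /partial; lin. Qed.

Lemma partial_mon x r s : partial CU_pair x (bmon r s) =
  \sum_(j < r.+1) ('C(r, j)%:R * CU_pair x (bmon (r - j) (j%:Z + s))) *: bmon j s.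
Proof.
have h := CU_pair_linr x.
have bl : is_bilinear (fun a1 a2 : B => CU_pair x a1 *: a2) by lin.
rewrite /partial cop_bmon (lin_sumE _ _ _ (tlift_is_linear bl)); apply: eq_bigr => j _.
by rewrite (linZE _ _ (tlift_is_linear bl)) tlift_tens // scalerA invr1 gauss_bin.
Qed.

Lemma ddX_is_linear : is_linear (@ddX K). Proof. exact: sclin_is_linear. Qed.
Lemma ddg_is_linear : is_linear (@ddg K). Proof. exact: sclin_is_linear. Qed.

Lemma ddX_mon r s : ddX (bmon r s) = r%:R *: bmon r.-1 s.
Proof. exact: (sclinE (T := Bq_table q1)). Qed.

Lemma ddg_mon r s : ddg (bmon r s) = s%:~R *: bmon r (s - 1).
Proof. exact: (sclinE (T := Bq_table q1)). Qed.

Lemma iter_ddX_mon i r s : iter i (@ddX K) (bmon r s) = (r ^_ i)%:R *: bmon (r - i) s.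
Proof.
elim: i => [|i IH]; first by rewrite ffactn0 scale1r subn0.
rewrite iterS IH (linZE _ _ ddX_is_linear) ddX_mon scalerA -natrM ffactnSr.
by rewrite subnS.
Qed.

(** In the coproduct of X^r g^s the term with X^i in its first factor has the
    coefficient binomial(r, i), and the pairing gives i!; the product is the
    falling factorial. *)
Lemma partial_X i f : partial CU_pair (um (i, 0)%N) f = iter i (@ddX K) f.
Proof.
have il : is_linear (iter i (@ddX K)).
  elim: i => [|i IH] //; move=> c x y; rewrite !iterS IH; exact: ddX_is_linear.
move: f; apply: (bmon_ext (partial_is_linear _) il) => r s.
rewrite partial_mon iter_ddX_mon.
have t (j : 'I_r.+1) : ('C(r, j)%:R * CU_pair (um (i, 0)%N) (bmon (r - j) (j%:Z + s))) *: bmon j s =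
    if (j : nat) == (r - i)%N then (r ^_ i)%:R *: bmon (r - i) s else 0.
  rewrite CU_pair_mon expr0 mulr1; have jr : (j <= r)%N by rewrite -ltnS.
  have [->|ne] := eqVneq (j : nat) (r - i)%N.
    have [ir|ri] := leqP i r.
      by rewrite subKn // eqxx mul1r -natrM bin_sub // bin_ffact.
    have -> : (r - i = 0)%N by lia.
    by rewrite ffact_small // subn0 (gtn_eqF ri) mul0r mulr0 scale0r.
  rewrite (_ : (i == r - j)%N = false) ?mul0r ?mulr0 ?scale0r //.
  by apply: contraNF ne => /eqP ->; rewrite subKn.
under eq_bigr => j _ do rewrite t.
have ri : (r - i < r.+1)%N by rewrite ltnS leq_subr.
rewrite (bigD1 (Ordinal ri)) //= eqxx big1 ?addr0 // => j jr.
by rewrite (negbTE (jr : (j != r - i :> nat)%N)).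
Qed.

Lemma partial_H f : partial CU_pair (um (0, 1)%N) f = CX * ddX f + Cg 1 * ddg f.
Proof.
have l1 := ddX_is_linear; have l2 := ddg_is_linear.
have l : is_linear (fun f : B => CX * ddX f + Cg 1 * ddg f : B).
  exact: lin_add (lin_mulr _ l1) (lin_mulr _ l2).
move: f; apply: (bmon_ext (partial_is_linear _) l) => r s.
rewrite partial_mon ddX_mon ddg_mon big_ord_recr /= big1 => [|j _]; last first.
  by rewrite CU_pair_mon (ltn_eqF (_ : 0 < r - j)%N) ?mul0r ?mulr0 ?scale0r // subn_gt0.
rewrite add0r binn mul1r subnn CU_pair_mon eqxx fact0 !mul1r expr1.
rewrite -!scalerAr -/(bmon 1 0) -/(bmon 0 1) bmonXM bmon_gM exp1rz scale1r subrKC.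
rewrite add1n intrD [LHS]scalerDl.
by have -> : r%:R *: bmon r.-1.+1 s = r%:R *: bmon r s by case: r => [|r]; rewrite ?scale0r.
Qed.

End ClassicalPairing.

(** * Relations in a calculus *)

Section CalculusRelations.
Variables (K : fieldType) (A : hopfAlg K) (M : set A).
Hypothesis Mx : is_crossed M.
Local Notation pt := (@aug_class K A M).
Local Notation G := (calc_of M).

Let sM : is_subspace M. Proof. by case: Mx. Qed.

Lemma aug_class_eq a b : cou a = cou b -> M (a - b) -> pt a = pt b.
Proof.
move=> e Mab; apply/eqP; rewrite -subr_eq0 -linearB; apply/eqP/aug_class_eq0 => //.
by rewrite linearB /= e subrr scale0r subr0.
Qed.

Lemma dd_grouplike g : cop g = g (x) g -> dd G g = ract (rinv (pt g)) g.
Proof.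
move=> cg; rewrite ddE // cg tlift_tens; last by lin.
by rewrite /rinv ract_tens mul1r.
Qed.

Lemma dd_skew X g : cop X = X (x) 1 + g (x) X ->
  dd G X = rinv (pt X) + ract (rinv (pt g)) X.
Proof.
move=> cX; rewrite ddE // cX tliftD; last by lin.
by rewrite !tlift_tens ?/rinv ?ract_tens ?mul1r //; lin.
Qed.

Lemma rcomm_grouplike g a : cop g = g (x) g -> cou g = 1 -> cou a = 0 ->
  M (g * a - a) -> rcomm g (rinv (pt a)) = 0.
Proof.
move=> cg g1 a0 Mga; rewrite /rcomm /rinv lact_class // cg tlift_tens; last by lin.
rewrite mulr1 ract_tens mul1r (@aug_class_eq (g * a) a) ?subrr //.
by rewrite couM a0 mulr0.
Qed.

Lemma rcomm_skew X g a : cop X = X (x) 1 + g (x) X -> cou g = 1 -> cou a = 0 ->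
  M (g * a - a) -> rcomm X (rinv (pt a)) = rinv (pt (X * a)).
Proof.
move=> cX g1 a0 Mga; rewrite /rcomm /rinv lact_class // cX tliftD; last by lin.
rewrite !tlift_tens; [|lin..]; rewrite !mulr1 ract_tens !mul1r.
rewrite (@aug_class_eq (g * a) a) ?addrK //; first by rewrite couM a0 mulr0.
Qed.

End CalculusRelations.

(** * Quotient calculi and coirreducibility *)
Section QuotientMap.
Variables (K : fieldType) (A : hopfAlg K) (M M' : set A).
Hypotheses (Mx : is_crossed M) (Mx' : is_crossed M') (MM' : M `<=` M').
Local Notation pt := (@aug_class K A M).
Local Notation pt' := (@aug_class K A M').

Let sM : is_subspace M. Proof. by case: Mx. Qed.
Let sM' : is_subspace M'. Proof. by case: Mx'. Qed.

(** The projection of the calculus of M onto that of a larger M'. *)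
Definition calc_proj (w : forms (calc_of M)) : forms (calc_of M') :=
  tlift (fun v b => aug_lift pt' v (x) b) w.

Let lift_lin : is_linear (aug_lift (M := M) pt').
Proof.
apply: (aug_lift_is_linear sM (@aug_class_is_linear _ _ M') (aug_class1 sM')).
move=> m Mm; apply/aug_class_eq0 => //; have [_ h _ _] := Mx.
by rewrite (h _ Mm) scale0r subr0; apply: MM'.
Qed.

Let liftE a : aug_lift pt' (pt a) = pt' a.
Proof.
apply: (aug_liftE sM (@aug_class_is_linear _ _ M') (aug_class1 sM')).
move=> m Mm; apply/aug_class_eq0 => //; have [_ h _ _] := Mx.
by rewrite (h _ Mm) scale0r subr0; apply: MM'.
Qed.

Lemma calc_proj_is_linear : is_linear calc_proj.
Proof. by rewrite /calc_proj; lin. Qed.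

Lemma calc_projE a b : calc_proj (pt a (x) b) = pt' a (x) b.
Proof. by rewrite /calc_proj tlift_tens ?liftE //; lin. Qed.

Lemma calc_proj_quotient : calc_quotient_map calc_proj.
Proof.
have pl := calc_proj_is_linear.
have [l1 l2] := lact_is_bilinear Mx; have [l1' l2'] := lact_is_bilinear Mx'.
have [r1 r2] := ract_is_bilinear M; have [r1' r2'] := ract_is_bilinear M'.
split; first split=> //.
- move=> a w; move: w; apply: forms_ext; [lin | lin |] => x b x0.
  rewrite calc_projE !lact_class // (tlift_comp _ _ pl).
  by apply: eq_tlift => a1 a2; rewrite calc_projE.
- move=> a w; move: w; apply: forms_ext; [lin | lin |] => x b x0.
  by rewrite ract_tens !calc_projE ract_tens.
- move=> a; rewrite !ddE // (tlift_comp _ _ pl).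
  by apply: eq_tlift => a1 a2; rewrite calc_projE.
apply: tensor_ind.
  split; first by exists 0; exact: is_linear0.
  by move=> c x y [u <-] [v <-]; exists (c *: u + v); rewrite pl.
by move=> v b; exists (pt (aug_val (qrepr v)) (x) b); rewrite calc_projE aug_class_repr.
Qed.

End QuotientMap.

Section Coirreducible.
Variables (K : fieldType) (q : K) (q0 : q != 0).
Hypothesis qgen : forall n, (0 < n)%N -> q ^+ n != 1.
Local Notation B := (Bq q0).

Lemma root_setpoly_generic I : 0%N \notin I -> root (setpoly q I 0) 1 = (1%N \in I).
Proof.
move=> I0; rewrite root_setpoly; apply/hasP/idP => [[n nI /andP[n0]]|I1]; last first.
  by exists 1%N => //; rewrite subrr expr0z mulr1 eqxx.
rewrite mulr1 => /eqP e; suff -> : 1%N = n by [].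
apply/eqP; case: eqP => // n1.
have /negP[] : q ^ (1 - n%:Z) != 1 by apply: (qz_neq1 qgen); lia.
exact/eqP.
Qed.

(** For generic q the roots q^(n-1) of the factors are distinct, so the d_k tell
    which n belong to the set. *)
Lemma Mset_generic_sub I J : 0%N \notin I -> 0%N \notin J ->
  Mset q0 I `<=` Mset q0 J -> {subset J <= I}.
Proof.
move=> I0 J0 /Mset_sub h n nJ; have n0 : (0 < n)%N by case: n nJ J0 => [->|].
have : root (setpoly q I n.-1) (q ^ (n%:Z - 1)).
  apply: root_dvdp (h n.-1) _; rewrite root_setpoly; apply/hasP; exists n => //.
  by rewrite prednK // leqnn -expfzDr // (_ : 1 - n%:Z + (n%:Z - 1) = 0) ?expr0z ?eqxx //; lia.
rewrite root_setpoly => /hasP[m mI /andP[_ /eqP]]; rewrite -expfzDr // => e.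
suff -> : n = m by [].
apply/eqP; case: eqP => // nm.
have /negP[] : q ^ (1 - m%:Z + (n%:Z - 1)) != 1 by apply: (qz_neq1 qgen); lia.
exact/eqP.
Qed.

(** A quotient of the calculus of the set {1, n} belongs to a set between {1}
    and {1, n}. *)
Theorem Mset_coirreducible n : (2 <= n)%N ->
  coirreducible (calc_of (Mset q0 [fset 1%N; n]%fset)).
Proof.
move=> n2; set I := [fset 1%N; n]%fset.
have I0 : 0%N \notin I by rewrite !inE; lia.
have I1 : root (setpoly q I 0) 1 by rewrite root_setpoly_generic // !inE.
have Mx := Mset_crossed q0 I1; have [sM _ _ _] := Mx.
split; first exact: calc_of_bicovariant.
  exists (rinv (aug_class (Mset q0 I) (bmon q0 1 0))) => /tens1_inj/(aug_class_eq0 sM).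
  rewrite cou_bmon scale0r subr0 -bpoly1 => /(Mgr_bpoly (setpoly_root0 q I)).
  rewrite dvdp1 size_setpoly // => /eqP[]; have := cI_split I 1.
  suff : (0 < cI I 1)%N by lia.
  by rewrite cI_sum sum1_count -has_count; apply/hasP; exists n; rewrite ?inE ?eqxx ?orbT.
move=> G' f G'b fq; have Mx' := quot_submod_crossed Mx G'b fq.
have sub := quot_submod_sup Mx fq.
have fin := fincodim_sub sub (has_dim_fincodim sM (Mset_dim q0 I1)).
have [I' [I'0 e I'1]] := crossed_classification (qgen_sum qgen) Mx' fin.
rewrite root_setpoly_generic // in I'1.
have I'I : {subset I' <= I} by apply: Mset_generic_sub => //; rewrite -e.
have [nI'|nI'] := boolP (n \in I').
  right; apply: (quot_submod_inj Mx G'b fq); rewrite e.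
  by rewrite (_ : I' = I) //; apply/fsetP => m; apply/idP/idP => [/I'I//|]; rewrite !inE => /orP[] /eqP ->.
left; apply: (quot_submod_full G'b fq); rewrite e (_ : I' = [fset 1%N]%fset); last first.
  apply/fsetP => m; rewrite inE; apply/idP/eqP => [mI'|-> //].
  by have := I'I _ mI'; rewrite !inE => /orP[/eqP//|/eqP mn]; rewrite -mn mI' in nI'.
have r1 : root (setpoly q [fset 1%N]%fset 0) 1 by rewrite root_setpoly_generic ?inE.
have [b [_ gen]] := Mset_dim q0 r1; have sM1 := Mgr_sub q0 (setpoly q [fset 1%N]%fset).
move=> x x0; have : aug_class (Mset q0 [fset 1%N]%fset) x = 0.
  have [c [-> _]] := gen (aug_class _ x) Logic.I; rewrite big1 // => -[i il] _.
  by exfalso; move: il; rewrite big_seq_fset1.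
by move/(aug_class_eq0 sM1); rewrite x0 scale0r subr0.
Qed.

End Coirreducible.

(** * The calculi of {1, n} and {n} *)

(** Dual families on the two sides of a pairing of Hopf algebras. *)
Section DualFamilies.
Variables (K : fieldType) (H A : hopfAlg K) (pair : H -> A -> K^o) (M : set A).
Hypotheses (linl : forall y, is_linear (pair^~ y)) (linr : forall x, is_linear (pair x)).
Hypothesis sM : is_subspace M.
Variables (N : nat) (e : 'I_N -> A) (phi : 'I_N -> H).
Hypotheses (phi1 : forall i, pair (phi i) 1 = 0)
  (phiM : forall i m, M m -> pair (phi i) m = 0)
  (phie : forall i j, pair (phi i) (e j) = (i == j)%:R).
Local Notation pt := (@aug_class K A M).

Lemma qpair_is_linear i : is_linear (qpair (M := M) pair (phi i) : _ -> K^o).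
Proof. exact: (aug_lift_is_linear sM (linr _) (phi1 i) (phiM i)). Qed.

Lemma qpairE i a : qpair (M := M) pair (phi i) (pt a) = pair (phi i) a.
Proof. exact: (aug_liftE sM (linr _) (phi1 i) (phiM i)). Qed.

Lemma dual_basis_quot : has_dim [set: aug_quot M] N -> is_basis [set: aug_quot M] (pt \o e).
Proof.
move=> dN; apply: dim_basis => // c c0 i.
have := congr1 (qpair (M := M) pair (phi i)) c0.
rewrite (lin_sumE _ _ _ (qpair_is_linear i)) (is_linear0 (qpair_is_linear i)).
rewrite (bigD1 i) //= (linZE _ _ (qpair_is_linear i)) qpairE phie eqxx big1 => [|j ji].
  by rewrite addr0 => <-; rewrite -[LHS]mulr1.
by rewrite (linZE _ _ (qpair_is_linear i)) qpairE phie eq_sym (negPf ji) scaler0.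
Qed.

Lemma dual_basis_tangent (L : set H) : is_subspace L -> has_dim L N ->
  (forall i, L (phi i)) -> is_basis L phi.
Proof.
move=> [L0 _] dN Lphi; apply: dim_basis => // c c0 j.
have := congr1 (pair^~ (e j)) c0.
rewrite (lin_sumE _ _ _ (linl _)) (is_linear0 (linl _)).
rewrite (bigD1 j) //= (linZE _ _ (linl _)) phie eqxx big1 => [|i ij].
  by rewrite addr0 => <-; rewrite -[LHS]mulr1.
by rewrite (linZE _ _ (linl _)) phie (negPf ij) scaler0.
Qed.

Lemma dual_family_tensor_free (b : 'I_N -> A) :
  \sum_(i < N) (pt (e i) (x) b i : tensor (aug_quot M) A) = 0 -> forall i, b i = 0.
Proof.
move=> b0 i; pose F (v : aug_quot M) (c : A) : A := (qpair pair (phi i) v : K^o) *: c.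
have Fb : is_bilinear F by have h := qpair_is_linear i; rewrite /F; lin.
have := congr1 (tlift F) b0.
rewrite (lin_sumE _ _ _ (tlift_is_linear Fb)) (is_linear0 (tlift_is_linear Fb)).
rewrite (bigD1 i) //= tlift_tens // /F qpairE phie eqxx scale1r big1 ?addr0 // => j ji.
by rewrite tlift_tens // qpairE phie eq_sym (negPf ji) scale0r.
Qed.

End DualFamilies.

(** Elements of U (x) A have coordinates in A with respect to a basis of U. *)
Lemma tensor_basis_expand (K : fieldType) (U : lmodType K) (A : algType K) N (e : 'I_N -> U) :
  is_basis [set: U] e -> forall w : tensor U A,
  exists b : 'I_N -> A, w = \sum_(i < N) e i (x) b i.
Proof.
move=> [_ gen]; apply: tensor_ind.
  split; first by exists (fun=> 0); rewrite big1 // => i _; exact: (is_linear0 ((tens_is_bilinear U A).2 _)).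
  move=> c x y [b ->] [b' ->]; exists (fun i => c *: b i + b' i).
  by rewrite scaler_sumr -big_split; apply: eq_bigr => i _; rewrite tensDr.
move=> u a; have [c [-> _]] := gen u Logic.I; exists (fun i => c i *: a).
have l : is_linear (fun u : U => u (x) a) by lin.
rewrite (lin_sumE _ _ _ l); apply: eq_bigr => i _.
by rewrite tensZl tensZr.
Qed.

Section ClassicalExamples.
Variable K : fieldType.
Hypothesis char0 : [pchar K] =i pred0.
Local Notation q1 := (oner_neq0 K).
Local Notation B := (CB K).
Local Notation U := (UB K).
Local Notation um := (@um K).
Local Notation bmon := (bmon q1).
Local Notation bpoly := (bpoly q1).

Lemma CB_copX : cop (CX : B) = CX (x) 1 + Cg 1 (x) CX. Proof. exact: Bq_copX. Qed.
Lemma CB_copg s : cop (Cg s : B) = Cg s (x) Cg s. Proof. exact: Bq_copg. Qed.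

Lemma MI_root I : posfin I -> root (setpoly (1 : K) I 0) 1.
Proof.
move=> /cI0_gt0 c0; rewrite setpoly1 rootE horner_exp hornerD hornerN hornerX hornerC.
by rewrite subrr expr0n gtn_eqF.
Qed.

Lemma MI_crossed I : posfin I -> is_crossed (MI K I).
Proof. by move=> Ip; rewrite MI_Mset; apply/Mset_crossed/MI_root. Qed.

Lemma MI_dim I : posfin I -> has_dim [set: aug_quot (MI K I)] (\sum_(n <- I) n)%N.-1.
Proof. by move=> Ip; rewrite MI_Mset; apply/Mset_dim/MI_root. Qed.

Lemma MI_bpoly I k r : (1 - 'X) ^+ cI I k %| r -> MI K I (bpoly k r).
Proof. by rewrite MI_Mset -setpoly1; apply: Mgr_in0. Qed.

(** Representatives of the forms eta_i, and the dual vectors phi_i.  The form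
    eta_0 is the class of g - 1, for which g is as good since the class of 1
    is zero. *)
Definition form_rep (i : nat) : B := if i is 0%N then Cg 1 else bmon i 0.
Definition dual_vec (i : nat) : U :=
  if i is 0%N then um (0, 1)%N else (i`!%:R)^-1 *: um (i, 0)%N.

Lemma dual_vec1 i : CU_pair (dual_vec i) 1 = 0.
Proof.
case: i => [|i] /=; first by rewrite -(bmon1 q1) CU_pair_mon /= expr1 mulr0.
by rewrite (linZE _ _ (CU_pair_linl _)) -(bmon1 q1) CU_pair_mon !mul0r scaler0.
Qed.

Lemma dual_vec_form i j : CU_pair (dual_vec i) (form_rep j) = (i == j)%:R.
Proof.
case: i j => [|i] [|j] /=; rewrite ?(linZE _ _ (CU_pair_linl _)) CU_pair_mon.
- by rewrite eqxx fact0 !mul1r expr1.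
- by rewrite !mul0r.
- by rewrite !mul0r scaler0.
have [_|_] := eqVneq i.+1 j.+1; last by rewrite !mul0r scaler0.
rewrite mul1r expr0 mulr1 [LHS]mulVf // (natrK_eq0 char0).
by rewrite (gtn_eqF (fact_gt0 _)).
Qed.

Lemma dual_vec_LI I i : posfin I -> ((i == 0%N) < cI I i)%N -> LI K I (dual_vec i).
Proof.
move=> Ip; rewrite (LI_tangent_of char0 Ip); case: i => [|i] ic; split=> /=.
- by rewrite cou_um.
- by move=> m; exact: (CU_pair_MI char0 (t := (0, 1)%N)).
- by rewrite linearZ /= cou_um scaler0.
move=> m Mm; rewrite (linZE _ _ (CU_pair_linl _)).
by rewrite (CU_pair_MI char0 (t := (i.+1, 0)%N) ic Mm) scaler0.
Qed.

Lemma dual_vec_MI I i m : posfin I -> ((i == 0%N) < cI I i)%N -> MI K I m ->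
  CU_pair (dual_vec i) m = 0.
Proof.
by move=> Ip ic; have := dual_vec_LI Ip ic; rewrite (LI_tangent_of char0 Ip) => -[_]; apply.
Qed.

Lemma partial_dual_vec i f : (0 < i)%N ->
  partial CU_pair (dual_vec i) f = (i`!%:R)^-1 *: iter i (@ddX K) f.
Proof.
case: i => [//|i] _; rewrite -partial_X /partial /=.
rewrite (tlift_comp _ _ (h := fun a : B => (i.+1`!%:R)^-1 *: a)) => [|c x y].
  by apply: eq_tlift => a1 a2; rewrite (linZE _ _ (CU_pair_linl _)) -scalerA.
by rewrite scalerDr !scalerA mulrC.
Qed.

(** The calculi of {1, n} and of {n} share their relations: in degree k > 0
    both M have the component X^k (1 - g) k[g, g^-1] for k < n and all of
    X^k k[g, g^-1] from k = n on. *)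
Section ClassicalRelations.
Variables (I : {fset nat}) (n : nat).
Hypotheses (Ip : posfin I) (n2 : (1 < n)%N) (I0 : (cI I 0 <= 2)%N)
  (Ik : forall k, (0 < k)%N -> cI I k = (k < n)%N).
Local Notation M := (MI K I).
Local Notation pt := (@aug_class K B M).
Local Notation G := (GammaI K I).

Let Mx : is_crossed M := MI_crossed Ip.
Let sM : is_subspace M. Proof. by case: Mx. Qed.

Let coug (s : int) : cou (Cg s : B) = 1. Proof. exact: cou_bmon. Qed.

Lemma g_sub1 k : bmon k 1 - bmon k 0 = bpoly k ('X - 1).
Proof. by rewrite linearB /= bpoly1 -['X]expr1 bpolyX. Qed.

Lemma dvd_subX (d : nat) (r : {poly K}) : ('X - 1) ^+ d %| r -> (1 - 'X) ^+ d %| r.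
Proof. by rewrite -opprB -scaleN1r exprZn dvdpZl // expf_neq0 // oppr_eq0 oner_eq0. Qed.

Lemma aug_class_g : pt (Cg 1) = pt (bpoly 0 ('X - 1)).
Proof.
rewrite -g_sub1 bmon1 (linBE _ _ (@aug_class_is_linear _ _ M)).
by rewrite (aug_class1 sM) subr0.
Qed.

Lemma form_rep_g i : rcomm (Cg 1) (rinv (pt (form_rep i)) : forms G) = 0.
Proof.
case: i => [|i] /=; [rewrite aug_class_g|];
  apply: (rcomm_grouplike Mx (CB_copg 1) (coug 1)).
- by rewrite cou_bpoly eqxx mul1r !hornerE subrr.
- rewrite -/(bmon 0 1) (bmon_g_bpoly _ 1) invr1 expr1n scale1r -linearB expr1 -{2}['X - 1]mul1r.
  by rewrite -mulrBl; apply/MI_bpoly/dvd_subX; apply: dvdp_exp2l (I0).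
- exact: cou_bmon.
rewrite -/(bmon 0 1) bmon_gM exp1rz scale1r addr0 g_sub1; apply/MI_bpoly/dvd_subX.
by rewrite Ik //; case: (_ < n)%N; rewrite ?expr0 ?dvd1p.
Qed.

Lemma form_rep_X0 : rcomm CX (rinv (pt (form_rep 0)) : forms G) = 0.
Proof.
rewrite /= aug_class_g (rcomm_skew Mx CB_copX (coug 1)); first last.
- rewrite -/(bmon 0 1) (bmon_g_bpoly _ 1) invr1 expr1n scale1r -linearB expr1 -{2}['X - 1]mul1r.
  by rewrite -mulrBl; apply/MI_bpoly/dvd_subX; apply: dvdp_exp2l (I0).
- by rewrite cou_bpoly eqxx mul1r !hornerE subrr.
rewrite -/(bmon 1 0) bmonX_bpoly addn0 (_ : pt _ = 0) ?/rinv ?(is_linear0 ((tens_is_bilinear _ _).1 _)) //.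
apply/(aug_class_eq0 sM); rewrite cou_bpoly mul0r scale0r subr0.
by apply/MI_bpoly/dvd_subX; rewrite Ik // n2 expr1.
Qed.

Lemma form_rep_X i : (0 < i)%N ->
  rcomm CX (rinv (pt (form_rep i)) : forms G) = rinv (pt (form_rep i.+1)).
Proof.
case: i => // i _ /=; rewrite (rcomm_skew Mx CB_copX (coug 1)).
- by rewrite -/(bmon 1 0) bmonXM.
- exact: cou_bmon.
rewrite -/(bmon 0 1) bmon_gM exp1rz scale1r addr0 g_sub1; apply/MI_bpoly/dvd_subX.
by rewrite Ik //; case: (_ < n)%N; rewrite ?expr0 ?dvd1p.
Qed.

Lemma form_rep_n : pt (form_rep n) = 0.
Proof.
case: n n2 Ik => // m _ Im; apply/(aug_class_eq0 sM).
rewrite /= cou_bmon scale0r subr0 -bpoly1; apply: MI_bpoly.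
by rewrite Im // ltnn expr0 dvd1p.
Qed.

Lemma form_rep_dX : dd G CX = rinv (pt (form_rep 1)) + ract (rinv (pt (form_rep 0))) CX.
Proof. exact: (dd_skew Mx CB_copX). Qed.

Lemma form_rep_dg : dd G (Cg 1) = ract (rinv (pt (form_rep 0))) (Cg 1).
Proof. exact: (dd_grouplike Mx (CB_copg 1)). Qed.

Lemma form_rep_0 : cI I 0 = 1%N -> pt (form_rep 0) = 0.
Proof.
move=> c1; rewrite /= aug_class_g; apply/(aug_class_eq0 sM).
rewrite cou_bpoly eqxx mul1r !hornerE subrr scale0r subr0.
by apply/MI_bpoly/dvd_subX; rewrite c1 expr1.
Qed.

End ClassicalRelations.
End ClassicalExamples.

Lemma sum_fset2 n (F : nat -> nat) : (1 < n)%N ->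
  (\sum_(m <- [fset 1%N; n]%fset) F m = F 1 + F n)%N.
Proof. by move=> n2; rewrite big_fsetU1 ?big_seq_fset1 // inE; lia. Qed.

Lemma cI_fset2 n k : (1 < n)%N -> cI [fset 1%N; n]%fset k = ((k < 1) + (k < n))%N.
Proof.
by move=> n2; rewrite cI_sum big_mkcond sum_fset2 //; case: (k < 1)%N; case: (k < n)%N.
Qed.

Lemma cI_fset1 n k : cI [fset n]%fset k = (k < n)%N.
Proof. by rewrite cI_sum big_mkcond big_seq_fset1; case: (k < n)%N. Qed.

Lemma posfin_fset2 n : (1 < n)%N -> posfin [fset 1%N; n]%fset.
Proof.
move=> n2; split; first by rewrite !inE; lia.
by apply/eqP/fset0Pn; exists n; rewrite !inE eqxx orbT.
Qed.

Lemma posfin_fset1 n : (1 < n)%N -> posfin [fset n]%fset.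
Proof.
move=> n2; split; first by rewrite !inE; lia.
by apply/eqP/fset0Pn; exists n; rewrite !inE.
Qed.

Section Examples.
Variable K : fieldType.
Hypothesis char0 : [pchar K] =i pred0.
Variable n : nat.
Hypothesis n2 : (1 < n)%N.
Local Notation B := (CB K).
Local Notation I2 := [fset 1%N; n]%fset.
Local Notation I1 := [fset n]%fset.
Local Notation M2 := (MI K I2).
Local Notation M1 := (MI K I1).
Local Notation pt2 := (@aug_class K B M2).
Local Notation pt1 := (@aug_class K B M1).
Local Notation e := (@form_rep K).
Local Notation phi := (@dual_vec K).

Let p2 := posfin_fset2 n2.
Let p1 := posfin_fset1 n2.
Let x2 := MI_crossed K p2.
Let x1 := MI_crossed K p1.
Let s2 : is_subspace M2. Proof. by case: x2. Qed.
Let s1 : is_subspace M1. Proof. by case: x1. Qed.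

Let c2 k : (0 < k)%N -> cI I2 k = (k < n)%N.
Proof. by move=> k0; rewrite cI_fset2 // ltnNge k0. Qed.
Let c1 k : (0 < k)%N -> cI I1 k = (k < n)%N.
Proof. by move=> _; rewrite cI_fset1. Qed.
Let c20 : (cI I2 0 <= 2)%N. Proof. by rewrite cI_fset2 // (ltnW n2). Qed.
Let c10 : (cI I1 0 <= 2)%N. Proof. by rewrite cI_fset1; case: (_ < _)%N. Qed.
Let c1E : cI I1 0 = 1%N. Proof. by rewrite cI_fset1 (ltnW n2). Qed.

Let d2 : has_dim [set: aug_quot M2] n.
Proof. by have := MI_dim K p2; rewrite sum_fset2 // add1n. Qed.
Let d1 : has_dim [set: aug_quot M1] n.-1.
Proof. by have := MI_dim K p1; rewrite big_seq_fset1. Qed.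
Let l2 : has_dim (LI K I2) n.
Proof. by have := LI_dim K p2; rewrite sum_fset2 // add1n. Qed.
Let l1 : has_dim (LI K I1) n.-1.
Proof. by have := LI_dim K p1; rewrite big_seq_fset1. Qed.

Let i2 i : (i < n)%N -> ((i == 0%N) < cI I2 i)%N.
Proof. by move=> il; rewrite cI_fset2 // il; case: i il. Qed.
Let i1 i : (0 < i < n)%N -> ((i == 0%N) < cI I1 i)%N.
Proof. by case: i => // i /andP[_ il]; rewrite cI_fset1 il. Qed.

Let phi1 i : CU_pair (phi i) 1 = 0 := dual_vec1 K i.
Let phi2M i m : (i < n)%N -> M2 m -> CU_pair (phi i) m = 0.
Proof. by move=> il; apply: dual_vec_MI char0 _ _ _ p2 (i2 il). Qed.
Let phi1M i m : (0 < i < n)%N -> M1 m -> CU_pair (phi i) m = 0.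
Proof. by move=> il; apply: dual_vec_MI char0 _ _ _ p1 (i1 il). Qed.

Let sh (i : 'I_n.-1) : (0 < i.+1 < n)%N.
Proof. by case: i => i /=; case: n => //=. Qed.

Let phie (i j : 'I_n) : CU_pair (phi i) (e j) = (i == j)%:R := dual_vec_form char0 i j.
Let phie' (i j : 'I_n.-1) : CU_pair (phi i.+1) (e j.+1) = (i == j)%:R.
Proof. exact: dual_vec_form. Qed.

Lemma form_basis2 : is_basis [set: aug_quot M2] (fun i : 'I_n => pt2 (e i)).
Proof.
exact: (dual_basis_quot (@CU_pair_linr K) s2 (fun i : 'I_n => phi1 i)
  (fun (i : 'I_n) m => @phi2M i m (ltn_ord i)) phie d2).
Qed.

Lemma form_basis1 : is_basis [set: aug_quot M1] (fun i : 'I_n.-1 => pt1 (e i.+1)).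
Proof.
exact: (dual_basis_quot (@CU_pair_linr K) s1 (fun i : 'I_n.-1 => phi1 i.+1)
  (fun (i : 'I_n.-1) m => @phi1M i.+1 m (sh i)) phie' d1).
Qed.

Lemma dual_basis2 : is_basis (LI K I2) (fun i : 'I_n => phi i).
Proof.
apply: (dual_basis_tangent (@CU_pair_linl K) phie (lspan_subspace _) l2) => i.
by apply: dual_vec_LI => //; exact: i2.
Qed.

Lemma dual_basis1 : is_basis (LI K I1) (fun i : 'I_n.-1 => phi i.+1).
Proof.
apply: (dual_basis_tangent (@CU_pair_linl K) phie' (lspan_subspace _) l1) => i.
by apply: dual_vec_LI => //; exact: (i1 (sh i)).
Qed.

Lemma dual_qpair2 i j : (i < n)%N -> qpair CU_pair (phi i) (pt2 (e j)) = (i == j)%:R.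
Proof.
move=> il; rewrite -(dual_vec_form char0).
exact: (aug_liftE s2 (CU_pair_linr _) (phi1 i) (fun m => @phi2M i m il)).
Qed.

Lemma dual_qpair1 i j : (0 < i < n)%N -> qpair CU_pair (phi i) (pt1 (e j)) = (i == j)%:R.
Proof.
move=> il; rewrite -(dual_vec_form char0).
exact: (aug_liftE s1 (CU_pair_linr _) (phi1 i) (fun m => @phi1M i m il)).
Qed.

Lemma MI_fset_sub : M2 `<=` M1.
Proof.
rewrite !MI_Mset; apply: lspan_min; first exact: Mgr_sub.
move=> _ [i [s ->]]; apply: Mgr_in; rewrite !setpoly1; apply: dvdp_exp2l.
by rewrite cI_fset1 cI_fset2 // leq_addl.
Qed.

Local Notation p := (@calc_proj K B M2 M1).

Lemma form_proj i : p (rinv (pt2 (e i))) = rinv (pt1 (e i)).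
Proof. exact: (calc_projE x2 x1 MI_fset_sub). Qed.

Let pl : is_linear p := calc_proj_is_linear x2 x1 MI_fset_sub.

Let e0 : pt1 (e 0) = 0 := form_rep_0 K p1 c1E.

(** A form is a sum of eta_i b_i; in its projection the term of eta_0 is lost,
    and phi_1, ..., phi_(n-1) separate the other coefficients. *)
Lemma form_proj_ker w : p w = 0 <-> exists a, w = ract (rinv (pt2 (e 0))) a.
Proof.
split=> [|[a ->]]; last first.
  rewrite /rinv ract_tens mul1r (calc_projE x2 x1 MI_fset_sub) e0.
  exact: (is_linear0 ((tens_is_bilinear _ _).1 _)).
have [b ->] := tensor_basis_expand form_basis2 w.
rewrite (lin_sumE _ _ _ pl) => pw.
have n0 : (0 < n)%N := ltnW n2.
pose o0 := Ordinal n0; exists (b o0).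
rewrite (bigD1 o0) // big1 => [|i i0]; first by rewrite [LHS]addr0 /rinv ract_tens mul1r.
suff -> : b i = 0 by exact: (is_linear0 ((tens_is_bilinear _ _).2 _)).
have nE : n.-1.+1 = n by rewrite prednK.
pose b' (j : 'I_n.-1) := b (cast_ord nE (lift ord0 j)).
have b0 : \sum_(j < n.-1) (pt1 (e j.+1) (x) b' j : tensor (aug_quot M1) B) = 0.
  rewrite -[RHS]pw.
  rewrite (reindex (cast_ord nE)) /=; last by exists (cast_ord (esym nE)) => j _; rewrite ?cast_ordK ?cast_ordKV.
  rewrite big_ord_recl (calc_projE x2 x1 MI_fset_sub) [pt1 _]e0.
  rewrite (is_linear0 ((tens_is_bilinear _ _).1 _)) add0r; apply: eq_bigr => j _.
  by rewrite (calc_projE x2 x1 MI_fset_sub).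
have b'0 := dual_family_tensor_free (@CU_pair_linr K) s1 (fun i : 'I_n.-1 => phi1 i.+1)
  (fun (i : 'I_n.-1) m => @phi1M i.+1 m (sh i)) phie' b0.
have il : (i.-1 < n.-1)%N by move: (ltn_ord i) i0; rewrite -val_eqE /=; lia.
rewrite -(b'0 (Ordinal il)); congr b; apply/val_inj; rewrite /= /bump /= add1n prednK //.
by rewrite lt0n.
Qed.

End Examples.

(** * The classifications *)

Section CalculiUpToIsomorphism.
Variables (K : fieldType) (q : K) (q0 : q != 0).
Local Notation B := (Bq q0).

Lemma Mset_calc_dim I : root (setpoly q I 0) 1 ->
  calc_dim (calc_of (Mset q0 I)) (\sum_(n <- I) n)%N.-1.
Proof.
move=> r; exists (Mset q0 I); split; [exact: Mset_crossed | exact: calc_iso_refl | exact: Mset_dim].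
Qed.

Lemma Mset_findim I : root (setpoly q I 0) 1 -> findim_calculus B (calc_of (Mset q0 I)).
Proof.
by move=> r; split; [exact/calc_of_bicovariant/Mset_crossed | eexists; exact: Mset_calc_dim].
Qed.

Lemma Mset_iso_inj I J : 0%N \notin I -> 0%N \notin J ->
  root (setpoly q I 0) 1 -> root (setpoly q J 0) 1 ->
  calc_iso B (calc_of (Mset q0 I)) (calc_of (Mset q0 J)) -> I = J.
Proof.
move=> I0 J0 rI rJ /(calc_iso_crossed (Mset_crossed q0 rI) (Mset_crossed q0 rJ)).
exact: Mset_inj.
Qed.

Lemma findim_calculus_classification (G : calculus B) :
  (forall n, \sum_(i < n.+1) q^-1 ^+ i != 0) -> findim_calculus B G ->
  exists I, [/\ 0%N \notin I, root (setpoly q I 0) 1 & calc_iso B G (calc_of (Mset q0 I))].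
Proof.
move=> qs [_ [n [M [Mx GM Mn]]]]; have [sM _ _ _] := Mx.
have [I [I0 e r]] := crossed_classification qs Mx (has_dim_fincodim sM Mn).
by exists I; split=> //; rewrite -e.
Qed.

End CalculiUpToIsomorphism.

Lemma root_setpoly_neq0 (K : fieldType) (q : K) I k x : root (setpoly q I k) x -> I <> fset0.
Proof. by rewrite root_setpoly => /hasP[n nI _] I0; rewrite I0 inE in nI. Qed.

Section Deformation.
Variable K : fieldType.

(** The indeterminate is not a root of unity. *)
Lemma qpar_generic n : (0 < n)%N -> qpar K ^+ n != 1.
Proof.
move=> n0; rewrite -tofracXn -tofrac1 tofrac_eq; apply/eqP => /(congr1 (fun p : {poly K} => size p)).
by rewrite size_polyXn size_poly1; lia.
Qed.

Lemma MqJ_Mset J : MqJ K J = Mset (qpar_neq0 K) (1%N |` J)%fset.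
Proof. by rewrite Mset_gens. Qed.

Lemma LqJ_Lset J : 0%N \notin J -> LqJ K J = Lset (q0 := qpar_neq0 K) J.
Proof.
move=> J0; have XgE i s : qX K ^+ i * qg K s = bmon (qpar_neq0 K) i s.
  by rewrite -[qX K]/(bmon _ 1 0) -[qg K s]/(bmon _ 0 s) bmonX bmonMg add0r.
apply/seteqP; split; apply: lspan_min; try exact: lspan_subspace.
  move=> _ [n nJ [->|[i /andP[i0 il] ->]]]; apply: sub_lspan.
    exists (0%N, 1 - n%:Z); last by rewrite cou_bmon eqxx scale1r.
    by exists n; [rewrite !inE nJ orbT | split=> //=; case: n nJ J0 => [->|]].
  exists (i, 1 - n%:Z); last by rewrite XgE cou_bmon (gtn_eqF i0) scale0r subr0.
  by exists n; [rewrite !inE nJ orbT | split=> //=; lia].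
move=> _ [[i s] [n nJ [/= -> il]] ->]; rewrite cou_bmon.
have [i0|i0] := eqVneq i 0%N; last first.
  rewrite scale0r subr0; apply: sub_lspan; exists n.
    by move: nJ; rewrite !inE => /predU1P[n1|//]; lia.
  by right; exists i; [lia | rewrite XgE].
rewrite i0 scale1r; move: nJ; rewrite !inE => /predU1P[->|nJ].
  by rewrite /bm /= bmon1 subrr; exact: (lspan_subspace _).1.
by apply: sub_lspan; exists n => //; left.
Qed.

End Deformation.

Section Classification.
Variables (k : fieldType) (char0 : [pchar k] =i pred0).
Local Notation q1 := (oner_neq0 k).
Local Notation P1 := (fun I => posfin I /\ 1%N \in I).

Lemma GammaI_bij : bij_onto posfin (GammaI k) (calc_iso (CB k)) (findim_calculus (CB k)).
Proof.
split=> [I Ip|I J Ip Jp|G Gf]; rewrite /GammaI.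
- by rewrite MI_Mset; apply/Mset_findim/MI_root.
- by rewrite !MI_Mset; have [[I0 _] [J0 _]] := (Ip, Jp); apply: Mset_iso_inj => //; exact: MI_root.
have qs n : \sum_(i < n.+1) (1 : k)^-1 ^+ i != 0.
  under eq_bigr do rewrite invr1 expr1n.
  by rewrite sumr_const card_ord (natrK_eq0 char0).
have [I [I0 r GI]] := findim_calculus_classification qs Gf.
by exists I; [split=> //; exact: root_setpoly_neq0 r | rewrite MI_Mset].
Qed.

Lemma LI_bij : bij_onto posfin (LI k) eq (findim_tangent (UB k)).
Proof.
split=> [I Ip|I J Ip Jp|L [Lt [N LN]]].
- by split; [exact: LI_tangent | eexists; exact: LI_dim].
- exact: LI_inj.
by have [I Ip ->] := ub_tangent_stairs char0 Lt LN; exists I => //; rewrite LI_aug.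
Qed.

Let addone I : 1%N \in I -> (1%N |` (I `\ 1%N))%fset = I. Proof. exact: fsetD1K. Qed.

Let inj1 I J : 1%N \in I -> 1%N \in J -> (I `\ 1%N)%fset = (J `\ 1%N)%fset -> I = J.
Proof. by move=> I1 J1 e; rewrite -(addone I1) e addone. Qed.

Let root1 I : P1 I -> root (setpoly (qpar k) I 0) 1.
Proof. by move=> [[I0 _] I1]; rewrite (root_setpoly_generic (qpar_neq0 k) (@qpar_generic k)). Qed.

Lemma GammaI_corresponds : corresponds P1 (GammaI k) (calc_iso (CB k))
  (fun I => GammaqJ k (I `\ 1%N)%fset) (calc_iso (CqB k)) (findim_calculus (CqB k)).
Proof.
have E I : P1 I -> GammaqJ k (I `\ 1%N)%fset = calc_of (Mset (qpar_neq0 k) I).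
  by move=> [_ I1]; rewrite /GammaqJ MqJ_Mset addone.
split=> [I Ip|I J Ip Jp|G Gf].
- by rewrite E //; exact/Mset_findim/root1.
- rewrite !E //; split=> [|h].
    by have [_ inj _] := GammaI_bij; move/(inj _ _ Ip.1 Jp.1) ->; exact: calc_iso_refl.
  have [[[I0 _] _] [[J0 _] _]] := (Ip, Jp).
  by rewrite (Mset_iso_inj I0 J0 (root1 Ip) (root1 Jp) h); exact: calc_iso_refl.
have [I [I0 r GI]] := findim_calculus_classification (qgen_sum (@qpar_generic k)) Gf.
have I1 : 1%N \in I by rewrite -(root_setpoly_generic (qpar_neq0 k) (@qpar_generic k)).
have Ip : P1 I by split=> //; split=> //; exact: root_setpoly_neq0 r.
by exists I; rewrite // E.
Qed.

Lemma LI_corresponds : corresponds P1 (LI k) eq (fun I => LqJ k (I `\ 1%N)%fset) eq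
  (findim_tangent (CqB k)).
Proof.
have E I : P1 I -> LqJ k (I `\ 1%N)%fset = Lset (q0 := qpar_neq0 k) (I `\ 1%N)%fset.
  by move=> [[I0 _] _]; apply: LqJ_Lset; rewrite !inE (negPf I0) andbF.
split=> [I Ip|I J Ip Jp|L [Lt [N LN]]].
- by rewrite E //; split; [exact: Lset_tangent | exact: Lset_findim].
- rewrite !E //; split=> [/(LI_inj Ip.1 Jp.1) -> //|h].
  have [[[I0 _] I1] [[J0 _] J1]] := (Ip, Jp); congr LI; apply: inj1 => //.
  by apply: Lset_inj h; rewrite !inE ?(negPf I0) ?(negPf J0) ?andbF.
have [J [J0 J1 ->]] := bq_tangent_classification (@qpar_generic k) Lt LN.
have Jp : P1 (1%N |` J)%fset.
  split; last by rewrite !inE eqxx.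
  split; first by rewrite !inE.
  by apply/eqP/fset0Pn; exists 1%N; rewrite !inE eqxx.
by exists (1%N |` J)%fset; rewrite // E // fsetU1K.
Qed.

End Classification.

(** * The main result *)

Theorem proposition3p5 (k : fieldType) (char0 : [pchar k] =i pred0) :
  (* (a) *)
  [/\ bij_onto posfin (GammaI k) (calc_iso (CB k)) (findim_calculus (CB k)),
      bij_onto posfin (LI k) eq (findim_tangent (UB k)),
      forall I, posfin I -> LI k I = tangent_of CU_pair (MI k I),
      forall I, posfin I ->
        calc_dim (GammaI k I) (\sum_(n <- I) n)%N.-1 /\
        has_dim (LI k I) (\sum_(n <- I) n)%N.-1 &
      corresponds (fun I => posfin I /\ 1%N \in I)
        (GammaI k) (calc_iso (CB k))
        (fun I => GammaqJ k (I `\ 1%N)%fset) (calc_iso (CqB k))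
        (findim_calculus (CqB k)) /\
      corresponds (fun I => posfin I /\ 1%N \in I)
        (LI k) eq
        (fun I => LqJ k (I `\ 1%N)%fset) eq
        (findim_tangent (CqB k))] /\
  forall n : nat, (2 <= n)%N ->
  exists (eta : nat -> aug_quot (MI k [fset 1%N; n]%fset)) (phi : nat -> UB k),
  (* (b) *)
  [/\ calc_dim (GammaI k [fset 1%N; n]%fset) n,
      coirreducible (GammaqJ k [fset n]%fset) /\ calc_dim (GammaqJ k [fset n]%fset) n,
      is_basis [set: aug_quot (MI k [fset 1%N; n]%fset)] (fun i : 'I_n => eta i),
      [/\ dd (GammaI k [fset 1%N; n]%fset) CX =
            rinv (eta 1%N) + ract (rinv (eta 0%N)) CX,
          dd (GammaI k [fset 1%N; n]%fset) (Cg 1) = ract (rinv (eta 0%N)) (Cg 1),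
          forall i, (i < n)%N -> rcomm (Cg 1) (rinv (eta i)) = 0,
          forall i, (i = 0%N \/ i = n.-1) -> rcomm CX (rinv (eta i)) = 0 &
          forall i, (0 < i < n.-1)%N -> rcomm CX (rinv (eta i)) = rinv (eta i.+1)] &
      [/\ is_basis (LI k [fset 1%N; n]%fset) (fun i : 'I_n => phi i),
          forall i j, (i < n)%N -> (j < n)%N ->
            qpair CU_pair (phi i) (eta j) = (i == j)%:R,
          forall i f, (1 <= i < n)%N ->
            partial CU_pair (phi i) f = (i`!%:R)^-1 *: iter i (@ddX k) f &
          forall f, partial CU_pair (phi 0%N) f = CX * ddX f + Cg 1 * ddg f]] /\
  (* (c) *)
  exists (eta' : nat -> aug_quot (MI k [fset n]%fset))
    (p : forms (GammaI k [fset 1%N; n]%fset) -> forms (GammaI k [fset n]%fset)),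
  [/\ calc_dim (GammaI k [fset n]%fset) n.-1,
      [/\ calc_quotient_map p,
          forall w, p w = 0 <-> (exists a, w = ract (rinv (eta 0%N)) a) &
          forall i, (1 <= i < n)%N -> p (rinv (eta i)) = rinv (eta' i)],
      is_basis [set: aug_quot (MI k [fset n]%fset)] (fun i : 'I_n.-1 => eta' i.+1),
      [/\ dd (GammaI k [fset n]%fset) CX = rinv (eta' 1%N),
          dd (GammaI k [fset n]%fset) (Cg 1) = 0,
          forall i, (1 <= i < n)%N -> rcomm (Cg 1) (rinv (eta' i)) = 0,
          forall i, (1 <= i < n.-1)%N -> rcomm CX (rinv (eta' i)) = rinv (eta' i.+1) &
          rcomm CX (rinv (eta' n.-1)) = 0] &
      [/\ is_basis (LI k [fset n]%fset) (fun i : 'I_n.-1 => phi i.+1),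
          forall i j, (1 <= i < n)%N -> (1 <= j < n)%N ->
            qpair CU_pair (phi i) (eta' j) = (i == j)%:R &
          forall i f, (1 <= i < n)%N ->
            partial CU_pair (phi i) f = (i`!%:R)^-1 *: iter i (@ddX k) f]].
Proof.
split.
  split; [exact: GammaI_bij | exact: LI_bij | move=> I; exact: LI_tangent_of | |].
    move=> I Ip; split; last exact: LI_dim.
    by rewrite /GammaI MI_Mset; apply/Mset_calc_dim/MI_root.
  by split; [exact: GammaI_corresponds | exact: LI_corresponds].
move=> n n2; set I2 := [fset 1%N; n]%fset; set I1 := [fset n]%fset.
have [Ip2 Ip1] := (posfin_fset2 n2, posfin_fset1 n2).
have c20 : (cI I2 0 <= 2)%N by rewrite cI_fset2 // (ltnW n2).
have c2 j : (0 < j)%N -> cI I2 j = (j < n)%N by move=> j0; rewrite cI_fset2 // ltnNge j0.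
have c1 j : (0 < j)%N -> cI I1 j = (j < n)%N by move=> _; rewrite cI_fset1.
have c11 : cI I1 0 = 1%N by rewrite cI_fset1 (ltnW n2).
have c10 : (cI I1 0 <= 2)%N by rewrite c11.
have d2 : calc_dim (GammaI k I2) n.
  exists (MI k I2); split; [exact: MI_crossed | exact: calc_iso_refl |].
  by have := MI_dim k Ip2; rewrite sum_fset2 // add1n.
have qc : GammaqJ k I1 = calc_of (Mset (qpar_neq0 k) I2) by rewrite /GammaqJ MqJ_Mset.
have r2 : root (setpoly (qpar k) I2 0) 1.
  rewrite (root_setpoly_generic (qpar_neq0 k) (@qpar_generic k) Ip2.1).
  by rewrite !inE.
pose eta i := aug_class (MI k I2) (form_rep k i).
pose eta' i := aug_class (MI k I1) (form_rep k i).
have rinv0 I : rinv (0 : aug_quot (MI k I)) = 0 := is_linear0 ((tens_is_bilinear _ _).1 _).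
have nE : n.-1.+1 = n := prednK (ltnW n2).
have calc0 : rinv (eta' 0%N) = 0.
  by rewrite /eta' (form_rep_0 k Ip1 c11).
have ract0 a : ract (0 : forms (GammaI k I1)) a = 0.
  by have [h _] := ract_is_bilinear (MI k I1); exact: is_linear0 (h a).
exists eta, (@dual_vec k); split; last first.
  exists eta', (calc_proj (MI k I1)); split.
  - exists (MI k I1); split; [exact: MI_crossed | exact: calc_iso_refl |].
    by have := MI_dim k Ip1; rewrite big_seq_fset1.
  - split; first exact: (calc_proj_quotient (MI_crossed k Ip2) (MI_crossed k Ip1) (@MI_fset_sub k n n2)).
      exact: (form_proj_ker char0 n2).
    by move=> i _; exact: form_proj.
  - exact: form_basis1.
  - split.
    + by rewrite (form_rep_dX k Ip1) -/(eta' 0%N) calc0 ract0 addr0.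
    + by rewrite (form_rep_dg k Ip1) -/(eta' 0%N) calc0 ract0.
    + by move=> i _; exact: (form_rep_g k Ip1 c10 c1).
    + by move=> i /andP[i0 _]; exact: (form_rep_X k Ip1 c1).
    rewrite (form_rep_X k Ip1 c1) ?nE; last by rewrite -ltnS nE.
    by rewrite (form_rep_n k Ip1 n2 c1) rinv0.
  split; first exact: dual_basis1.
    by move=> i j il _; exact: dual_qpair1.
  by move=> i f /andP[i0 _]; exact: partial_dual_vec.
split; [exact: d2 | | exact: form_basis2 | |].
- rewrite qc; split; first exact: (Mset_coirreducible _ (@qpar_generic k) n2).
  by have := Mset_calc_dim (qpar_neq0 k) r2; rewrite sum_fset2 // add1n.
- split.
  + exact: (form_rep_dX k Ip2).
  + exact: (form_rep_dg k Ip2).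
  + by move=> i _; exact: (form_rep_g k Ip2 c20 c2).
  + move=> i [->|->]; first exact: (form_rep_X0 k Ip2 n2 c20 c2).
    rewrite (form_rep_X k Ip2 c2) ?nE; last by rewrite -ltnS nE.
    by rewrite (form_rep_n k Ip2 n2 c2) rinv0.
  by move=> i /andP[i0 _]; exact: (form_rep_X k Ip2 c2).
split; first exact: dual_basis2.
- by move=> i j il _; exact: dual_qpair2.
- by move=> i f /andP[i0 _]; exact: partial_dual_vec.
exact: partial_H.
Qed.
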